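(* Any two extensions of a gluing isometry have the same field of definition.
   Context: All manifolds are connected, hyperbolic and complete of finite volume; a manifold with boundary has totally geodesic boundary whose components are themselves of finite volume. Gluing isometry: an isometry $\varphi:N_1\to N_2$, where $N_1\subset\partial M_1$ and $N_2\subset\partial M_2$ are boundary components of manifolds with boundary $M_1,M_2$ of dimension $n$ (interbreeding case), or $N_1,N_2$ are two boundary components of one manifold with boundary $M_1$, in which case we set $M_2=M_1$ (closing up case). Trace field and ambient group: an $n$-dimensional manifold $M$ with (possibly empty) boundary can be written $M=\Gamma\backslash\widetilde M$, where $\widetilde M$ is $\mathbf{H}^n$ or an intersection of half-spaces in $\mathbf{H}^n$ and $\Gamma\subset \mathrm{PO}(n,1)=\mathrm{Isom}(\mathbf{H}^n)$ is discrete, torsion-free and stabilizes $\widetilde M$. Its (adjoint) trace field is $k=\mathbb{Q}(\{\operatorname{tr}\operatorname{Ad}\gamma\mid\gamma\in\Gamma\})\subset\mathbb{R}$. It is (Vinberg) the smallest field $k$ for which there are an algebraic $k$-group $\mathbf G$ and an isomorphism $\mathbf G(\mathbb{R})\cong \mathrm{PO}(n,1)^\circ$ carrying $\Gamma\cap\mathrm{PO}(n,1)^\circ$ into $\mathbf G(k)$. If $M$ contains, in its interior or boundary, an immersed finite-volume totally geodesic hypersurface, then $\mathbf G=\mathbf{PO}_f^\circ$ for a quadratic form $f$ over $k$ of signature $(n,1)$, and the isomorphism extends to $\mathbf{PO}_f(\mathbb{R})\cong\mathrm{PO}(n,1)$ with $\Gamma$ mapped into $\mathbf{PO}_f(k)$.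 Models: for $f$ of signature $(n,1)$ let $\mathbf{H}_f=\{x\in\mathbb{R}^{n+1}\mid f(x)=-1\}/\{\pm1\}$, a model of hyperbolic space with isometry group $\mathbf{PO}_f(\mathbb{R})$. A model for $M$ (with trace field $k$) is a choice of universal cover $\widetilde M\subset\mathbf{H}_f$ and monodromy representation $\Gamma\subset\mathbf{PO}_f(k)$, $f$ a form over $k$, with $M=\Gamma\backslash\widetilde M$. The hyperplanes in $\partial\widetilde M$ forming the preimage of a boundary component $N\subset\partial M$ are called hyperplane lifts of $N$. Extensions and their field of definition: for $i=1,2$ let $k_i$ be the trace field of $M_i$, choose models $\widetilde M_i\subset\mathbf{H}_{f_i}$ with $\Gamma_i\subset\mathbf{PO}_{f_i}(k_i)$ and hyperplane lifts $R_i\subset\partial\widetilde M_i$ of $N_i$ (different models may be chosen even if $M_1=M_2$). An extension of $\varphi$ is an isometry $\phi:\mathbf{H}_{f_1}\to\mathbf{H}_{f_2}$ with $\phi(R_1)=R_2$ such that $\phi|_{R_1}$ composed with the covering $R_2\to N_2$ equals the covering $R_1\to N_1$ composed with $\varphi$. Such $\phi$ is induced by some $A_\phi\in\mathbf{GL}_{n+1}(\mathbb{R})$ with $f_2\circ A_\phi=f_1$. Let $k=k_1k_2$ be the compositum. Conjugation by $A_\phi$ induces an isomorphism of algebraic groups $\Phi:(\mathbf{PO}_{f_1,k})_{\mathbb{R}}\to(\mathbf{PO}_{f_2,k})_{\mathbb{R}}$. The field of definition of $\phi$ is the smallest field $K$ with $k\subset K\subset\mathbb{R}$ over which $\Phi$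 is defined. The two extensions in the statement may be defined using different models and different hyperplane lifts. *)

(* Defs.v *)
From HB Require Import structures.
From mathcomp Require Import all_boot all_order all_algebra.
From mathcomp Require Import all_classical all_reals all_analysis.

Set Implicit Arguments.
Unset Strict Implicit.
Unset Printing Implicit Defensive.

Import Order.TTheory GRing.Theory Num.Theory.
Import numFieldNormedType.Exports.

Local Open Scope classical_set_scope.
Local Open Scope ring_scope.

Definition is_subfield (R : realType) (K : set R) : Prop :=
  GRing.divring_closed (fun x : R => x \in K).

(* The smallest subfield of R containing S. *)
Definition gen_field (R : realType) (S : set R) : set R :=
  smallest (@is_subfield R) S.

Definition compositum (R : realType) (k1 k2 : set R) : set R :=
  gen_field (k1 `|` k2).

(** ** Quadratic forms *)

(* A quadratic form on R^(n+1) is given by its symmetric Gram matrix F. *)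
Definition bil (R : realType) (n : nat) (F : 'M[R]_n) (x y : 'cV[R]_n) : R :=
  (x^T *m F *m y) ord0 ord0.

Definition qf (R : realType) (n : nat) (F : 'M[R]_n) (x : 'cV[R]_n) : R :=
  bil F x x.

(* A is in GL and f2 o A = f1. *)
Definition form_iso (R : realType) (n : nat) (F1 F2 A : 'M[R]_n) : Prop :=
  A \in unitmx /\ forall x, qf F2 (A *m x) = qf F1 x.

(* The real points of the orthogonal group O_f. *)
Definition orth (R : realType) (n : nat) (F : 'M[R]_n) : set 'M[R]_n :=
  [set X | form_iso F F X].

(* x_0^2 + ... + x_(n-1)^2 - x_n^2 *)
Definition lorentz (R : realType) (n : nat) : 'M[R]_n.+1 :=
  diag_mx (\row_(j < n.+1) (if j == ord_max then -1 else 1)).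

(** ** The algebraic group PO_f = O_f / {1, -1}

   For f of signature (n,1) with n >= 2, PO_f(R) = O_f(R) / {1, -1}, and a
   point of PO_f(R) is represented by either of its two lifts X in O_f(R). *)

(* X represents a point of PO_f(k).  As PO_f is a closed k-subgroup of PGL,
   this means that the class of X lies in PGL(k) = GL(k) / k^*; in general X
   itself cannot be chosen with entries in k. *)
Definition po_rational (R : realType) (n : nat) (k : set R) (X : 'M[R]_n) :
    Prop :=
  exists2 c : R, c != 0 & forall i j, k (c * X i j).

(* Polynomials over K in the products X_ij X_kl, as functions of a real
   matrix.  The coordinate ring of PO_f is the ring of invariants of
   {1, -1} in that of O_f, hence is generated by these products.  As
   O_f(R) is Zariski-dense in O_f, the restrictions of
   these functions to O_f(R) form the coordinate ring K[PO_f], for every field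
   K over which f is defined. *)
Inductive regular_on_PO (R : realType) (n : nat) (K : set R) :
    ('M[R]_n -> R) -> Prop :=
| regular_cst c : K c -> regular_on_PO K (fun=> c)
| regular_gen i j k l : regular_on_PO K (fun X => X i j * X k l)
| regular_add g h : regular_on_PO K g -> regular_on_PO K h ->
    regular_on_PO K (fun X => g X + h X)
| regular_mul g h : regular_on_PO K g -> regular_on_PO K h ->
    regular_on_PO K (fun X => g X * h X).

(* The morphism of real algebraic groups PO_f1 -> PO_f2, X |-> A X A^-1, is
   defined over K: its comorphism maps K[PO_f2] into K[PO_f1]. *)
Definition conj_defined_over (R : realType) (n : nat) (F1 A : 'M[R]_n)
    (K : set R) : Prop :=
  forall h, regular_on_PO K h ->
  exists2 g, regular_on_PO K g &
    forall X, orth F1 X -> h (A *m X *m invmx A) = g X.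

(** ** Hyperbolic space *)

(* H^n as the upper sheet of the hyperboloid. *)
Definition Hyp (R : realType) (n : nat) : set 'cV[R]_n.+1 :=
  [set x | qf (lorentz R n) x = -1 /\ 0 < x ord_max ord0].

(* cosh (hdist x y) = - bil x y *)
Definition hdist (R : realType) (n : nat) (x y : 'cV[R]_n.+1) : R :=
  let c := - bil (lorentz R n) x y in ln (c + Num.sqrt (c ^+ 2 - 1)).

(* PO(n,1) = Isom(H^n), as the group of elements of O(n,1) preserving the
   upper sheet. *)
Definition IsomH (R : realType) (n : nat) : set 'M[R]_n.+1 :=
  [set g | orth (lorentz R n) g /\ forall x, Hyp x -> Hyp (g *m x)].

(* v is a unit normal of a hyperplane of H^n *)
Definition unit_normal (R : realType) (n : nat) (v : 'cV[R]_n.+1) : Prop :=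
  qf (lorentz R n) v = 1.

Definition hyperplane (R : realType) (n : nat) (v : 'cV[R]_n.+1) :
    set 'cV[R]_n.+1 :=
  [set x | Hyp x /\ bil (lorentz R n) x v = 0].

Definition half_space (R : realType) (n : nat) (v : 'cV[R]_n.+1) :
    set 'cV[R]_n.+1 :=
  [set x | Hyp x /\ bil (lorentz R n) x v <= 0].

(** ** Volume *)

(* Lebesgue outer measure on R^d. *)
Definition leb_outer (R : realType) (d : nat) (S : set 'cV[R]_d) : \bar R :=
  ereal_inf [set e : \bar R | exists a b : nat -> 'cV[R]_d,
    [/\ forall k i, a k i ord0 <= b k i ord0,
        S `<=` \bigcup_k
          [set c | forall i, a k i ord0 <= c i ord0 <= b k i ord0] &
        e = (\sum_(0 <= k <oo)
               (\prod_(i < d) (b k i ord0 - a k i ord0))%:E)%E]].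

(* The columns of L are a basis of a subspace W of R^(n+1) of dimension d, and
   D lies in the (d-1)-dimensional hyperbolic space formed by W and H^n.  Up to
   a positive constant depending on L only, the hyperbolic (outer) volume of D
   is the Lebesgue measure, in the coordinates L, of the cone with apex 0
   over D. *)
Definition hvol (R : realType) (n d : nat) (L : 'M[R]_(n.+1, d))
    (D : set 'cV[R]_n.+1) : \bar R :=
  leb_outer [set c | exists2 x, D x &
                     exists2 t : R, 0 < t <= 1 & L *m c = t *: x].

(* The quotient of X by G has finite volume: X is covered by the translates
   of a subset of finite volume. *)
Definition finite_covolume (R : realType) (n d : nat) (L : 'M[R]_(n.+1, d))
    (G : set 'M[R]_n.+1) (X : set 'cV[R]_n.+1) : Prop :=
  exists2 D : set 'cV[R]_n.+1, D `<=` X /\ (hvol L D < +oo)%E &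
    forall x, X x -> exists g y, [/\ G g, D y & x = g *m y].

(** ** Manifolds *)

Definition setwise_stab (R : realType) (n : nat) (G : set 'M[R]_n.+1)
    (X : set 'cV[R]_n.+1) : set 'M[R]_n.+1 :=
  [set g | G g /\ (mulmx g) @` X = X].

(* v is the outward unit normal of a hyperplane contained in the boundary of
   the universal cover C *)
Definition boundary_normal (R : realType) (n : nat) (C : set 'cV[R]_n.+1)
    (v : 'cV[R]_n.+1) : Prop :=
  [/\ unit_normal v, hyperplane v `<=` C & C `<=` half_space v].

(* A connected complete hyperbolic n-manifold of finite volume with (possibly
   empty) totally geodesic boundary, all of whose boundary components have
   finite volume, given as the quotient of cover by grp. *)
Record hyp_manifold (R : realType) (n : nat) := HypManifold {
  cover : set 'cV[R]_n.+1;
  grp : set 'M[R]_n.+1;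
  _ : cover !=set0;
  (* H^n itself is the case where V is empty *)
  _ : exists V : set 'cV[R]_n.+1, V `<=` @unit_normal R n /\
        cover = @Hyp R n `&` \bigcap_(v in V) half_space v;
  (* each point of the cover is interior, or has a neighbourhood in which the
     cover is a half-space *)
  _ : forall x, cover x ->
        (\forall y \near x, Hyp y -> cover y) \/
        (exists v, [/\ unit_normal v, hyperplane v x &
           \forall y \near x, Hyp y -> (cover y <-> half_space v y)]);
  _ : grp `<=` @IsomH R n;
  _ : grp 1;
  _ : forall g h, grp g -> grp h -> grp (g * h);
  _ : forall g, grp g -> grp (invmx g);
  _ : \forall g \near (1 : 'M[R]_n.+1), grp g -> g = 1;
  _ : forall g (m : nat), grp g -> (0 < m)%N -> g ^+ m = 1 -> g = 1;
  _ : forall g, grp g -> (mulmx g) @` cover = cover;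
  _ : finite_covolume (1%:M : 'M[R]_n.+1) grp cover;
  _ : forall v, boundary_normal cover v ->
        exists L : 'M[R]_(n.+1, n),
          [/\ \rank L = n, v^T *m lorentz R n *m L = 0 &
              finite_covolume L (setwise_stab grp (hyperplane v))
                (hyperplane v)]
}.

(* Points of M are the orbits of grp M in cover M. *)
Definition proj (R : realType) (n : nat) (M : hyp_manifold R n)
    (x : 'cV[R]_n.+1) : set 'cV[R]_n.+1 :=
  [set y | exists2 g, grp M g & y = g *m x].

(* P is a hyperplane of H^n in the preimage of the boundary component N *)
Definition lifts_to (R : realType) (n : nat) (M : hyp_manifold R n)
    (N : set (set 'cV[R]_n.+1)) (P : set 'cV[R]_n.+1) : Prop :=
  exists v, [/\ boundary_normal (cover M) v, P = hyperplane v &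
                proj M @` P = N].

Definition boundary_component (R : realType) (n : nat) (M : hyp_manifold R n)
    (N : set (set 'cV[R]_n.+1)) : Prop :=
  exists P, lifts_to M N P.

(* The intrinsic distance of a boundary component N. *)
Definition dist_boundary (R : realType) (n : nat) (M : hyp_manifold R n)
    (N : set (set 'cV[R]_n.+1)) (p q : set 'cV[R]_n.+1) : R :=
  inf [set r | exists P x y, [/\ lifts_to M N P, P x /\ p x, P y /\ q y &
                                 r = hdist x y]].

(* Interbreeding of M1 and M2; closing up is the case M2 = M1. *)
Definition gluing_isometry (R : realType) (n : nat) (M1 M2 : hyp_manifold R n)
    (N1 N2 : set (set 'cV[R]_n.+1))
    (phi : set 'cV[R]_n.+1 -> set 'cV[R]_n.+1) : Prop :=
  [/\ boundary_component M1 N1, boundary_component M2 N2,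
      set_bij N1 N2 phi &
      forall p q, N1 p -> N1 q ->
        dist_boundary M2 N2 (phi p) (phi q) = dist_boundary M1 N1 p q].

(** ** Trace field *)

(* The Lie algebra of O_f, as the row space of a matrix (via mxvec). *)
Definition lie_so (R : realType) (n : nat) (F : 'M[R]_n) : 'M[R]_(n * n) :=
  kermx (lin_mx (fun Y : 'M[R]_n => Y^T *m F + F *m Y)).

Definition trace_Ad (R : realType) (n : nat) (F X : 'M[R]_n) : R :=
  \tr (restrictmx (lie_so F) (lin_mx (fun Y : 'M[R]_n => X *m Y *m invmx X))).

Definition trace_field (R : realType) (n : nat) (M : hyp_manifold R n) :
    set R :=
  gen_field [set trace_Ad (lorentz R n) g | g in grp M].

(** ** Models

   H_f = {f = -1} / {1, -1}; its points are represented by their two lifts and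
   its subsets by subsets of {f = -1} invariant under -1. *)

(* The identification of the model with M lifts to an isometry of universal
   covers, hence is induced by a linear map dev carrying the Lorentz form to f;
   the universal cover and the monodromy group of the model are the image of
   cover M and the conjugate of grp M under dev.  The existence of dev
   implies that f has signature (n,1). *)
Record model (R : realType) (n : nat) (M : hyp_manifold R n) := Model {
  form : 'M[R]_n.+1;
  dev : 'M[R]_n.+1;
  _ : form^T = form;
  _ : forall i j, trace_field M (form i j);
  _ : form_iso (lorentz R n) form dev;
  _ : forall g, grp M g ->
        po_rational (trace_field M) (dev *m g *m invmx dev)
}.

(* The subset of H_f corresponding to X in the upper sheet of H^n. *)
Definition in_model (R : realType) (n : nat) (M : hyp_manifold R n)
    (m : model M) (X : set 'cV[R]_n.+1) : set 'cV[R]_n.+1 :=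
  [set y | exists2 x, X x & y = dev m *m x \/ y = - (dev m *m x)].

Definition hyperplane_lift (R : realType) (n : nat) (M : hyp_manifold R n)
    (m : model M) (N : set (set 'cV[R]_n.+1)) (P : set 'cV[R]_n.+1) : Prop :=
  exists2 Q, lifts_to M N Q & P = in_model m Q.

(* The covering from the universal cover in H_f to M: a point y = dev x or
   - dev x, with x in the upper sheet, goes to the orbit of x. *)
Definition model_proj (R : realType) (n : nat) (M : hyp_manifold R n)
    (m : model M) (y : 'cV[R]_n.+1) : set 'cV[R]_n.+1 :=
  [set z | exists x, [/\ Hyp x, y = dev m *m x \/ y = - (dev m *m x) &
                         proj M x z]].

(** ** Extensions *)

(* The isometry of H_f1 onto H_f2 induced by A is an extension of phi, with
   respect to the hyperplane lifts R1 and R2. *)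
Definition is_extension (R : realType) (n : nat) (M1 M2 : hyp_manifold R n)
    (N1 N2 : set (set 'cV[R]_n.+1))
    (phi : set 'cV[R]_n.+1 -> set 'cV[R]_n.+1)
    (m1 : model M1) (m2 : model M2) (R1 R2 : set 'cV[R]_n.+1)
    (A : 'M[R]_n.+1) : Prop :=
  [/\ hyperplane_lift m1 N1 R1 /\ hyperplane_lift m2 N2 R2,
      form_iso (form m1) (form m2) A,
      (mulmx A) @` R1 = R2 &
      forall x, R1 x -> model_proj m2 (A *m x) = phi (model_proj m1 x)].

Definition definition_field_candidate (R : realType) (n : nat)
    (M1 M2 : hyp_manifold R n) (m1 : model M1) (A : 'M[R]_n.+1)
    (K : set R) : Prop :=
  [/\ is_subfield K, compositum (trace_field M1) (trace_field M2) `<=` K &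
      conj_defined_over (form m1) A K].

(* K is the field of definition of the isometry of H_f1 onto H_f2 induced
   by A. *)
Definition is_field_of_definition (R : realType) (n : nat)
    (M1 M2 : hyp_manifold R n) (m1 : model M1) (m2 : model M2)
    (A : 'M[R]_n.+1) (K : set R) : Prop :=
  [/\ form_iso (form m1) (form m2) A,
      definition_field_candidate M2 m1 A K &
      forall K', definition_field_candidate M2 m1 A K' -> K `<=` K'].

(* Main.v *)
Require Import Defs.
From HB Require Import structures.
From mathcomp Require Import all_boot all_order all_algebra.
From mathcomp Require Import all_classical all_reals all_analysis.
From mathcomp Require Import measurable_realfun.
From mathcomp Require Import ring lra.

Set Implicit Arguments.
Unset Strict Implicit.
Unset Printing Implicit Defensive.

Import Order.TTheory GRing.Theory Num.Theory.
Import numFieldNormedType.Exports.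

Local Open Scope classical_set_scope.
Local Open Scope ring_scope.


(** Let B and B' be the isometries of the Lorentz form that two extensions A and A'
of the gluing isometry induce in the Lorentz coordinates of M1 and M2. Each of them
covers the gluing isometry on a boundary hyperplane of the universal cover of M1.
These two hyperplanes lie over the same boundary component, so a deck transformation
g1 carries one to the other ([lifts_conjugate]). After this correction B and B' agree
on the hyperplane, at each point, up to sign and a deck transformation of M2, and a
single deck transformation g2 serves for all points ([uniform_deck]). An isometry is
determined by its restriction to a hyperplane up to the reflection in it, and hence
A' = P A Q, where P and Q are products of changes of models, deck transformations
and possibly the reflection in a boundary hyperplane ([extensions_related]). If P and
Q are rational over the trace fields, conjugation by A is defined over a field
containing these exactly when conjugation by A' is ([conj_defined_transfer]).

Deck transformations are rational by the definition of a model. For the reflections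
and the changes of models everything rests on the normals of the faces of the
universal cover:

- up to a scalar, the normal v of a boundary hyperplane is a rational vector of every
  model ([normal_rational]). It spans the common fixed space of the squares of the
  elements stabilizing the hyperplane ([stab_fixed]), and these squares are matrices
  over the trace field, without a scalar ([po_rational_sqr]). A line cut out by linear
  equations over a field is spanned by a vector over that field ([rational_line]);

- the normals span the whole space ([boundary_normals_span]) and no two of them are
  orthogonal ([boundary_normal_sep]). A basis of normals therefore gives bases of two
  models, rational up to scalars that are determined up to a common factor
  ([model_change_rational]).

The two facts about fixed vectors and spans express that the boundary components and
the manifold have finite volume. They replace the Zariski density of lattices, and are
proved by packing. If they failed, there would be a geodesic along which the injectivity
radius does not decrease, running through the interior of the cover or inside a boundary
hyperplane ([no_expanding_geodesic], [no_invariant_null]). Points far apart on such a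
geodesic are centres of balls of a fixed radius with disjoint translates, and a quotient
of finite volume contains a bounded number of these ([packing]). The volume comparison
uses that the Lebesgue outer measure is countably subadditive, is preserved by linear
maps of determinant 1 or -1 ([leb_outer_image]), gives boxes their usual volume
([leb_outer_box]) and makes them measurable ([box_caratheodory]). *)

(** * Lebesgue outer measure *)

Definition box (R : realType) (d : nat) (a b : 'cV[R]_d) : set 'cV[R]_d :=
  [set c | forall i, a i ord0 <= c i ord0 <= b i ord0].

Definition box_vol (R : realType) (d : nat) (a b : 'cV[R]_d) : R :=
  \prod_(i < d) (b i ord0 - a i ord0).

Lemma box_vol_ge0 (R : realType) (d : nat) (a b : 'cV[R]_d) :
  (forall i, a i ord0 <= b i ord0) -> 0 <= box_vol a b.
Proof. by move=> ab; apply: prodr_ge0 => i _; rewrite subr_ge0. Qed.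

Lemma leb_outer_le_cover (R : realType) (d : nat) (S : set 'cV[R]_d)
    (a b : nat -> 'cV[R]_d) :
  (forall k i, a k i ord0 <= b k i ord0) -> S `<=` \bigcup_k box (a k) (b k) ->
  (leb_outer S <= \sum_(0 <= k <oo) (box_vol (a k) (b k))%:E)%E.
Proof. by move=> ab Sab; apply: ereal_inf_lbound; exists a, b. Qed.

Lemma leb_outer_ge0 (R : realType) (d : nat) (S : set 'cV[R]_d) :
  (0 <= leb_outer S)%E.
Proof.
apply: le_ereal_inf_tmp => e [a [b [ab _ ->]]].
by apply: nneseries_ge0 => k _ _; rewrite lee_fin; exact: box_vol_ge0.
Qed.

Lemma le_leb_outer (R : realType) (d : nat) :
  {homo @leb_outer R d : A B / A `<=` B >-> (A <= B)%E}.
Proof.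
move=> A B AB; apply: le_ereal_inf_tmp => e [a [b [ab Bab ->]]].
by apply: leb_outer_le_cover => //; exact: subset_trans Bab.
Qed.

Lemma leb_outer_box_le (R : realType) (d : nat) (S : set 'cV[R]_d.+1)
    (a b : 'cV[R]_d.+1) :
  (forall i, a i ord0 <= b i ord0) -> S `<=` box a b ->
  (leb_outer S <= (box_vol a b)%:E)%E.
Proof.
move=> ab Sab; pose b' k := if k is 0%N then b else a.
apply: (le_trans (@leb_outer_le_cover _ _ _ (fun=> a) b' _ _)).
- by case.
- by move=> x /Sab xab; exists 0%N.
rewrite nneseries_recl//=; last first.
  by move=> k _; rewrite lee_fin box_vol_ge0//; case: k.
rewrite eseries_cond/= eseries0 ?adde0// => -[|k]//= _ _.
by rewrite /box_vol big_ord_recl subrr mul0r.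
Qed.

Lemma leb_outer0 (R : realType) (d : nat) :
  leb_outer (set0 : set 'cV[R]_d.+1) = 0%E.
Proof.
apply/eqP; rewrite eq_le leb_outer_ge0 andbT.
apply: (le_trans (@leb_outer_box_le _ _ _ 0 0 _ _)) => //.
by rewrite /box_vol big_ord_recl subrr mul0r.
Qed.

(** Near-optimal covers of the members of the sequence, with errors e / 2^(k+1),
are merged into one sequence of boxes along a bijection of nat * nat with nat. *)
Lemma leb_outer_sigma_subadditive (R : realType) (d : nat) :
  sigma_subadditive (@leb_outer R d.+1).
Proof.
move=> A; have [[k Ak]|fin] := pselect (exists k, leb_outer (A k) = +oo%E).
  rewrite (eseries_pinfty _ _ Ak) ?leey// => j _.
  by rewrite gt_eqF// (lt_le_trans ltNy0 (leb_outer_ge0 _)).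
apply/lee_addgt0Pr => e e0.
have cov k : exists p : (nat -> 'cV[R]_d.+1) * (nat -> 'cV[R]_d.+1),
    [/\ forall j i, p.1 j i ord0 <= p.2 j i ord0,
        A k `<=` \bigcup_j box (p.1 j) (p.2 j) &
        (\sum_(j <oo) (box_vol (p.1 j) (p.2 j))%:E <=
          leb_outer (A k) + (e / (2 ^ k.+1)%:R)%:E)%E].
  have e'0 : 0 < e / (2 ^ k.+1)%:R by rewrite divr_gt0.
  have Afin : leb_outer (A k) \is a fin_num.
    rewrite ge0_fin_numE ?leb_outer_ge0// ltey.
    by apply/eqP => Ak; apply: fin; exists k.
  have [_ [a [b [ab Aab ->]]] /ltW le] := lb_ereal_inf_adherent e'0 Afin.
  by exists (a, b).
have [p hp] := choice cov.
pose vol k j : \bar R := (box_vol ((p k).1 j) ((p k).2 j))%:E.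
have vol0 k j : (0 <= vol k j)%E.
  by rewrite lee_fin; apply: box_vol_ge0; case: (hp k).
apply: (@le_trans _ _ (\sum_(k <oo) \sum_(j <oo) vol k j)%E); last first.
  apply: le_trans (epsilon_trick _ _ (ltW e0)); last by move=> k; exact: leb_outer_ge0.
  by apply: lee_nneseries => k _; [move=> _; exact: nneseries_ge0 | case: (hp k)].
have -> : (\sum_(k <oo) \sum_(j <oo) vol k j = \esum_(q in setT) vol q.1 q.2)%E.
  rewrite nneseries_esumT => [|k]; last exact: nneseries_ge0.
  rewrite (eq_esum (b := fun k => \esum_(j in setT) vol k j)%E); last first.
    by move=> k _; exact: nneseries_esumT.
  by rewrite esum_esum//; congr esum; apply/seteqP.
have [f bijf] := card_set_bijP (card_esym card_nat2).
rewrite (reindex_esum _ _ _ _ bijf) -nneseries_esumT//.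
apply: (leb_outer_le_cover (a := fun k => (p (f k).1).1 (f k).2)
  (b := fun k => (p (f k).1).2 (f k).2)) => [k i|x [k _ Akx]].
  by case: (hp (f k).1).
have [_ /(_ _ Akx)[j _ kjx] _] := hp k.
by have [_ _ /(_ (k, j) I)[l _ fl]] := bijf; exists l; rewrite ?fl.
Qed.

HB.instance Definition _ (R : realType) (d : nat) :=
  isOuterMeasure.Build R 'cV[R]_d.+1 (@leb_outer R d.+1)
    (@leb_outer0 R d) (@leb_outer_ge0 R d.+1) (@le_leb_outer R d.+1)
    (@leb_outer_sigma_subadditive R d).

(** * Measurability of boxes *)

Definition upd (R : realType) (d : nat) (i : 'I_d) (m : R) (a : 'cV[R]_d) :
  'cV[R]_d := \col_j (if j == i then m else a j ord0).

Lemma box_vol_split (R : realType) (d : nat) (i : 'I_d) (m : R)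
    (a b : 'cV[R]_d) :
  box_vol a (upd i m b) + box_vol (upd i m a) b = box_vol a b.
Proof.
rewrite /box_vol (bigD1 i)//= [X in _ + X = _](bigD1 i)//= [RHS](bigD1 i)//=.
rewrite !mxE eqxx.
have -> : \prod_(j < d | j != i) ((upd i m b) j ord0 - a j ord0) =
    \prod_(j < d | j != i) (b j ord0 - a j ord0).
  by apply: eq_bigr => j /negPf ji; rewrite !mxE ji.
have -> : \prod_(j < d | j != i) (b j ord0 - (upd i m a) j ord0) =
    \prod_(j < d | j != i) (b j ord0 - a j ord0).
  by apply: eq_bigr => j /negPf ji; rewrite !mxE ji.
by rewrite -mulrDl; congr (_ * _); ring.
Qed.

Lemma upd_le (R : realType) (d : nat) (i : 'I_d) (m : R) (a b : 'cV[R]_d) :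
  (forall j, a j ord0 <= b j ord0) -> a i ord0 <= m <= b i ord0 ->
  (forall j, a j ord0 <= upd i m b j ord0) /\
  (forall j, upd i m a j ord0 <= b j ord0).
Proof.
move=> ab /andP[am mb]; split => j; rewrite mxE; case: eqP => // ->//.
Qed.

Lemma box_split (R : realType) (d : nat) (i : 'I_d) (m : R) (a b x : 'cV[R]_d) :
  box a b x -> (x i ord0 <= m -> box a (upd i m b) x) /\
               (m <= x i ord0 -> box (upd i m a) b x).
Proof.
move=> xab; split => xm j; rewrite mxE; have /andP[aj bj] := xab j.
  by case: eqP => [ji|_]; rewrite ?aj ?bj// ji xm.
by case: eqP => [ji|_]; rewrite ?aj ?bj// ji xm.
Qed.

Lemma nneseriesZl_fin (R : realType) (c : R) (f : nat -> R) :
  (forall k, 0 <= f k) ->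
  (\sum_(0 <= k <oo) (c * f k)%:E = c%:E * \sum_(0 <= k <oo) (f k)%:E)%E.
Proof.
move=> f0; under eq_eseriesr do rewrite EFinM.
by rewrite nneseriesZl// => k _; rewrite lee_fin.
Qed.

(** Every box of a cover is cut in two at the height t. *)
Lemma half_space_caratheodory (R : realType) (d : nat) (i : 'I_d.+1) (t : R)
    (A : set 'cV[R]_d.+1) :
  (forall c : 'cV[R]_d.+1, c i ord0 < t -> A c) ->
  (forall c : 'cV[R]_d.+1, A c -> c i ord0 <= t) ->
  (@leb_outer R d.+1).-caratheodory A.
Proof.
move=> ltA leA; apply: (@le_caratheodory_measurable R _ (@leb_outer R d.+1)).
move=> X; apply: le_ereal_inf_tmp => e [a [b [ab Xab ->]]].
pose m k := Num.max (a k i ord0) (Num.min (b k i ord0) t).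
have amb k : a k i ord0 <= m k <= b k i ord0.
  by rewrite /m le_max lexx/= ge_max ab ge_min lexx.
have lem k x : box (a k) (b k) x -> x i ord0 <= t ->
    box (a k) (upd i (m k) (b k)) x.
  move=> kx xt; apply: (proj1 (box_split _ _ kx)).
  by rewrite /m le_max le_min xt; have /andP[_ ->] := kx i; rewrite orbT.
have gem k x : box (a k) (b k) x -> t <= x i ord0 ->
    box (upd i (m k) (a k)) (b k) x.
  move=> kx xt; apply: (proj2 (box_split _ _ kx)).
  by rewrite /m ge_max ge_min xt; have /andP[-> _] := kx i; rewrite orbT.
apply: (@le_trans _ _ (\sum_(0 <= k <oo) (box_vol (a k) (upd i (m k) (b k)))%:E
   + \sum_(0 <= k <oo) (box_vol (upd i (m k) (a k)) (b k))%:E)%E).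
  apply: leeD; apply: leb_outer_le_cover.
  - by move=> k; apply: (proj1 (upd_le (ab k) (amb k))).
  - by move=> x [/Xab[k _ kx] /leA xt]; exists k => //; apply: lem.
  - by move=> k; apply: (proj2 (upd_le (ab k) (amb k))).
  - move=> x [/Xab[k _ kx] nA]; exists k => //; apply: gem => //.
    by rewrite leNgt; apply/negP => /ltA.
rewrite -nneseriesD => [||k _ _]; last 2 first.
- by move=> k _ _; rewrite lee_fin box_vol_ge0//; case: (upd_le (ab k) (amb k)).
- by rewrite lee_fin box_vol_ge0//; case: (upd_le (ab k) (amb k)).
apply: lee_nneseries => k _; last by rewrite -EFinD box_vol_split.
by rewrite -EFinD box_vol_split lee_fin box_vol_ge0.
Qed.

Lemma box_caratheodory (R : realType) (d : nat) (a b : 'cV[R]_d.+1) :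
  (@leb_outer R d.+1).-caratheodory (box a b).
Proof.
pose mu : {outer_measure set 'cV[R]_d.+1 -> \bar R} := @leb_outer R d.+1.
have -> : box a b = \big[setI/setT]_(i < d.+1)
    ([set c : 'cV[R]_d.+1 | c i ord0 <= b i ord0] `&`
     ~` [set c : 'cV[R]_d.+1 | c i ord0 < a i ord0]).
  apply/seteqP; split => x.
    move=> xab; elim/big_ind : _ => //= i _.
    have /andP[ax xb] := xab i; split => //.
    by apply/negP; rewrite -leNgt.
  move=> + i; rewrite (bigD1 i)//= => -[[xb /negP]].
  by rewrite -leNgt xb => ->.
apply: (@big_ind _ mu.-caratheodory).
- by rewrite -setC0; apply: (caratheodory_measurable_setC (mu := mu)
    (caratheodory_measurable_set0 mu)).
- by move=> A B; apply: (caratheodory_measurable_setI (mu := mu)).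
move=> i _; apply: (caratheodory_measurable_setI (mu := mu)).
- by apply: (half_space_caratheodory (i := i) (t := b i ord0)) => c /= // /ltW.
- apply: (caratheodory_measurable_setC (mu := mu)).
  by apply: (half_space_caratheodory (i := i) (t := a i ord0)) => c /= // /ltW.
Qed.

(** * Lebesgue outer measure and linear maps *)

(** Countable subadditivity reduces the bound to images of boxes. *)
Lemma leb_outer_image_le (R : realType) (d : nat) (T : 'M[R]_d.+1) (c : R) :
  0 < c ->
  (forall a b : 'cV[R]_d.+1, (forall i, a i ord0 <= b i ord0) ->
     (leb_outer (mulmx T @` box a b) <= (c * box_vol a b)%:E)%E) ->
  forall S, (leb_outer (mulmx T @` S) <= c%:E * leb_outer S)%E.
Proof.
move=> c0 Tbox S; rewrite -lee_pdivrMl//.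
apply: le_ereal_inf_tmp => e [a [b [ab Sab ->]]]; rewrite lee_pdivrMl//.
rewrite -nneseriesZl_fin => [|k]; last exact: box_vol_ge0.
apply: (@le_trans _ _ (leb_outer (\bigcup_k (mulmx T @` box (a k) (b k))))).
  apply: le_leb_outer => _ [x /Sab[k _ kx] <-].
  by exists k => //; exists x.
apply: le_trans (leb_outer_sigma_subadditive _) _.
by apply: lee_nneseries => [k _ _|k _]; [exact: leb_outer_ge0 | exact: Tbox].
Qed.

Definition elem_mx (R : realType) (d : nat) (i j : 'I_d) (t : R) : 'M[R]_d :=
  1%:M + t *: delta_mx i j.

Lemma elem_mxE (R : realType) (d : nat) (i j : 'I_d) (t : R) (x : 'cV[R]_d) k :
  (elem_mx i j t *m x) k ord0 =
    x k ord0 + (if k == i then t * x j ord0 else 0).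
Proof.
rewrite mulmxDl mul1mx -scalemxAl mxE; congr (_ + _).
rewrite !mxE (bigD1 j)//= !mxE eqxx andbT big1 ?addr0 => [|l /negPf lj].
  by case: eqP => _; rewrite ?mul1r// mul0r mulr0.
by rewrite !mxE lj andbF mul0r.
Qed.

Lemma mul_elem_mxE (R : realType) (d : nat) (i j : 'I_d) (t : R) (A : 'M[R]_d)
    k l :
  (A *m elem_mx i j t) k l = A k l + (if l == j then A k i * t else 0).
Proof.
rewrite mulmxDr mulmx1 -scalemxAr !mxE; congr (_ + _).
rewrite (bigD1 i)//= !mxE eqxx/= big1 ?addr0 => [|m /negPf mi].
  by case: eqP => _; rewrite ?mulr1 ?mulr0// mulrC.
by rewrite !mxE mi mulr0.
Qed.

Lemma det_elem_diag (R : realType) (d : nat) (i : 'I_d) (t : R) :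
  \det (elem_mx i i t) = 1 + t.
Proof.
have -> : elem_mx i i t = diag_mx (\row_j (if j == i then 1 + t else 1)).
  apply/matrixP => k l; rewrite !mxE.
  have [->|kl] := eqVneq k l.
    by rewrite andbb; case: eqP => _; rewrite ?mulr1// mulr0 addr0.
  have -> : (k == i) && (l == i) = false.
    by apply/negP => /andP[/eqP ki /eqP li]; case/eqP: kl; rewrite ki li.
  by rewrite mulr0 addr0.
rewrite det_diag (bigD1 i)//= mxE eqxx big1 ?mulr1// => j /negPf ji.
by rewrite mxE ji.
Qed.

(** Row i of the matrix is that of the identity plus t times row j of the identity. *)
Lemma det_elem_off (R : realType) (d : nat) (i j : 'I_d) (t : R) :
  i != j -> \det (elem_mx i j t) = 1.
Proof.
move=> ij.
pose C : 'M[R]_d := \matrix_(k, l) (if k == i then (l == j)%:R else (k == l)%:R).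
rewrite (@determinant_multilinear _ _ (elem_mx i j t) 1%:M C i 1 t); last 3 first.
- by rewrite scale1r; apply/rowP => l; rewrite !mxE eqxx.
- apply/matrixP => k l; rewrite !mxE.
  by rewrite [lift i k == i]eq_sym (negPf (neq_lift _ _))/= mulr0 addr0.
- apply/matrixP => k l; rewrite !mxE.
  by rewrite [lift i k == i]eq_sym (negPf (neq_lift _ _))/= mulr0 addr0.
rewrite det1 mul1r (@determinant_alternate _ _ C i j) ?mulr0 ?addr0//.
by move=> l; rewrite !mxE eqxx [j == i]eq_sym (negPf ij) eq_sym.
Qed.

Lemma elem_mxK (R : realType) (d : nat) (i j : 'I_d) (t : R) :
  i != j -> elem_mx i j t *m elem_mx i j (- t) = 1%:M.
Proof.
move=> ij; apply/matrixP => k l; rewrite mul_elem_mxE !mxE (negPf ij) andbF.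
by rewrite mulr0 addr0; case: (l == j); case: (k == i) => /=; ring.
Qed.

Definition scales_volume (R : realType) (d : nat) (T : 'M[R]_d.+1) : Prop :=
  forall S, (leb_outer (mulmx T @` S) <= `|\det T|%:E * leb_outer S)%E.

Lemma scales_volume_mul (R : realType) (d : nat) (T U : 'M[R]_d.+1) :
  scales_volume T -> scales_volume U -> scales_volume (T *m U).
Proof.
move=> hT hU S; have -> : mulmx (T *m U) @` S = mulmx T @` (mulmx U @` S).
  apply/seteqP; split => [_ [x Sx <-]|_ [_ [x Sx <-] <-]].
    by exists (U *m x); [exists x | rewrite mulmxA].
  by exists x; rewrite ?mulmxA.
apply: (le_trans (hT _)); rewrite det_mulmx normrM EFinM -muleA.
by apply: lee_wpmul2l => //; rewrite lee_fin.
Qed.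

Lemma scales_volume1 (R : realType) (d : nat) :
  scales_volume (1%:M : 'M[R]_d.+1).
Proof.
move=> S; rewrite det1 normr1 mul1e le_leb_outer// => _ [x Sx <-].
by rewrite mul1mx.
Qed.

Lemma scales_volume_diag (R : realType) (d : nat) (i : 'I_d.+1) (t : R) :
  1 + t != 0 -> scales_volume (elem_mx i i t).
Proof.
move=> t0; rewrite /scales_volume det_elem_diag.
apply: leb_outer_image_le => [|a b ab]; first by rewrite normr_gt0.
pose lo := Num.min ((1 + t) * a i ord0) ((1 + t) * b i ord0).
pose hi := Num.max ((1 + t) * a i ord0) ((1 + t) * b i ord0).
have vol : box_vol (upd i lo a) (upd i hi b) = `|1 + t| * box_vol a b.
  rewrite /box_vol (bigD1 i)//= [in RHS](bigD1 i)//= !mxE eqxx mulrA.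
  congr (_ * _); last by apply: eq_bigr => j /negPf ji; rewrite !mxE ji.
  have ai := ab i; rewrite /hi /lo.
  have [h|h] := lerP ((1 + t) * a i ord0) ((1 + t) * b i ord0).
    rewrite -mulrBr; have [ab0|ab0] := eqVneq (a i ord0) (b i ord0).
      by rewrite ab0 subrr !mulr0.
    rewrite ger0_norm//; move: h.
    by rewrite -subr_ge0 -mulrBr pmulr_lge0// subr_gt0 lt_neqAle ab0.
  rewrite ltr0_norm; first by ring.
  have ab1 : a i ord0 < b i ord0.
    by rewrite lt_neqAle ai andbT; apply: contraTneq h => ->; rewrite ltxx.
  by move: h; rewrite -subr_gt0 -mulrBr nmulr_lgt0 ?subr_lt0.
rewrite -vol; apply: leb_outer_box_le => [j|_ [x xab <-] j].
  by rewrite !mxE; case: eqP => // _; rewrite ge_min le_max lexx.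
rewrite elem_mxE !mxE; have [->|_] := eqVneq j i; last by rewrite addr0.
have -> : x i ord0 + t * x i ord0 = (1 + t) * x i ord0 by ring.
have /andP[ax xb] := xab i; rewrite /lo /hi.
have [tn|tp] := lerP 0 (1 + t).
  by rewrite ge_min le_max; apply/andP; split; apply/orP; [left|right];
    rewrite ler_wpM2l.
by rewrite ge_min le_max; apply/andP; split; apply/orP; [right|left];
  rewrite ler_wnM2l// ltW.
Qed.

(** Shearing a box gives at worst a box enlarged by the shear of its edge j;
halving that edge repeatedly makes the excess arbitrarily small. *)
Lemma scales_volume_shear (R : realType) (d : nat) (i j : 'I_d.+1) (t : R) :
  i != j -> scales_volume (elem_mx i j t).
Proof.
move=> ij; rewrite /scales_volume det_elem_off// normr1.
apply: leb_outer_image_le => // a b ab; rewrite mul1r.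
pose w (a b : 'cV[R]_d.+1) := (b j ord0 - a j ord0) *
  \prod_(l < d.+1 | l != i) (b l ord0 - a l ord0).
have key r : forall a b : 'cV[R]_d.+1, (forall l, a l ord0 <= b l ord0) ->
    (leb_outer (mulmx (elem_mx i j t) @` box a b) <=
     (box_vol a b + `|t| * w a b / 2 ^+ r)%:E)%E.
  elim: r => [|r IH] {}a {}b {}ab.
    rewrite expr0 divr1.
    pose lo := Num.min (t * a j ord0) (t * b j ord0).
    pose hi := Num.max (t * a j ord0) (t * b j ord0).
    have hl : hi - lo = `|t| * (b j ord0 - a j ord0).
      have [tn|tp] := lerP 0 t.
        have h : t * a j ord0 <= t * b j ord0 by rewrite ler_wpM2l.
        by rewrite /hi /lo (max_idPr h) (min_idPl h) ger0_norm//; ring.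
      have h : t * b j ord0 <= t * a j ord0 by rewrite ler_wnM2l// ltW.
      by rewrite /hi /lo (max_idPl h) (min_idPr h) ltr0_norm//; ring.
    have lohi : lo <= hi.
      by rewrite -subr_ge0 hl mulr_ge0// subr_ge0.
    have -> : box_vol a b + `|t| * w a b =
        box_vol (upd i (a i ord0 + lo) a) (upd i (b i ord0 + hi) b).
      rewrite /box_vol (bigD1 i)//= [in RHS](bigD1 i)//= !mxE eqxx.
      have -> : \prod_(l < d.+1 | l != i) (upd i (b i ord0 + hi) b l ord0 -
          upd i (a i ord0 + lo) a l ord0) =
          \prod_(l < d.+1 | l != i) (b l ord0 - a l ord0).
        by apply: eq_bigr => l /negPf li; rewrite !mxE li.
      have -> : b i ord0 + hi - (a i ord0 + lo) =
        (b i ord0 - a i ord0) + `|t| * (b j ord0 - a j ord0) by rewrite -hl; ring.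
      by rewrite /w; ring.
    apply: leb_outer_box_le => [l|_ [x xab <-] l].
      by rewrite !mxE; case: eqP => // _; rewrite lerD.
    rewrite elem_mxE !mxE; have [->|_] := eqVneq l i; last by rewrite addr0.
    have /andP[ax xb] := xab i; have /andP[ax' xb'] := xab j.
    rewrite /lo /hi; apply/andP; split; apply: lerD => //.
      have [tn|tp] := lerP 0 t; rewrite ge_min; apply/orP.
        by left; rewrite ler_wpM2l.
      by right; rewrite ler_wnM2l// ltW.
    have [tn|tp] := lerP 0 t; rewrite le_max; apply/orP.
      by right; rewrite ler_wpM2l.
    by left; rewrite ler_wnM2l// ltW.
  pose m := (a j ord0 + b j ord0) / 2.
  have amb : a j ord0 <= m <= b j ord0 by have := ab j; rewrite /m; lra.
  have [abl abr] := upd_le ab amb.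
  have wl : w a (upd j m b) = w a b / 4.
    rewrite /w !mxE eqxx (bigD1 j) 1?eq_sym//= [in RHS](bigD1 j) 1?eq_sym//=.
    rewrite !mxE eqxx.
    have -> : \prod_(l < d.+1 | (l != i) && (l != j)) (upd j m b l ord0 - a l ord0)
      = \prod_(l < d.+1 | (l != i) && (l != j)) (b l ord0 - a l ord0).
      by apply: eq_bigr => l /andP[_ /negPf lj]; rewrite !mxE lj.
    by rewrite /m; field.
  have wr : w (upd j m a) b = w a b / 4.
    rewrite /w !mxE eqxx (bigD1 j) 1?eq_sym//= [in RHS](bigD1 j) 1?eq_sym//=.
    rewrite !mxE eqxx.
    have -> : \prod_(l < d.+1 | (l != i) && (l != j)) (b l ord0 - upd j m a l ord0)
      = \prod_(l < d.+1 | (l != i) && (l != j)) (b l ord0 - a l ord0).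
      by apply: eq_bigr => l /andP[_ /negPf lj]; rewrite !mxE lj.
    by rewrite /m; field.
  apply: (@le_trans _ _ (leb_outer (mulmx (elem_mx i j t) @` box a (upd j m b)) +
     leb_outer (mulmx (elem_mx i j t) @` box (upd j m a) b))%E).
    apply: le_trans (outer_measureU2 (@leb_outer R d.+1) _ _).
    apply: le_leb_outer => _ [x xab <-].
    have [bl br] := box_split j m xab.
    have [xm|/ltW xm] := lerP (x j ord0) m; first by left; exists x => //; exact: bl.
    by right; exists x => //; exact: br.
  apply: (le_trans (leeD (IH _ _ abl) (IH _ _ abr))).
  rewrite -EFinD lee_fin wl wr -(box_vol_split j m a b) exprS.
  have r0 : (2 : R) ^+ r != 0 by rewrite expf_neq0.
  by rewrite le_eqVlt; apply/orP; left; apply/eqP; field.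
apply/lee_addgt0Pr => e e0.
have [r re] : exists r, `|t| * w a b / 2 ^+ r <= e.
  pose x := `|t| * w a b / e; pose r := Num.bound `|x|.
  exists r; rewrite ler_pdivrMr ?exprn_gt0//.
  have xr : x <= 2 ^+ r.
    apply: (le_trans (ler_norm _)); apply/ltW/(lt_le_trans (archi_boundP _)) => //.
    by rewrite -natrX ler_nat ltnW// ltn_expl.
  by move: xr; rewrite /x ler_pdivrMr// [e * _]mulrC.
by apply: (le_trans (key r _ _ ab)); rewrite -EFinD lee_fin lerD2l.
Qed.

(** Column operations reduce an invertible matrix to the identity, from the
last row upwards. *)
Lemma unitmx_scales_volume (R : realType) (d : nat) (A : 'M[R]_d.+1) :
  A \in unitmx -> scales_volume A.
Proof.
move=> uA.
pose idrows k (A : 'M[R]_d.+1) :=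
  forall r c : 'I_d.+1, (k <= r)%N -> A r c = (r == c)%:R.
suff : forall k, (k <= d.+1)%N -> forall A : 'M[R]_d.+1, A \in unitmx ->
    idrows k A -> scales_volume A.
  move=> /(_ d.+1 (leqnn _) A uA); apply => r c.
  by rewrite leqNgt ltn_ord.
elim=> [_ {uA}A uA idA|k IH kd {uA}A uA idA].
  have -> : A = 1%:M by apply/matrixP => r c; rewrite idA// mxE.
  exact: scales_volume1.
pose i := Ordinal kd.
have ri (r : 'I_d.+1) : (k < r)%N -> r != i.
  by move=> kr; apply: contraTneq kr => ->; rewrite ltnn.
have off (B : 'M[R]_d.+1) j l t : j != l ->
    scales_volume (B *m elem_mx j l t) -> scales_volume B.
  move=> jl hB; rewrite -[B]mulmx1 -(elem_mxK t jl) mulmxA.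
  by apply: scales_volume_mul => //; exact: scales_volume_shear.
have uE (B : 'M[R]_d.+1) j l t : j != l -> B \in unitmx ->
    B *m elem_mx j l t \in unitmx.
  by move=> jl uB; rewrite unitmx_mul uB unitmxE det_elem_off// unitr1.
(* row i is the unit vector from column m on *)
have clear m : forall B : 'M[R]_d.+1, B \in unitmx -> idrows k.+1 B ->
    B i i = 1 -> (forall c : 'I_d.+1, (m <= c)%N -> c != i -> B i c = 0) ->
    scales_volume B.
  elim: m => [|m IHm] B uB idB Bii Bm.
    apply: IH => //; first exact: ltnW.
    move=> r c; rewrite leq_eqVlt => /orP[/eqP kr|]; last exact: idB.
    have -> : r = i by apply/val_inj.
    have [<-|ic] := eqVneq i c; first exact: Bii.
    by rewrite Bm// eq_sym.
  have [md|md] := ltnP m d.+1; last first.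
    by apply: IHm => // c mc; have := leq_trans md mc; rewrite leqNgt ltn_ord.
  pose j := Ordinal md; have [ij|ij] := eqVneq i j.
    apply: IHm => // c; rewrite leq_eqVlt => /orP[/eqP mc|]; last exact: Bm.
    by rewrite (_ : c = i) ?eqxx// ij; apply/val_inj.
  apply: (off B i j (- B i j)) => //; apply: IHm => //.
  - exact: uE.
  - move=> r c kr; rewrite mul_elem_mxE [B r i]idB// (negPf (ri r kr)) mul0r.
    by rewrite if_same addr0 idB.
  - by rewrite mul_elem_mxE (negPf ij) addr0.
  - move=> c mc ci; rewrite mul_elem_mxE Bii mul1r.
    have [->|cj] := eqVneq c j; first by rewrite subrr.
    rewrite addr0 Bm// ltn_neqAle mc andbT; apply: contra_neq cj => mc'.
    exact/val_inj.
have pivot (B : 'M[R]_d.+1) : B \in unitmx -> idrows k.+1 B -> B i i != 0 ->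
    scales_volume B.
  move=> uB idB Bii.
  have bi : 1 + (B i i - 1) = B i i by ring.
  have bi' : 1 + ((B i i)^-1 - 1) = (B i i)^-1 by ring.
  have -> : B = B *m elem_mx i i ((B i i)^-1 - 1) *m elem_mx i i (B i i - 1).
    apply/matrixP => r c; rewrite !mul_elem_mxE eqxx.
    case: eqP => [->|_]; last by rewrite !addr0.
    by field.
  apply: scales_volume_mul; last by apply: scales_volume_diag; rewrite bi.
  apply: (clear d.+1).
  - by rewrite unitmx_mul uB unitmxE det_elem_diag bi' unitfE invr_eq0.
  - move=> r c kr; rewrite mul_elem_mxE [B r i]idB// (negPf (ri r kr)) mul0r.
    by rewrite if_same addr0 idB.
  - by rewrite mul_elem_mxE eqxx; field.
  - by move=> c; rewrite leqNgt ltn_ord.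
have [Aii|] := eqVneq (A i i) 0; last exact: pivot.
have [[j [jk Aij]]|Ai0] :=
    pselect (exists j : 'I_d.+1, (j <= k)%N /\ A i j != 0).
  have ji : j != i by apply: contraNneq Aij => ->; rewrite Aii.
  apply: (off A j i 1) => //; apply: pivot.
  - exact: uE.
  - move=> r c kr; rewrite mul_elem_mxE [A r j]idA// (_ : (r == j) = false).
      by rewrite mul0r if_same addr0 idA.
    by apply: contraTF kr => /eqP ->; rewrite -leqNgt.
  - by rewrite mul_elem_mxE eqxx Aii add0r mulr1.
(* otherwise row i is a combination of the later rows, which are unit vectors *)
exfalso; pose u : 'rV[R]_d.+1 := row i 1%:M - row i A.
have rA : row i A *m A = row i A.
  apply/rowP => c; rewrite !mxE (bigD1 c)//= !mxE.
  have z (j : 'I_d.+1) : (j <= k)%N -> A i j = 0.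
    by move=> jk; apply/eqP; apply: contra_notT Ai0 => Aij; exists j.
  have -> : A i c * A c c = A i c.
    have [ck|ck] := leqP c k; first by rewrite z// mul0r.
    by rewrite [A c c]idA// eqxx mulr1.
  rewrite big1 ?addr0// => j jc; rewrite mxE.
  have [jk|jk] := leqP j k; first by rewrite z// mul0r.
  by rewrite [A j c]idA// (negPf jc) mulr0.
have : u *m A = 0 by rewrite mulmxBl rA -row_mul mul1mx subrr.
move=> /(congr1 (fun v => v *m invmx A)); rewrite mulmxK// mul0mx.
move/rowP/(_ i); rewrite !mxE Aii eqxx subr0 => /eqP.
by rewrite oner_eq0.
Qed.

(** The reverse inequality is the direct one for the inverse of T. *)
Lemma leb_outer_image (R : realType) (d : nat) (T : 'M[R]_d.+1) S :
  T \in unitmx -> `|\det T| = 1 -> leb_outer (mulmx T @` S) = leb_outer S.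
Proof.
move=> uT dT; apply/eqP; rewrite eq_le.
have := unitmx_scales_volume uT S; rewrite dT mul1e => ->/=.
have uV : invmx T \in unitmx by rewrite unitmx_inv.
have := unitmx_scales_volume uV (mulmx T @` S).
rewrite det_inv normfV dT invr1 mul1e; apply: le_trans.
apply: le_leb_outer => x Sx; exists (T *m x); first by exists x.
by rewrite mulKmx.
Qed.

(** * The measure of a box *)

(** Integrating over the first coordinate: for each height t, the boxes that
meet the slice at height t cover the slice, so induction bounds its volume. The
predicate P selects these boxes in the inductive step. *)
Lemma box_cover_vol (R : realType) (d : nat) (P : nat -> bool)
    (A B : 'cV[R]_d) (a b : nat -> 'cV[R]_d) :
  (forall i, A i ord0 <= B i ord0) ->
  (forall k i, a k i ord0 <= b k i ord0) ->
  (forall x, box A B x -> exists2 k, P k & box (a k) (b k) x) ->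
  ((box_vol A B)%:E <=
    \sum_(0 <= k <oo) (if P k then box_vol (a k) (b k) else 0)%:E)%E.
Proof.
elim: d => [|d IH] in P A B a b *; move=> AB ab ABab.
  have [|k Pk _] := ABab 0; first by case.
  apply: (@le_trans _ _
    (\sum_(0 <= k < k.+1) (if P k then box_vol (a k) (b k) else 0)%:E)%E).
    rewrite big_nat_recr//= Pk /box_vol !big_ord0.
    rewrite leeDr// sume_ge0// => j _; rewrite lee_fin; case: ifP => // _.
    by rewrite big_ord0.
  apply: nneseries_lim_ge => j _ _; rewrite lee_fin; case: ifP => // _.
  exact: box_vol_ge0.
pose tl (x : 'cV[R]_d.+1) : 'cV[R]_d := \col_i x (lift ord0 i) ord0.
have volE (u v : 'cV[R]_d.+1) :
    box_vol u v = (v ord0 ord0 - u ord0 ord0) * box_vol (tl u) (tl v).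
  rewrite /box_vol big_ord_recl; congr (_ * _).
  by apply: eq_bigr => i _; rewrite !mxE.
have tl_le (u v : 'cV[R]_d.+1) : (forall i, u i ord0 <= v i ord0) ->
    forall i, tl u i ord0 <= tl v i ord0.
  by move=> uv i; rewrite !mxE.
pose slab (u v : 'cV[R]_d.+1) : set R := `[u ord0 ord0, v ord0 ord0]%classic.
pose V k : R := if P k then box_vol (tl (a k)) (tl (b k)) else 0.
have V_ge0 k : 0 <= V k.
  by rewrite /V; case: ifP => // _; apply/box_vol_ge0/tl_le.
have mI u v : measurable (slab u v) by exact: measurable_itv.
have muI (u v : 'cV[R]_d.+1) : (forall i, u i ord0 <= v i ord0) ->
    lebesgue_measure (slab u v) = (v ord0 ord0 - u ord0 ord0)%:E.
  move=> uv; rewrite /slab lebesgue_measure_itv/= lte_fin.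
  have := uv ord0; rewrite le_eqVlt => /orP[/eqP ->|->]; last by rewrite EFinB.
  by rewrite ltxx subrr.
have slice t : slab A B t ->
    ((box_vol (tl A) (tl B))%:E <=
       \sum_(0 <= k <oo) (V k * \1_(slab (a k) (b k)) t)%:E)%E.
  rewrite /slab /= in_itv/= => ABt.
  have -> : (\sum_(0 <= k <oo) (V k * \1_(slab (a k) (b k)) t)%:E =
    \sum_(0 <= k <oo) (if P k && (t \in slab (a k) (b k)) then
      box_vol (tl (a k)) (tl (b k)) else 0)%:E)%E.
    apply: eq_eseriesr => k _; rewrite /V indicE.
    by case: (P k) => /=; rewrite ?mul0r//; case: (_ \in _);
      rewrite ?mulr1 ?mulr0.
  apply: IH; [exact: tl_le | by move=> k; exact: tl_le |].
  move=> y yAB.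
  pose x : 'cV[R]_d.+1 :=
    \col_i (if unlift ord0 i is Some j then y j ord0 else t).
  have x0 : x ord0 ord0 = t by rewrite mxE unlift_none.
  have xl i : x (lift ord0 i) ord0 = y i ord0 by rewrite mxE liftK.
  have [|k Pk kx] := ABab x.
    move=> i; case: (unliftP ord0 i) => [j ->|->]; last by rewrite x0.
    by rewrite xl; have := yAB j; rewrite !mxE.
  exists k; last by move=> i; have := kx (lift ord0 i); rewrite xl !mxE.
  by rewrite Pk/= inE /slab/= in_itv/=; have := kx ord0; rewrite x0.
have mf k : measurable_fun (slab A B)
    (fun t : R => (V k * \1_(slab (a k) (b k)) t)%:E : \bar R).
  by apply/measurable_EFinP; apply: measurable_funM => //;
    exact: measurable_indic.
have f_ge0 k (t : R) : (0 <= (V k * \1_(slab (a k) (b k)) t)%:E)%E.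
  by rewrite lee_fin mulr_ge0.
have -> : (box_vol A B)%:E =
    (\int[lebesgue_measure]_(t in slab A B) (cst (box_vol (tl A) (tl B))%:E) t)%E.
  rewrite integral_cst; last exact: mI.
  rewrite volE mulrC EFinM.
  by congr (_ * _)%E; apply/esym/muI.
apply: (@le_trans _ _ (\int[lebesgue_measure]_(t in slab A B)
    (\sum_(0 <= k <oo) (V k * \1_(slab (a k) (b k)) t)%:E))%E).
  apply: ge0_le_integral => //.
  - exact: mI.
  - by move=> t _; rewrite lee_fin; apply/box_vol_ge0/tl_le.
  - apply: (ge0_emeasurable_sum (P := xpredT)) => [k t _ _|k _].
      exact: f_ge0.
    exact: mf.
rewrite integral_nneseries//; last exact: mI.
apply: lee_nneseries => [k _ _|k _].
  by apply: integral_ge0 => t _.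
under eq_integral do rewrite EFinM.
rewrite ge0_integralZl_EFin//; last first.
- by apply/measurable_EFinP; apply: measurable_indic; exact: mI.
- exact: mI.
rewrite integral_indic; [|exact: mI..].
rewrite /V; case: (P k); last by rewrite mul0e.
rewrite volE mulrC EFinM lee_wpmul2l//.
  by rewrite lee_fin; apply/box_vol_ge0/tl_le.
rewrite -(muI (a k) (b k))//; apply: le_measure; rewrite ?inE//.
  by apply: measurableI; exact: mI.
exact: mI.
Qed.

Lemma leb_outer_box (R : realType) (d : nat) (a b : 'cV[R]_d.+1) :
  (forall i, a i ord0 <= b i ord0) -> leb_outer (box a b) = (box_vol a b)%:E.
Proof.
move=> ab; apply/eqP; rewrite eq_le leb_outer_box_le//=.
apply: le_ereal_inf_tmp => e [a' [b' [ab' abab ->]]].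
apply: (@box_cover_vol R d.+1 xpredT) => // x /abab[k _ kx].
by exists k.
Qed.

(** * Lorentzian geometry *)

Notation ip := (bil (lorentz _ _)).

Lemma bilDl (R : realType) (n : nat) (F : 'M[R]_n) x y z :
  bil F (x + y) z = bil F x z + bil F y z.
Proof. by rewrite /bil linearD/= !mulmxDl mxE. Qed.

Lemma bilDr (R : realType) (n : nat) (F : 'M[R]_n) x y z :
  bil F x (y + z) = bil F x y + bil F x z.
Proof. by rewrite /bil mulmxDr mxE. Qed.

Lemma bilZl (R : realType) (n : nat) (F : 'M[R]_n) c x y :
  bil F (c *: x) y = c * bil F x y.
Proof. by rewrite /bil linearZ/= -!scalemxAl mxE. Qed.

Lemma bilZr (R : realType) (n : nat) (F : 'M[R]_n) c x y :
  bil F x (c *: y) = c * bil F x y.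
Proof. by rewrite /bil -scalemxAr mxE. Qed.

Lemma bilNl (R : realType) (n : nat) (F : 'M[R]_n) x y :
  bil F (- x) y = - bil F x y.
Proof. by rewrite -scaleN1r bilZl mulN1r. Qed.

Lemma bilNr (R : realType) (n : nat) (F : 'M[R]_n) x y :
  bil F x (- y) = - bil F x y.
Proof. by rewrite -scaleN1r bilZr mulN1r. Qed.

Lemma bil0l (R : realType) (n : nat) (F : 'M[R]_n) y : bil F 0 y = 0.
Proof. by rewrite -(scale0r (0 : 'cV[R]_n)) bilZl mul0r. Qed.

Lemma bil0r (R : realType) (n : nat) (F : 'M[R]_n) y : bil F y 0 = 0.
Proof. by rewrite -(scale0r (0 : 'cV[R]_n)) bilZr mul0r. Qed.

Lemma bilC (R : realType) (n : nat) (F : 'M[R]_n) x y :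
  F^T = F -> bil F x y = bil F y x.
Proof.
move=> Fsym; rewrite /bil -[in LHS]Fsym.
have -> : x^T *m F^T *m y = (y^T *m F *m x)^T by rewrite !trmx_mul trmxK mulmxA.
by rewrite mxE.
Qed.

Definition bilE := (bilDl, bilDr, bilNl, bilNr, bilZl, bilZr).

Lemma lorentz_sym (R : realType) (n : nat) : (lorentz R n)^T = lorentz R n.
Proof. by rewrite /lorentz tr_diag_mx. Qed.

Lemma ipC (R : realType) (n : nat) (x y : 'cV[R]_n.+1) : ip x y = ip y x.
Proof. exact/bilC/lorentz_sym. Qed.

(** Polarization. *)
Lemma form_iso_bil (R : realType) (n : nat) (F1 F2 A : 'M[R]_n) x y :
  F1^T = F1 -> F2^T = F2 -> form_iso F1 F2 A ->
  bil F2 (A *m x) (A *m y) = bil F1 x y.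
Proof.
move=> s1 s2 [_ h]; have := h (x + y); have := h x; have := h y.
rewrite /qf mulmxDr !bilE (bilC y x s1) (bilC (A *m y) (A *m x) s2).
by move=> -> ->; lra.
Qed.

Definition sp (R : realType) (n : nat) (x y : 'cV[R]_n.+1) : R :=
  \sum_(i < n) x (widen_ord (leqnSn n) i) ord0 * y (widen_ord (leqnSn n) i) ord0.

Lemma ipE (R : realType) (n : nat) (x y : 'cV[R]_n.+1) :
  ip x y = sp x y - x ord_max ord0 * y ord_max ord0.
Proof.
have -> : ip x y = \sum_(i < n.+1) x i ord0 * y i ord0 *
    (if i == ord_max then -1 else 1).
  rewrite /bil mxE; apply: eq_bigr => i _.
  by rewrite mul_mx_diag !mxE; case: eqP => _; ring.
rewrite big_ord_recr/= eqxx /sp; congr (_ + _); last by ring.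
apply: eq_bigr => i _; rewrite (_ : widen_ord _ i == ord_max = false) ?mulr1//.
by apply/negP => /eqP/(congr1 val)/= ni; have := ltn_ord i; rewrite ni ltnn.
Qed.

(** The discriminant of a nonnegative quadratic polynomial. *)
Lemma quadratic_ge0 (R : realType) (a b c : R) : 0 <= c ->
  (forall t, 0 <= a + b * t * 2 + c * t ^+ 2) -> b ^+ 2 <= a * c.
Proof.
move=> c_ge0 h; have [c0|c0] := eqVneq c 0.
  rewrite c0 mulr0; have [->|b0] := eqVneq b 0; first by rewrite expr0n.
  have := h (- (a + 1) / (b * 2)).
  have -> : a + b * (- (a + 1) / (b * 2)) * 2 + c * (- (a + 1) / (b * 2)) ^+ 2
    = -1 by rewrite c0; field.
  by lra.
have := h (- b / c).
have -> : a + b * (- b / c) * 2 + c * (- b / c) ^+ 2 = (a * c - b ^+ 2) / c.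
  by field.
by rewrite pmulr_lge0 ?invr_gt0 ?lt0r ?c0// subr_ge0.
Qed.

Lemma sp_ge0 (R : realType) (n : nat) (x : 'cV[R]_n.+1) : 0 <= sp x x.
Proof. by apply: sumr_ge0 => i _; rewrite -expr2 sqr_ge0. Qed.

Lemma sp_CS (R : realType) (n : nat) (x y : 'cV[R]_n.+1) :
  sp x y ^+ 2 <= sp x x * sp y y.
Proof.
apply: quadratic_ge0 => [|t]; first exact: sp_ge0.
have -> : sp x x + sp x y * t * 2 + sp y y * t ^+ 2 = sp (x + t *: y) (x + t *: y).
  rewrite /sp !mulr_suml -!big_split/=; apply: eq_bigr => i _; rewrite !mxE.
  by ring.
exact: sp_ge0.
Qed.

(** The Cauchy-Schwarz inequality for the Euclidean parts of x and z. *)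
Lemma orth_timelike_gt0 (R : realType) (n : nat) (x z : 'cV[R]_n.+1) :
  ip z z < 0 -> ip x z = 0 -> x != 0 -> 0 < ip x x.
Proof.
rewrite !ipE => zz xz x0; have cs := sp_CS x z.
have sx := sp_ge0 x; have sz := sp_ge0 z.
have [p0|p0] := eqVneq (x ord_max ord0) 0.
  rewrite p0 mulr0 subr0 lt_neqAle sx andbT eq_sym.
  apply: contraNneq x0 => sx0; apply/eqP/matrixP => i j; rewrite ord1 mxE.
  have [->//|im] := eqVneq i ord_max.
  have ilt : (i < n)%N.
    by rewrite ltn_neqAle -ltnS ltn_ord andbT; apply: contra_neq im => ?; apply/val_inj.
  have -> : i = widen_ord (leqnSn n) (Ordinal ilt) by apply/val_inj.
  have := @psumr_eq0P R 'I_n xpredT (fun i => x (widen_ord (leqnSn n) i) ord0 *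
    x (widen_ord (leqnSn n) i) ord0).
  have sq i' : true -> 0 <= x (widen_ord (leqnSn n) i') ord0 *
    x (widen_ord (leqnSn n) i') ord0 by rewrite -expr2 sqr_ge0.
  move=> /(_ sq sx0 (Ordinal ilt) isT)/eqP.
  by rewrite mulf_eq0 orbb => /eqP.
set p := x ord_max ord0 in xz p0 *; set q := z ord_max ord0 in xz zz *.
rewrite ltNge; apply/negP => h.
have pp : 0 < p * p by rewrite -expr2 exprn_even_gt0.
have : sp x x * sp z z <= p * p * sp z z by rewrite ler_wpM2r//; lra.
have : p * p * sp z z < p * p * (q * q) by rewrite ltr_pM2l//; lra.
have xz2 : sp x z = p * q by lra.
by move: cs; rewrite xz2; lra.
Qed.

Lemma Hyp_ip (R : realType) (n : nat) (x : 'cV[R]_n.+1) : Hyp x -> ip x x = -1.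
Proof. by case. Qed.

Lemma Hyp_ip_lt0 (R : realType) (n : nat) (x y : 'cV[R]_n.+1) :
  Hyp x -> Hyp y -> ip x y < 0.
Proof.
move=> [+ +] [+ +]; rewrite /qf !ipE; have := sp_CS x y.
have := sp_ge0 x; have := sp_ge0 y.
set p := x ord_max ord0; set q := y ord_max ord0 => sy sx cs xx p0 yy q0.
have h : sp x x * sp y y = p ^+ 2 * q ^+ 2 - p ^+ 2 - q ^+ 2 + 1.
  have -> : sp x x = p ^+ 2 - 1 by rewrite expr2; lra.
  have -> : sp y y = q ^+ 2 - 1 by rewrite expr2; lra.
  by ring.
have pq : 0 < p * q by rewrite mulr_gt0.
rewrite ltNge; apply/negP => le.
have : (p * q) ^+ 2 <= sp x y ^+ 2.
  by rewrite ler_sqr ?nnegrE; lra.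
rewrite exprMn; have : 1 <= p ^+ 2 by rewrite expr2; lra.
have : 1 <= q ^+ 2 by rewrite expr2; lra.
by lra.
Qed.

(** The component of y orthogonal to the timelike vector x is spacelike. As - ip x y
is the hyperbolic cosine of the distance of x and y, this says that distinct points
are at positive distance. *)
Lemma Hyp_gap (R : realType) (n : nat) (x y : 'cV[R]_n.+1) : Hyp x -> Hyp y ->
  x != y -> ip x y < -1.
Proof.
move=> hx hy xy; have lt0 := Hyp_ip_lt0 hx hy.
have hxx := Hyp_ip hx; have hyy := Hyp_ip hy.
pose u := y + ip x y *: x.
have ux : ip u x = 0 by rewrite !bilE hxx (ipC y x); ring.
have uu : ip u u = ip x y ^+ 2 - 1 by rewrite !bilE hxx hyy (ipC y x); ring.
have [u0|u0] := eqVneq u 0; last first.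
  have := orth_timelike_gt0 _ ux u0; rewrite hxx uu => /(_ (ltrN10 _)).
  by rewrite subr_gt0 => h; nra.
have c1 : ip x y = -1 by move: uu; rewrite u0 bil0l => ?; nra.
by move: u0; rewrite /u c1 scaleN1r => /subr0_eq/eqP; rewrite eq_sym (negPf xy).
Qed.

Lemma Hyp_ip_le (R : realType) (n : nat) (x y : 'cV[R]_n.+1) :
  Hyp x -> Hyp y -> ip x y <= -1.
Proof.
move=> hx hy; have [->|xy] := eqVneq x y; first by rewrite Hyp_ip.
exact/ltW/Hyp_gap.
Qed.

Lemma nonspacelike_ip_neq0 (R : realType) (n : nat) (x w : 'cV[R]_n.+1) :
  Hyp x -> w != 0 -> ip w w <= 0 -> ip x w != 0.
Proof.
move=> hx w0 ww; apply/eqP => xw.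
have := @orth_timelike_gt0 R n w x; rewrite ipC xw (Hyp_ip hx).
by move=> /(_ (ltrN10 _) erefl w0); rewrite ltNge ww.
Qed.

(** Otherwise the segment from x to y would meet the orthogonal complement of w
inside the light cone. *)
Lemma nonspacelike_same_sign (R : realType) (n : nat) (x y w : 'cV[R]_n.+1) :
  Hyp x -> Hyp y -> w != 0 -> ip w w <= 0 -> 0 < ip x w * ip y w.
Proof.
move=> hx hy w0 ww; rewrite lt_neqAle eq_sym mulf_neq0 ?nonspacelike_ip_neq0//=.
rewrite leNgt; apply/negP => neg.
pose c := ip y w *: x - ip x w *: y.
have cw : ip w c = 0 by rewrite ipC !bilE; ring.
have cc : ip c c < 0.
  rewrite !bilE (Hyp_ip hx) (Hyp_ip hy) (ipC y x).
  have := Hyp_ip_le hx hy; set p := ip x w in neg *; set q := ip y w in neg *.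
  by move=> h; have := sqr_ge0 p; have := sqr_ge0 q; rewrite !expr2; nra.
by have := orth_timelike_gt0 cc cw w0; rewrite ltNge ww.
Qed.

(** As cosh (s + t) <= 2 cosh s cosh t, this is a weak form of the triangle inequality
for the distance; it follows from the sign of the form on the orthogonal complement
of z. *)
Lemma Hyp_triangle (R : realType) (n : nat) (x y z : 'cV[R]_n.+1) :
  Hyp x -> Hyp y -> Hyp z -> - ip x y <= 2 * ip x z * ip y z.
Proof.
move=> hx hy hz; have xz := Hyp_ip_le hx hz; have yz := Hyp_ip_le hy hz.
have xx := Hyp_ip hx; have yy := Hyp_ip hy; have zz := Hyp_ip hz.
set a := ip x z in xz *; set b := ip y z in yz *.
pose w := b *: x + a *: y + (2 * a * b) *: z.
have wz : ip w z = 0 by rewrite !bilE zz -/a -/b; ring.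
have ww : 0 <= ip w w.
  have [->|w0] := eqVneq w 0; first by rewrite bil0l.
  by apply/ltW/(orth_timelike_gt0 _ wz w0); rewrite zz; lra.
move: ww; rewrite !bilE xx yy zz (ipC z x) (ipC z y) (ipC y x) -/a -/b => ww.
have ab : 0 < a * b by nra.
rewrite -(ler_pM2l ab); have := sqr_ge0 a; have := sqr_ge0 b; rewrite !expr2.
by lra.
Qed.

Lemma Hyp_intro (R : realType) (n : nat) (a x : 'cV[R]_n.+1) :
  Hyp a -> ip x x = -1 -> ip x a < 0 -> Hyp x.
Proof.
move=> ha xx xa; split => //; rewrite ltNge; apply/negP => x0.
move: (x0); rewrite le_eqVlt => /orP[/eqP x00|xlt].
  by move: xx; rewrite ipE x00 mulr0; have := sp_ge0 x; lra.
have hNx : Hyp (- x).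
  by split; [rewrite /qf !bilE opprK | rewrite mxE oppr_gt0].
by have := Hyp_ip_lt0 hNx ha; rewrite bilNl; lra.
Qed.

(** The point at distance arsinh s from a on the geodesic through a orthogonal
to the hyperplane with unit normal u. *)
Lemma move_across (R : realType) (n : nat) (a u : 'cV[R]_n.+1) (s : R) :
  Hyp a -> ip u u = 1 -> 0 < s -> - ip a u < s ->
  exists z, [/\ Hyp z, - ip a z = Num.sqrt (1 + s ^+ 2), 0 < ip z u &
    exists c d, z = c *: a + d *: u].
Proof.
move=> ha uu s0 ts; have aa := Hyp_ip ha.
set t := - ip a u in ts *; have au : ip a u = - t by rewrite opprK.
pose ct := Num.sqrt (1 + t ^+ 2); pose cs := Num.sqrt (1 + s ^+ 2).
have ct0 : 0 < ct by rewrite sqrtr_gt0; have := sqr_ge0 t; lra.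
have cs0 : 0 < cs by rewrite sqrtr_gt0; have := sqr_ge0 s; lra.
have ct2 : ct ^+ 2 = 1 + t ^+ 2 by rewrite sqr_sqrtr//; have := sqr_ge0 t; lra.
have cs2 : cs ^+ 2 = 1 + s ^+ 2 by rewrite sqr_sqrtr//; have := sqr_ge0 s; lra.
pose k := s / ct; have kct : k * ct = s by rewrite /k; field; rewrite gt_eqF.
pose z := (cs - k * t) *: a + k *: u.
have za : ip z a = - cs by rewrite !bilE aa (ipC u a) au; ring.
have zz : ip z z = -1.
  rewrite !bilE aa (ipC u a) au uu.
  transitivity (- cs ^+ 2 + k ^+ 2 * (1 + t ^+ 2)); first by ring.
  by rewrite -ct2 -exprMn kct cs2; ring.
exists z; split.
- by apply: (Hyp_intro ha) => //; rewrite za oppr_lt0.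
- by rewrite ipC za opprK.
- rewrite !bilE au uu.
  have -> : (cs - k * t) * - t + k * 1 = k * ct ^+ 2 - cs * t by rewrite ct2; ring.
  have -> : k * ct ^+ 2 = s * ct by rewrite -kct; ring.
  have [t0|t0] := lerP t 0; first by nra.
  rewrite subr_gt0 -(@ltr_sqr _ (cs * t)) ?nnegrE ?mulr_ge0 ?(ltW cs0) ?(ltW ct0) ?(ltW t0) ?(ltW s0)//.
  have tt : t ^+ 2 < s ^+ 2 by rewrite ltr_sqr ?nnegrE ?ltW.
  by rewrite !exprMn ct2 cs2; lra.
- by exists (cs - k * t), k.
Qed.

(** * The topology of hyperbolic space *)

(** The positive definite form attached to a point a of hyperbolic space: it changes the
sign of the Lorentz form on the line of a. *)
Definition epos (R : realType) (n : nat) (a x y : 'cV[R]_n.+1) : R :=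
  ip x y + 2 * ip x a * ip y a.

Lemma epos_ge0 (R : realType) (n : nat) (a x : 'cV[R]_n.+1) :
  Hyp a -> 0 <= epos a x x.
Proof.
move=> ha; pose u := x + ip x a *: a; have aa := Hyp_ip ha.
have ua : ip u a = 0 by rewrite !bilE aa; ring.
have uu : ip u u = ip x x + ip x a ^+ 2 by rewrite !bilE aa (ipC a x); ring.
have u0 : 0 <= ip u u.
  have [->|u0] := eqVneq u 0; first by rewrite bil0l.
  by apply/ltW/(orth_timelike_gt0 _ ua u0); rewrite aa; lra.
by have := sqr_ge0 (ip x a); move: u0; rewrite uu /epos expr2; lra.
Qed.

Lemma ip_sqr_le (R : realType) (n : nat) (a x y : 'cV[R]_n.+1) :
  Hyp a -> ip x y ^+ 2 <= epos a x x * epos a y y.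
Proof.
move=> ha; have aa := Hyp_ip ha; pose y' := y + (2 * ip y a) *: a.
have -> : ip x y = epos a x y' by rewrite /epos !bilE aa; ring.
have -> : epos a y y = epos a y' y'.
  by rewrite /epos !bilE aa (ipC a y); ring.
apply: quadratic_ge0 => [|t]; first exact: epos_ge0.
suff -> : epos a x x + epos a x y' * t * 2 + epos a y' y' * t ^+ 2 =
    epos a (x + t *: y') (x + t *: y') by exact: epos_ge0.
by move: y' => z; rewrite /epos !bilE (ipC z x) ; ring.
Qed.

(** The vector dual to the i-th coordinate. *)
Definition co (R : realType) (n : nat) (i : 'I_n.+1) : 'cV[R]_n.+1 :=
  (if i == ord_max then -1 else 1) *: delta_mx i ord0.

Lemma ip_co (R : realType) (n : nat) (i : 'I_n.+1) (x : 'cV[R]_n.+1) :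
  ip x (co R i) = x i ord0.
Proof.
rewrite /co bilZr /bil -mulmxA mul_diag_mx mxE (bigD1 i)//= !mxE eqxx big1.
  by rewrite eqxx/=; case: eqP => _; ring.
by move=> j /negPf ji; rewrite !mxE ji/= !mulr0.
Qed.

Lemma coord_sqr_le (R : realType) (n : nat) (a x : 'cV[R]_n.+1) i :
  Hyp a -> x i ord0 ^+ 2 <= epos a x x * epos a (co R i) (co R i).
Proof. by move=> ha; rewrite -(ip_co i x); exact: ip_sqr_le. Qed.

Lemma near_cV (R : realType) (n : nat) (x : 'cV[R]_n.+1) (P : 'cV[R]_n.+1 -> Prop) :
  (\forall y \near x, P y) ->
  exists2 e : R, 0 < e & forall y : 'cV[R]_n.+1, (forall i, `|x i ord0 - y i ord0| < e) -> P y.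
Proof.
move=> /nbhs_ballP[e /= e0 h]; exists e => // y xy; apply: h.
by split=> // i j; rewrite ord1; exact: xy.
Qed.

Lemma cV_near (R : realType) (n : nat) (x : 'cV[R]_n.+1) (P : 'cV[R]_n.+1 -> Prop)
    (e : R) : 0 < e ->
  (forall y : 'cV[R]_n.+1, (forall i, `|x i ord0 - y i ord0| < e) -> P y) ->
  \forall y \near x, P y.
Proof.
move=> e0 h; apply/nbhs_ballP; exists e => //= y xy; apply: h => i.
by case: xy => _ /(_ i ord0).
Qed.

Lemma near_M (R : realType) (n : nat) (x : 'M[R]_n.+1) (P : 'M[R]_n.+1 -> Prop) :
  (\forall y \near x, P y) ->
  exists2 e : R, 0 < e & forall y : 'M[R]_n.+1, (forall i j, `|x i j - y i j| < e) -> P y.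
Proof.
by move=> /nbhs_ballP[e /= e0 h]; exists e => // y xy; apply: h; split.
Qed.

(** The coordinates of a - y are controlled by the positive form at a, whose value on
a - y depends on the distance of a and y only. *)
Lemma Hyp_near_ball (R : realType) (n : nat) (a : 'cV[R]_n.+1)
    (P : 'cV[R]_n.+1 -> Prop) :
  Hyp a -> (\forall y \near a, Hyp y -> P y) ->
  exists2 e : R, 0 < e & forall y, Hyp y -> - ip a y < 1 + e -> P y.
Proof.
move=> ha /near_cV[e e0 h].
pose K := \sum_i epos a (co R i) (co R i).
have K0 : 0 <= K by apply: sumr_ge0 => i _; exact: epos_ge0.
pose eta := Num.min 1 (e ^+ 2 / (8 * (K + 1))).
have eta0 : 0 < eta.
  by rewrite lt_min ltr01 divr_gt0 ?exprn_gt0// mulr_gt0//; lra.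
exists eta => // y hy ay; apply: h => // i.
pose c := - ip a y; have c1 : 1 <= c by have := Hyp_ip_le ha hy; rewrite /c; lra.
have Ey : epos a (a - y) (a - y) = 2 * (c - 1) ^+ 2 + 2 * (c - 1).
  rewrite /epos !bilE (Hyp_ip ha) (Hyp_ip hy) (ipC y a) /c; ring.
have eta1 : eta <= 1 by rewrite ge_min lexx.
have eta2 : eta * (8 * (K + 1)) <= e ^+ 2.
  rewrite -ler_pdivlMr; last by lra.
  by rewrite ge_min lexx orbT.
have Eb : epos a (a - y) (a - y) <= 4 * eta.
  rewrite Ey; have : c - 1 <= eta by rewrite /c; lra.
  by have := sqr_ge0 (c - 1); rewrite expr2; nra.
have Ki : epos a (co R i) (co R i) <= K.
  rewrite /K (bigD1 i)//= lerDl; apply: sumr_ge0 => j _; exact: epos_ge0.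
have := coord_sqr_le (a - y) i ha; rewrite !mxE => le1.
have le2 : epos a (a - y) (a - y) * epos a (co R i) (co R i) <= 4 * eta * K.
  by apply: ler_pM => //; exact: epos_ge0.
have lt3 : 4 * eta * K < e ^+ 2 by nra.
by rewrite -ltr_sqr ?nnegrE ?(ltW e0)// real_normK ?num_real//; lra.
Qed.

(** * Isometries of hyperbolic space *)

Lemma isom_ip (R : realType) (n : nat) (g : 'M[R]_n.+1) x y :
  IsomH g -> ip (g *m x) (g *m y) = ip x y.
Proof. by case=> og _; apply: form_iso_bil => //; exact: lorentz_sym. Qed.

Lemma isom_unit (R : realType) (n : nat) (g : 'M[R]_n.+1) : IsomH g -> g \in unitmx.
Proof. by case; case. Qed.

Lemma isom_Hyp (R : realType) (n : nat) (g : 'M[R]_n.+1) x :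
  IsomH g -> Hyp x -> Hyp (g *m x).
Proof. by case=> _; exact. Qed.

Lemma isom_ip_inv (R : realType) (n : nat) (g : 'M[R]_n.+1) x y :
  IsomH g -> ip (g *m x) y = ip x (invmx g *m y).
Proof.
by move=> ig; rewrite -[y in LHS](mulKVmx (isom_unit ig)) isom_ip.
Qed.

(** The positive forms at a and at g a are comparable, with a constant depending on the
distance of these points, and g carries the first to the second. *)
Lemma isom_entry_le (R : realType) (n : nat) (a : 'cV[R]_n.+1) :
  Hyp a -> exists2 B : R -> R, forall c, 0 < B c &
    forall g c, IsomH g -> - ip a (g *m a) <= c -> forall i j, `|g i j| <= B c.
Proof.
move=> ha.
pose K := \sum_i epos a (co R i) (co R i).
have K0 : 0 <= K by apply: sumr_ge0 => i _; exact: epos_ge0.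
have Ki i : epos a (co R i) (co R i) <= K.
  rewrite /K (bigD1 i)//= lerDl; apply: sumr_ge0 => j _; exact: epos_ge0.
pose B c := 1 + K * (\sum_j (`|ip (delta_mx j ord0 : 'cV[R]_n.+1)
   (delta_mx j ord0)| + 2 * (epos a (delta_mx j ord0) (delta_mx j ord0) *
      (2 * c ^+ 2)))).
have t0 j c : 0 <= `|ip (delta_mx j ord0 : 'cV[R]_n.+1)
   (delta_mx j ord0)| + 2 * (epos a (delta_mx j ord0) (delta_mx j ord0) *
      (2 * c ^+ 2)).
  apply: addr_ge0 => //; apply: mulr_ge0 => //; apply: mulr_ge0.
    exact: epos_ge0.
  by rewrite mulr_ge0 ?sqr_ge0.
have B0 c : 1 <= B c by rewrite lerDl mulr_ge0// sumr_ge0.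
exists B => [c|g c ig gc i j]; first by have := B0 c; lra.
pose e : 'cV[R]_n.+1 := delta_mx j ord0.
have -> : g i j = (g *m e) i ord0.
  rewrite mxE (bigD1 j)//= !mxE !eqxx mulr1 big1 ?addr0// => k /negPf kj.
  by rewrite !mxE kj mulr0.
have hga := isom_Hyp ig ha; have uig := isom_unit ig.
have e1 : epos a (g *m e) (g *m e) <= `|ip e e| + 2 * (epos a e e * (2 * c ^+ 2)).
  rewrite {1}/epos isom_ip// [ip (g *m e) a]isom_ip_inv//.
  apply: lerD; first exact: ler_norm.
  rewrite -mulrA ler_pM2l// -expr2; apply: (le_trans (ip_sqr_le _ _ ha)).
  rewrite ler_wpM2l ?epos_ge0//.
  have -> : epos a (invmx g *m a) (invmx g *m a) = 2 * ip a (g *m a) ^+ 2 - 1.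
    rewrite /epos -(isom_ip (invmx g *m a) (invmx g *m a) ig) mulKVmx//.
    rewrite (Hyp_ip ha) ipC.
    have -> : ip a (invmx g *m a) = ip a (g *m a).
      by rewrite -(isom_ip_inv a a ig) ipC.
    by ring.
  have : ip a (g *m a) ^+ 2 <= c ^+ 2.
    rewrite -sqrrN ler_sqr ?nnegrE//; have := Hyp_ip_le ha hga; lra.
  lra.
have le1 := coord_sqr_le (g *m e) i ha.
have le2 : epos a (g *m e) (g *m e) * epos a (co R i) (co R i) <= B c ^+ 2.
  apply: (@le_trans _ _ (B c)); last by rewrite expr2 ler_peMr//; have := B0 c; lra.
  apply: (@le_trans _ _ ((`|ip e e| + 2 * (epos a e e * (2 * c ^+ 2))) * K)).
    by apply: ler_pM => //; exact: epos_ge0.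
  rewrite mulrC /B; apply: (@le_trans _ _ (K * \sum_j (`|ip (delta_mx j ord0 : 'cV[R]_n.+1)
   (delta_mx j ord0)| + 2 * (epos a (delta_mx j ord0) (delta_mx j ord0) *
      (2 * c ^+ 2))))); last by lra.
  rewrite ler_wpM2l// (bigD1 j)//= lerDl; exact: sumr_ge0.
rewrite -ler_sqr ?nnegrE//; last by have := B0 c; lra.
by rewrite real_normK ?num_real//; apply: le_trans le2.
Qed.

(** * Discreteness of the group of a manifold *)

Lemma grp_isom (R : realType) (n : nat) (M : hyp_manifold R n) g :
  grp M g -> IsomH g.
Proof. by move: g; case: M. Qed.

Lemma grp1 (R : realType) (n : nat) (M : hyp_manifold R n) : grp M 1.
Proof. by case: M. Qed.

Lemma grpM (R : realType) (n : nat) (M : hyp_manifold R n) g h :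
  grp M g -> grp M h -> grp M (g *m h).
Proof. by case: M => C G /= _ _ _ _ _ hM *; exact: hM. Qed.

Lemma grpV (R : realType) (n : nat) (M : hyp_manifold R n) g :
  grp M g -> grp M (invmx g).
Proof. by case: M => C G /= _ _ _ _ _ _ hV *; exact: hV. Qed.

Lemma grp_discrete (R : realType) (n : nat) (M : hyp_manifold R n) :
  \forall g \near (1 : 'M[R]_n.+1), grp M g -> g = 1.
Proof. by case: M. Qed.

Lemma grp_torsion_free (R : realType) (n : nat) (M : hyp_manifold R n) g m :
  grp M g -> (0 < m)%N -> g ^+ m = 1 -> g = 1.
Proof. by case: M => C G /= _ _ _ _ _ _ _ _ h *; apply: h; eassumption. Qed.

Lemma grp_cover (R : realType) (n : nat) (M : hyp_manifold R n) g x :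
  grp M g -> Defs.cover M x -> Defs.cover M (g *m x).
Proof.
move=> gg xC; have : (mulmx g) @` Defs.cover M = Defs.cover M.
  by move: gg; case: M {xC} => C G /= *; eauto.
by move=> <-; exists x.
Qed.

Lemma grp_unit (R : realType) (n : nat) (M : hyp_manifold R n) g :
  grp M g -> g \in unitmx.
Proof. by move/grp_isom/isom_unit. Qed.

Lemma isom_inv_entry (R : realType) (n : nat) (g : 'M[R]_n.+1) i j :
  IsomH g -> `|invmx g i j| = `|g j i|.
Proof.
move=> ig; have col (A : 'M[R]_n.+1) k l :
    A k l = (A *m (delta_mx l ord0 : 'cV[R]_n.+1)) k ord0.
  rewrite mxE (bigD1 l)//= !mxE !eqxx mulr1 big1 ?addr0// => m /negPf ml.
  by rewrite !mxE ml mulr0.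
have co_norm (x : 'cV[R]_n.+1) k : `|ip x (delta_mx k ord0)| = `|x k ord0|.
  rewrite -(ip_co k x) /co bilZr normrM.
  by case: eqP => _; rewrite ?normrN normr1 mul1r.
have e : ip (invmx g *m delta_mx j ord0) (delta_mx i ord0) =
    ip (g *m delta_mx i ord0) (delta_mx j ord0) by rewrite (isom_ip_inv _ _ ig) ipC.
by rewrite (col (invmx g)) -(co_norm (invmx g *m delta_mx j ord0) i) e co_norm -col.
Qed.

(** Two elements with entries close to each other differ by an element close to
the identity, so a bounded set of matrices, cut into finitely many small cells,
meets a discrete group in finitely many elements. *)
Lemma grp_bounded_finite (R : realType) (n : nat) (M : hyp_manifold R n) (B : R) :
  finite_set [set g | grp M g /\ forall i j, `|g i j| <= B].
Proof.
set S := [set g | _].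
have [B0|B0] := ltP B 0.
  rewrite (_ : S = set0)// -subset0 => g [_ /(_ ord0 ord0)].
  by have := normr_ge0 (g ord0 ord0); lra.
have [e e0 he] := near_M (grp_discrete M).
(* elements g and h in the same cell of side d differ by entries less than d, so that
   those of g^-1 (g - h) are at most (n + 1) B d < e *)
pose d := e / (n.+1%:R * (B + 1)).
have d0 : 0 < d by rewrite divr_gt0// mulr_gt0 ?ltr0n//; lra.
pose N := Num.bound (2 * B / d).
pose t (x : R) := Num.truncn ((x + B) / d).
have h0 (x : R) : `|x| <= B -> 0 <= (x + B) / d.
  by rewrite ler_norml => /andP[x1 x2]; rewrite divr_ge0 ?(ltW d0)//; lra.
have cell_lt (x : R) : `|x| <= B -> (t x < N.+1)%N.
  move=> xB; rewrite truncn_lt_nat ?h0//.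
  move: xB; rewrite ler_norml => /andP[x1 x2].
  apply: (@le_lt_trans _ _ (2 * B / d)).
    by rewrite ler_pM2r ?invr_gt0//; lra.
  apply: (lt_le_trans (archi_boundP _)); first by rewrite divr_ge0 ?(ltW d0)//; lra.
  by rewrite ler_nat.
have cell_eq (x y : R) : `|x| <= B -> `|y| <= B -> t x = t y -> `|x - y| < d.
  move=> xB yB xy; have /andP[x1 x2] := truncn_itv (h0 _ xB).
  have /andP[y1 y2] := truncn_itv (h0 _ yB).
  rewrite -/(t x) in x1 x2; rewrite -/(t y) -xy in y1 y2.
  have dx : (x + B) / d * d = x + B by field; lra.
  have dy : (y + B) / d * d = y + B by field; lra.
  move: x2 y2; rewrite -natr1 => x2 y2.
  by rewrite ltr_norml; apply/andP; split; nra.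
pose cell (g : 'M[R]_n.+1) : 'M['I_N.+1]_n.+1 := \matrix_(i, j) inord (t (g i j)).
rewrite -(eq_finite_set (@inj_card_eq _ _ S cell _)); first exact: finite_finset.
move=> g h; rewrite !inE => -[gg gB] [gh hB] /matrixP gh_eq.
have close i j : `|g i j - h i j| < d.
  apply: cell_eq => //; have := gh_eq i j; rewrite !mxE.
  by move=> /(congr1 val)/=; rewrite !inordK ?cell_lt.
have : invmx g *m h = 1.
  apply: he; last by apply: grpM => //; exact: grpV.
  move=> i j; rewrite [X in `|X|](_ : _ = (invmx g *m (g - h)) i j); last first.
    by rewrite mulmxBr mulVmx ?(grp_unit gg)// !mxE.
  rewrite mxE; apply: (le_lt_trans (ler_norm_sum _ _ _)).
  apply: (@le_lt_trans _ _ (\sum_(k < n.+1) (B * d))).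
    apply: ler_sum => k _; rewrite normrM (isom_inv_entry _ _ (grp_isom gg)).
    apply: ler_pM => //.
    by rewrite !mxE ltW// close.
  rewrite sumr_const card_ord -[X in X < _]mulr_natl /d.
  have n1 : (n.+1%:R : R) != 0 by rewrite pnatr_eq0.
  rewrite (_ : _ * _ = e * (B / (B + 1))); last first.
    rewrite invfM; transitivity ((n.+1%:R / n.+1%:R) * (e * (B / (B + 1)))).
      by ring.
    by rewrite divff// mul1r.
  by rewrite gtr_pMr// ltr_pdivrMr; lra.
move=> /(congr1 (mulmx g)); rewrite mulKVmx ?(grp_unit gg)// => ->.
by rewrite -[g *m 1]/(g * 1) mulr1.
Qed.

Lemma finite_set_gap (R : realType) (T : choiceType) (S : set T) (f : T -> R) :
  finite_set S -> (forall x, S x -> 0 < f x) ->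
  exists2 e : R, 0 < e & forall x, S x -> e <= f x.
Proof.
move=> /finite_seqP[s ->]; elim: s => [|x s IH] h; first by exists 1.
have [|e e0 he] := IH; first by move=> y ys; apply: h; rewrite /= inE ys orbT.
exists (Num.min e (f x)); first by rewrite lt_min e0 h//= inE eqxx.
move=> y; rewrite /= inE => /orP[/eqP ->|/he ey]; rewrite ge_min ?lexx ?orbT//.
by rewrite ey.
Qed.

(** The fixer of a is finite, hence trivial as the group has no torsion, and only
finitely many elements move a by a bounded distance. *)
Lemma grp_moves_away (R : realType) (n : nat) (M : hyp_manifold R n)
    (a : 'cV[R]_n.+1) : Hyp a ->
  exists2 e : R, 0 < e & forall g, grp M g -> - ip a (g *m a) < 1 + e -> g = 1.
Proof.
move=> ha; have [B _ hB] := isom_entry_le ha.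
pose S := [set g | grp M g /\ forall i j, `|g i j| <= B 2].
have finS : finite_set S by exact: grp_bounded_finite.
have inS g : grp M g -> - ip a (g *m a) <= 2 -> S g.
  by move=> gg ag; split => // i j; apply: hB ag _ _; exact: grp_isom gg.
have fixed g : grp M g -> g *m a = a -> g = 1.
  move=> gg ga; have pw m : grp M (g ^+ m) /\ g ^+ m *m a = a.
    elim: m => [|m [IH1 IH2]]; first by rewrite expr0 mul1mx; split => //; exact: grp1.
    rewrite exprS; split; first exact: grpM.
    by rewrite -[g * _]/(g *m _) -mulmxA IH2.
  have pS m : S (g ^+ m).
    have [h1 h2] := pw m; apply: inS => //; rewrite h2 (Hyp_ip ha); lra.
  have [s Ss] := (finite_seqP S).1 finS.
  have : ~~ uniq [seq g ^+ m | m <- iota 0 (size s).+1].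
    apply/negP => us; have := uniq_leq_size us (s2 := s).
    rewrite size_map size_iota ltnn => h; apply/notF/h => _ /mapP[m _ ->].
    by have := pS m; rewrite Ss.
  move=> /(uniqPn 1)[i [j [ij]]]; rewrite size_map size_iota => js.
  rewrite !(nth_map 0%N) ?size_iota//; last by apply: ltn_trans js.
  rewrite !nth_iota ?add0n//; last by apply: ltn_trans js.
  move=> gij; apply: (grp_torsion_free gg (m := (j - i)%N)); first by rewrite subn_gt0.
  apply: (@mulrI _ (g ^+ i)); first by apply: unitrX; exact: grp_unit gg.
  by rewrite -exprD subnKC ?mulr1 ?(ltnW ij).
pose T := [set g | S g /\ g *m a != a].
have finT : finite_set T by apply: sub_finite_set finS => g [].
have [|e e0 he] := finite_set_gap (f := fun g => - ip a (g *m a) - 1) finT.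
  move=> g [[gg _] ga]; rewrite subr_gt0 -ltrNr.
  apply: Hyp_gap => //; last by rewrite eq_sym.
  exact: isom_Hyp (grp_isom gg) ha.
exists (Num.min e 1) => [|g gg]; first by rewrite lt_min e0 ltr01.
move=> ag; apply: fixed => //; apply/eqP; apply: contraTT isT => ga.
have m1 : Num.min e 1 <= 1 by rewrite ge_min lexx orbT.
have me : Num.min e 1 <= e by rewrite ge_min lexx.
have Sg : S g by apply: inS => //; lra.
by move: (he g (conj Sg ga)) => /=; lra.
Qed.

Lemma grp_countable (R : realType) (n : nat) (M : hyp_manifold R n) :
  countable (grp M).
Proof.
have -> : grp M = \bigcup_k [set g | grp M g /\ forall i j, `|g i j| <= k%:R].
  apply/seteqP; split => [g gg|g [k _ []//]].
  pose x := \sum_i \sum_j `|g i j|.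
  exists (Num.bound x) => //; split => // i j.
  apply: (@le_trans _ _ x).
    rewrite /x (bigD1 i)//= (bigD1 j)//= -addrA lerDl addr_ge0//.
      exact: sumr_ge0.
    by apply: sumr_ge0 => k _; apply: sumr_ge0.
  apply/ltW/archi_boundP; apply: sumr_ge0 => k _; exact: sumr_ge0.
apply: bigcup_countable => // k _; apply: finite_set_countable.
exact: grp_bounded_finite.
Qed.

(** * Reflections *)

(** The reflection in w; the conventions on division make it the identity when
F(w, w) = 0. *)
Definition refl_mx (R : realType) (d : nat) (F : 'M[R]_d) (w : 'cV[R]_d) :
  'M[R]_d := 1%:M - (2 / bil F w w) *: (w *m (w^T *m F)).

Lemma refl_mxE (R : realType) (d : nat) (F : 'M[R]_d) w x :
  refl_mx F w *m x = x - (2 / bil F w w * bil F w x) *: w.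
Proof.
rewrite mulmxBl mul1mx -scalemxAl -mulmxA; congr (_ - _).
have -> : w^T *m F *m x = (bil F w x)%:M.
  by apply/matrixP => i j; rewrite !ord1 [RHS]mxE eqxx mulr1n.
by rewrite mul_mx_scalar scalerA.
Qed.

Lemma refl_mxK (R : realType) (d : nat) (F : 'M[R]_d) w :
  refl_mx F w *m refl_mx F w = 1%:M.
Proof.
rewrite {2}/refl_mx mulmxBr mulmx1 -scalemxAr [refl_mx F w *m (w *m _)]mulmxA.
have [w0|w0] := eqVneq (bil F w w) 0.
  by rewrite /refl_mx w0 invr0 mulr0 !scale0r !subr0.
have -> : refl_mx F w *m w = - w.
  rewrite refl_mxE divfK// scaler_nat.
  by rewrite mulr2n opprD addrA subrr add0r.
by rewrite mulNmx scalerN opprK /refl_mx subrK.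
Qed.

Lemma refl_mx_bil (R : realType) (d : nat) (F : 'M[R]_d) w x y :
  F^T = F -> bil F (refl_mx F w *m x) (refl_mx F w *m y) = bil F x y.
Proof.
move=> Fs; rewrite !refl_mxE !bilE (bilC x w Fs).
have [w0|w0] := eqVneq (bil F w w) 0; first by rewrite w0 invr0; ring.
by field.
Qed.

Lemma refl_mx_unit (R : realType) (d : nat) (F : 'M[R]_d) w :
  refl_mx F w \in unitmx.
Proof. by have [] := mulmx1_unit (refl_mxK F w). Qed.

Lemma det_refl_mx (R : realType) (d : nat) (F : 'M[R]_d) w :
  `|\det (refl_mx F w)| = 1.
Proof.
apply/eqP; rewrite -(@eqrXn2 _ 2)//; rewrite -normrX expr2 -det_mulmx.
by rewrite refl_mxK det1 normr1 expr1n.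
Qed.

Lemma image_caratheodory (R : realType) (d : nat) (T : 'M[R]_d.+1) A :
  T \in unitmx -> `|\det T| = 1 ->
  (@leb_outer R d.+1).-caratheodory A ->
  (@leb_outer R d.+1).-caratheodory (mulmx T @` A).
Proof.
move=> uT dT mA X; pose Y := mulmx (invmx T) @` X.
have XY (B : set 'cV[R]_d.+1) : X `&` mulmx T @` B = mulmx T @` (Y `&` B).
  apply/seteqP; split => [x [Xx [b Bb bx]]|_ [_ [[x Xx <-] Bx] <-]].
    exists b => //; split => //; exists x => //; by rewrite -bx mulKmx.
  by rewrite mulKVmx//; split => //; exists (invmx T *m x) => //; rewrite mulKVmx.
have XYC : X `&` ~` (mulmx T @` A) = mulmx T @` (Y `&` ~` A).
  rewrite -XY; congr (_ `&` _); apply/seteqP; split => [x nA|_ [b nAb <-] [a Aa]].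
    exists (invmx T *m x); last by rewrite mulKVmx.
    by move=> Ax; apply: nA; exists (invmx T *m x) => //; rewrite mulKVmx.
  by move=> /(congr1 (mulmx (invmx T))); rewrite !mulKmx// => ab; apply: nAb; rewrite -ab.
rewrite XY XYC !leb_outer_image// -mA /Y leb_outer_image//.
  by rewrite unitmx_inv.
by rewrite det_inv normfV dT invr1.
Qed.

Lemma unitmx_ker0 (R : realType) (d : nat) (A : 'M[R]_d) :
  (forall c : 'cV[R]_d, A *m c = 0 -> c = 0) -> A \in unitmx.
Proof.
move=> h; rewrite -unitmx_tr -row_free_unit -kermx_eq0; apply/rowV0P => v.
move=> /sub_kermxP vA; apply: trmx_inj; rewrite trmx0; apply: h.
by rewrite -[A]trmxK -trmx_mul vA trmx0.
Qed.

Lemma bil_bound (R : realType) (d : nat) (F : 'M[R]_d) :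
  exists2 K : R, 0 <= K & forall (e1 e2 : R) (x y : 'cV[R]_d),
    (forall i, `|x i ord0| <= e1) -> (forall i, `|y i ord0| <= e2) ->
    `|bil F x y| <= K * (e1 * e2).
Proof.
exists (\sum_i \sum_j `|F j i|).
  by apply: sumr_ge0 => i _; exact: sumr_ge0.
move=> e1 e2 x y xe ye; rewrite /bil mxE mulr_suml.
apply: (le_trans (ler_norm_sum _ _ _)); apply: ler_sum => i _.
rewrite normrM mxE mulr_suml.
have -> : (\sum_j `|F j i| * (e1 * e2)) = (\sum_j e1 * `|F j i|) * e2.
  by rewrite mulr_suml; apply: eq_bigr => j _; ring.
apply: ler_pM => //; apply: (le_trans (ler_norm_sum _ _ _)).
by apply: ler_sum => j _; rewrite normrM mxE ler_wpM2r.
Qed.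

Lemma normalize_Hyp (R : realType) (n : nat) (a y : 'cV[R]_n.+1) :
  Hyp a -> ip y y < 0 -> ip y a < 0 -> Hyp ((Num.sqrt (- ip y y))^-1 *: y).
Proof.
move=> ha yy ya; have s0 : 0 < Num.sqrt (- ip y y) by rewrite sqrtr_gt0; lra.
apply: (Hyp_intro ha); last by rewrite bilZl pmulr_rlt0 ?invr_gt0.
have : Num.sqrt (- ip y y) ^+ 2 = - ip y y by rewrite sqr_sqrtr//; lra.
rewrite !bilE; move: s0; set s := Num.sqrt _ => s0 s2.
have -> : ip y y = - s ^+ 2 by lra.
by field; lra.
Qed.

(** * The packing bound *)

Lemma bil_delta (R : realType) (d : nat) (F : 'M[R]_d) i j :
  bil F (delta_mx i ord0) (delta_mx j ord0) = F i j.
Proof.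
by rewrite /bil trmx_delta -rowE -colE !mxE.
Qed.

(** T preserves the Gram matrix of F. *)
Lemma det_isometry (R : realType) (d : nat) (F T : 'M[R]_d) :
  F \in unitmx -> (forall x y, bil F (T *m x) (T *m y) = bil F x y) ->
  `|\det T| = 1.
Proof.
move=> uF h; have TF : T^T *m F *m T = F.
  apply/matrixP => i j; rewrite -[RHS]bil_delta -h -[LHS]bil_delta /bil.
  by rewrite trmx_mul !mulmxA.
have /(congr1 determinant) := TF; rewrite !det_mulmx det_tr => e.
have dF : \det F != 0 by rewrite -unitfE -unitmxE.
have : \det T ^+ 2 = 1 by apply: (mulIf dF); rewrite mul1r -[RHS]e; ring.
by move=> dT; apply/eqP; rewrite -(@eqrXn2 _ 2)// -normrX dT normr1 expr1n.
Qed.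

(** Reflections in differences act transitively on hyperbolic space: they carry a ball
around one point to a ball around any other. *)
Lemma refl_swap (R : realType) (n : nat) (o x : 'cV[R]_n.+1) :
  Hyp o -> Hyp x -> refl_mx (lorentz R n) (x - o) *m o = x.
Proof.
move=> ho hx; rewrite refl_mxE.
have [->|xo] := eqVneq x o; first by rewrite subrr scaler0 subr0.
have := Hyp_gap hx ho xo; rewrite !bilE (Hyp_ip ho) (Hyp_ip hx) (ipC o x) => lt.
rewrite (_ : _ * _ = -1); last by field; lra.
by rewrite scaleN1r opprK addrC subrK.
Qed.

Lemma small_radius (R : realType) (K e1 : R) : 0 <= K -> 0 <= e1 ->
  exists eps : R,
    [/\ 0 < eps, K * (e1 * eps) <= 100^-1 & K * (eps * eps) <= 100^-1].
Proof.
move=> K0 e10; pose den := 100 * ((K + 1) * (e1 + 1)).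
have den1 : 1 <= den by rewrite /den; nra.
pose eps := den^-1.
have eps0 : 0 < eps by rewrite invr_gt0; lra.
have epsden : eps * den = 1 by rewrite mulVf//; lra.
have eps1 : eps <= 1 by rewrite invf_le1//; lra.
exists eps; split => //.
  have : 0 <= eps * (K + e1 + 1) by rewrite mulr_ge0; lra.
  by move: epsden; rewrite /den; lra.
have h1 : K * (eps * eps) <= K * eps.
  by rewrite ler_wpM2l// -[leRHS]mulr1 ler_pM2l.
have : 0 <= eps * (K * e1 + e1 + 1) by rewrite mulr_ge0 ?addr_ge0 ?mulr_ge0//; lra.
by move: epsden; rewrite /den; lra.
Qed.

Definition in_span (R : realType) (n d : nat) (L : 'M[R]_(n, d)) (y : 'cV[R]_n) :=
  exists c : 'cV[R]_d, y = L *m c.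

Definition subgroup (R : realType) (n : nat) (M : hyp_manifold R n)
    (G : set 'M[R]_n.+1) : Prop :=
  [/\ G `<=` grp M, G 1%:M, forall g h, G g -> G h -> G (g *m h) &
      forall g, G g -> G (invmx g)].

(** x is the centre of a ball of fixed radius contained in X, within the
hyperbolic subspace cut out by the span of L: - ip x z <= 2 bounds the distance. *)
Definition deep (R : realType) (n d : nat) (L : 'M[R]_(n.+1, d))
    (X : set 'cV[R]_n.+1) (x : 'cV[R]_n.+1) : Prop :=
  [/\ Hyp x, in_span L x &
      forall z, Hyp z -> in_span L z -> - ip x z <= 2 -> X z].

(** Points of X whose translates under G are far apart carry disjoint translates
of a ball of fixed volume, so finite volume of the quotient bounds their number.
The volumes are those of truncated cones in coordinates on the span of L, where
elements of G have determinant 1 or -1. *)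
Lemma packing (R : realType) (n d : nat) (M : hyp_manifold R n)
    (G : set 'M[R]_n.+1) (L : 'M[R]_(n.+1, d.+1)) (X : set 'cV[R]_n.+1)
    (o : 'cV[R]_n.+1) :
  \rank L = d.+1 -> subgroup M G ->
  (forall g y, G g -> in_span L y -> in_span L (g *m y)) ->
  finite_covolume L G X -> Hyp o -> in_span L o ->
  exists m, forall x : nat -> 'cV[R]_n.+1,
    (forall i, (i < m)%N -> deep L X (x i)) ->
    exists i j g, [/\ (i < m)%N, (j < m)%N, G g, - ip (x i) (g *m x j) <= 8 &
      i <> j \/ g <> 1%:M].
Proof.
move=> rL [GM G1 GMul GV] GL [D [DX Dfin] Dcov] ho oL.
have [P PL] : exists P, P *m L = 1%:M.
  have /row_freeP[B LB] : row_free L^T by rewrite /row_free mxrank_tr rL.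
  by exists B^T; apply: trmx_inj; rewrite trmx_mul trmxK LB trmx1.
have LP y : in_span L y -> L *m (P *m y) = y.
  by move=> [c ->]; rewrite (mulmxA P) PL mul1mx.
have PLc (c : 'cV[R]_d.+1) : P *m (L *m c) = c by rewrite mulmxA PL mul1mx.
pose G0 := L^T *m lorentz R n *m L.
have ipL c c' : ip (L *m c) (L *m c') = bil G0 c c'.
  by rewrite /bil trmx_mul /G0 !mulmxA.
have G0s : G0^T = G0 by rewrite /G0 !trmx_mul trmxK lorentz_sym mulmxA.
have G0u : G0 \in unitmx.
  apply: unitmx_ker0 => c Gc.
  have ort y : in_span L y -> ip (L *m c) y = 0.
    by move=> [c' ->]; rewrite ipC ipL /bil -mulmxA Gc mulmx0 mxE.
  have [Lc|Lc] := eqVneq (L *m c) 0; first by rewrite -(PLc c) Lc mulmx0.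
  have := orth_timelike_gt0 (z := o) _ (ort _ oL) Lc.
  rewrite (Hyp_ip ho) ort; last by exists c.
  by rewrite ltxx => /(_ (ltrN10 _)).
pose rho (g : 'M[R]_n.+1) := P *m g *m L.
have Lrho g (c : 'cV[R]_d.+1) : G g -> L *m (rho g *m c) = g *m (L *m c).
  by move=> Gg; rewrite /rho -!mulmxA LP//; apply: GL => //; exists c.
have Linj (c c' : 'cV[R]_d.+1) : L *m c = L *m c' -> c = c'.
  by move=> e; rewrite -(PLc c) e PLc.
have rho_det g : G g -> `|\det (rho g)| = 1.
  move=> Gg; apply: (det_isometry G0u) => x y.
  by rewrite -!ipL !Lrho// isom_ip//; exact: grp_isom (GM _ Gg).
have rho_unit g : G g -> rho g \in unitmx.
  move=> Gg; rewrite unitmxE unitfE -normr_gt0 (rho_det _ Gg); exact: ltr01.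
have rhoVK g (c : 'cV[R]_d.+1) : G g -> rho (invmx g) *m (rho g *m c) = c.
  move=> Gg; apply: Linj; rewrite !Lrho//; last exact: GV.
  by rewrite mulKmx// (grp_unit (GM _ Gg)).
have rhoKV g (c : 'cV[R]_d.+1) : G g -> rho g *m (rho (invmx g) *m c) = c.
  move=> Gg; apply: Linj; rewrite !Lrho//; last exact: GV.
  by rewrite mulKVmx// (grp_unit (GM _ Gg)).
(* the points of the box Q0 around o / 2 lie on rays through points close to o, at
   heights at most 1 *)
have [c0 Lc0] : exists c0 : 'cV[R]_d.+1, L *m c0 = 2^-1 *: o.
  by exists (2^-1 *: (P *m o)); rewrite -scalemxAr LP.
have c00 : bil G0 c0 c0 = - 4^-1 by rewrite -ipL Lc0 !bilE (Hyp_ip ho); field.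
have [K K0 hK] := bil_bound G0.
pose e1 := \sum_i `|c0 i ord0|.
have e10 : 0 <= e1 by exact: sumr_ge0.
have c0e1 i : `|c0 i ord0| <= e1.
  by rewrite /e1 (bigD1 i)//= lerDl; exact: sumr_ge0.
have [eps [eps0 Keps Keps2]] := small_radius K0 e10.
pose lo : 'cV[R]_d.+1 := c0 - const_mx eps; pose hi := c0 + const_mx eps.
have lohi i : lo i ord0 <= hi i ord0 by rewrite !mxE; lra.
pose Q0 := box lo hi.
have hQ0 (c : 'cV[R]_d.+1) : Q0 c -> exists s z, [/\ 0 < s <= 1, Hyp z, L *m c = s *: z,
    in_span L z & - ip o z <= 2].
  move=> Qc; have [dl cE] : exists dl, c = c0 + dl.
    by exists (c - c0); rewrite addrC subrK.
  have dle i : `|dl i ord0| <= eps.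
    have := Qc i; rewrite cE !mxE ler_norml => /andP[l1 l2].
    by apply/andP; split; lra.
  have := hK _ _ _ _ c0e1 dle; have := hK _ _ _ _ dle dle.
  rewrite !ler_norml => /andP[q1 q2] /andP[b1 b2].
  have yy : ip (L *m c) (L *m c) = - 4^-1 + 2 * bil G0 c0 dl + bil G0 dl dl.
    by rewrite ipL cE !bilE c00 (bilC dl c0 G0s); ring.
  have oy : ip o (L *m c) = 2 * (- 4^-1 + bil G0 c0 dl).
    have -> : o = 2 *: (L *m c0) by rewrite Lc0 scalerA divff ?scale1r.
    by rewrite bilZl ipL cE bilDr c00.
  pose s := Num.sqrt (- ip (L *m c) (L *m c)).
  have s2 : s ^+ 2 = - ip (L *m c) (L *m c) by rewrite sqr_sqrtr//; lra.
  have s0 : 0 < s by rewrite sqrtr_gt0; lra.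
  have slo : 2 / 5 <= s.
    by rewrite -ler_sqr ?nnegrE//; [rewrite s2; lra | exact: ltW].
  have shi : s <= 1.
    by rewrite -ler_sqr ?nnegrE//; [rewrite s2; lra | exact: ltW].
  exists s, (s^-1 *: (L *m c)); split.
  - by rewrite s0.
  - by apply: (normalize_Hyp ho); rewrite 1?ipC; lra.
  - by rewrite scalerA divff ?scale1r// gt_eqF.
  - by exists (s^-1 *: c); rewrite scalemxAr.
  - rewrite bilZr -mulrN mulrC ler_pdivrMr//; lra.
pose v := box_vol lo hi.
have v0 : 0 < v.
  by apply: prodr_gt0 => i _; rewrite !mxE; lra.
pose S := [set c : 'cV[R]_d.+1 | exists2 x, D x & exists2 t : R, 0 < t <= 1 & L *m c = t *: x].
have Sfin : (leb_outer S < +oo)%E by exact: Dfin.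
have [V VE] : exists V : R, leb_outer S = V%:E.
  exists (fine (leb_outer S)); rewrite fineK// ge0_fin_numE//; exact: leb_outer_ge0.
have V0 : 0 <= V by rewrite -lee_fin -VE leb_outer_ge0.
(* m copies of Q0 have a total volume larger than that of S *)
exists (Num.bound (V / v)); set m := Num.bound _ => x hx.
have mV : V < m%:R * v.
  by rewrite -ltr_pdivrMr//; apply: archi_boundP; rewrite divr_ge0// ltW.
apply: contrapT => no.
have far i j g : (i < m)%N -> (j < m)%N -> G g -> - ip (x i) (g *m x j) <= 8 ->
    i = j /\ g = 1%:M.
  move=> im jm Gg le8; apply: contrapT => nij; apply: no.
  exists i, j, g; split => //; apply: contrapT => nn; apply: nij.
  by split; apply: contrapT => ?; apply: nn; [left|right].
(* h i is the reflection exchanging o and x i, and T i is h i in the coordinates L *)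
pose w i := x i - o.
pose h i := refl_mx (lorentz R n) (w i).
pose T i := refl_mx G0 (P *m w i).
have LT i (c : 'cV[R]_d.+1) : (i < m)%N -> L *m (T i *m c) = h i *m (L *m c).
  move=> im; have [_ [cx xE] _] := hx _ im; have [co0 oE] := oL.
  have LPw : L *m (P *m w i) = w i.
    by apply: LP; exists (cx - co0); rewrite mulmxBr -xE -oE.
  by rewrite !refl_mxE mulmxBr -scalemxAr LPw -!ipL LPw.
pose Q i := mulmx (T i) @` Q0.
have hQ i c : (i < m)%N -> Q i c -> exists s z, [/\ 0 < s <= 1, Hyp z,
    L *m c = s *: z, in_span L z & - ip (x i) z <= 2].
  move=> im [b /hQ0[s [z [s01 hz Lb [cz zE] oz]]] <-].
  have [hxi _ _] := hx _ im.
  have hip y y' : ip (h i *m y) (h i *m y') = ip y y'.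
    by apply: refl_mx_bil; exact: lorentz_sym.
  have ho' : h i *m o = x i by exact: refl_swap.
  exists s, (h i *m z); split => //.
  - apply: (Hyp_intro hxi); first by rewrite hip (Hyp_ip hz).
    by rewrite -ho' hip; exact: Hyp_ip_lt0.
  - by rewrite LT// Lb scalemxAr.
  - by exists (T i *m cz); rewrite LT// zE.
  - by rewrite -ho' hip.
(* the translates of the copies Q i of Q0 are pairwise disjoint: if x i and k x j
   are at distance at most arcosh 2 from a common point, then - ip (x i) (k x j) <= 8 *)
have key i j g g' (c : 'cV[R]_d.+1) : (i < m)%N -> (j < m)%N -> G g -> G g' ->
    Q i (rho g *m c) -> Q j (rho g' *m c) -> i = j /\ g = g'.
  move=> im jm Gg Gg' /(hQ _ _ im)[s [z [/andP[s0 _] hz Lz _ xz]]].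
  move=> /(hQ _ _ jm)[s' [z' [/andP[s'0 _] hz' Lz' _ xz']]].
  rewrite !Lrho// in Lz Lz'.
  pose k := g *m invmx g'.
  have Gk : G k by apply: GMul => //; exact: GV.
  have ik := grp_isom (GM _ Gk).
  have ug' : g' \in unitmx by exact: grp_unit (GM _ Gg').
  have skz : s *: z = s' *: (k *m z').
    by rewrite scalemxAr -Lz' /k -mulmxA mulKmx// Lz.
  have ss : s = s'.
    have := congr1 (fun y => ip y y) skz.
    rewrite /= !bilE isom_ip// (Hyp_ip hz) (Hyp_ip hz') => e.
    apply/eqP; rewrite -(@eqrXn2 _ 2) ?(ltW s0) ?(ltW s'0)// !expr2; apply/eqP; lra.
  have zk : z = k *m z'.
    have : s *: z = s *: (k *m z') by rewrite {2}ss.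
    by apply: scalerI; rewrite gt_eqF.
  have [hxi _ _] := hx _ im; have [hxj _ _] := hx _ jm.
  have hkx := isom_Hyp ik hxj.
  have tri := Hyp_triangle hxi hkx hz.
  have e2 : ip (k *m x j) z = ip (x j) z' by rewrite zk isom_ip.
  rewrite e2 in tri.
  have le8 : - ip (x i) (k *m x j) <= 8.
    apply: (le_trans tri); have := Hyp_ip_le hxi hz; have := Hyp_ip_le hxj hz'.
    by nra.
  have [-> k1] := far _ _ _ im jm Gk le8; split => //.
  by rewrite -[RHS]mul1mx -k1 /k mulmxKV.
have Tu i : T i \in unitmx by exact: refl_mx_unit.
have Td i : `|\det (T i)| = 1 by exact: det_refl_mx.
pose mu : {outer_measure set 'cV[R]_d.+1 -> \bar R} := @leb_outer R d.+1.
pose A i := if (i < m)%N then Q i else set0.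
have mA i : mu.-caratheodory (A i).
  rewrite /A; case: ifP => _; last exact: caratheodory_measurable_set0.
  by apply: image_caratheodory => //; exact: box_caratheodory.
have rho1 (c : 'cV[R]_d.+1) : rho 1%:M *m c = c by rewrite /rho mulmx1 PL mul1mx.
have tA : trivIset setT A.
  move=> i j _ _ [c [Aic Ajc]]; move: Aic Ajc; rewrite /A.
  case: ifP => // im; case: ifP => // jm Qi Qj.
  by have [] := key i j 1%:M 1%:M c im jm G1 G1; rewrite ?rho1.
pose Qt := \big[setU/set0]_(i < m) A i.
have mQt : mu.-caratheodory Qt by exact: caratheodory_measurable_bigsetU.
have muQt : mu Qt = (m%:R * v)%:E.
  have := caratheodory_additive mA tA m setT; rewrite setTI => ->.
  rewrite (eq_bigr (fun=> v%:E)) => [|i _].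
    by rewrite sumEFin sumr_const card_ord mulr_natl.
  rewrite setTI /A ltn_ord.
  have -> : mu (Q i) = leb_outer Q0 by exact: leb_outer_image.
  exact: leb_outer_box.
have QtP c : Qt c -> exists2 i, (i < m)%N & Q i c.
  rewrite /Qt -bigcup_mkord => -[i /= im]; rewrite /A im => Qc; by exists i.
(* with the elements of G numbered by f, B k is the part of Qt carried into S by the
   inverse of the k-th element, and E k the preimage of Qt under that element *)
have [f finj] : exists f : 'M[R]_n.+1 -> nat, {in G &, injective f}.
  apply/countable_injP; exact: sub_countable (subset_card_le GM) (grp_countable M).
pose B k := [set c : 'cV[R]_d.+1 | Qt c /\ exists g, [/\ G g, f g = k & S (rho (invmx g) *m c)]].
pose E k := [set c : 'cV[R]_d.+1 | exists g, [/\ G g, f g = k & Qt (rho g *m c)]].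
have BE k : (mu (B k) <= mu (S `&` E k))%E.
  have [[g [Gg fg]]|none] := pselect (exists g, G g /\ f g = k); last first.
    rewrite (_ : B k = set0) ?outer_measure0 ?outer_measure_ge0//.
    by rewrite -subset0 => c [_ [g [Gg fg _]]]; apply: none; exists g.
  rewrite -[leRHS](leb_outer_image _ (rho_unit _ Gg) (rho_det _ Gg)).
  apply: le_outer_measure => c [Qc [g' [Gg' fg' Sc]]].
  have gg' : g' = g by apply: finj; rewrite ?inE// fg fg'.
  rewrite gg' in Sc; exists (rho (invmx g) *m c); last by rewrite rhoKV.
  by split => //; exists g; rewrite rhoKV.
have mE k : mu.-caratheodory (E k).
  have [[g [Gg fg]]|none] := pselect (exists g, G g /\ f g = k); last first.
    rewrite (_ : E k = set0); first exact: caratheodory_measurable_set0.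
    by rewrite -subset0 => c [g [Gg fg _]]; apply: none; exists g.
  have -> : E k = mulmx (rho (invmx g)) @` Qt.
    apply/seteqP; split => [c [g' [Gg' fg' Qc]]|_ [c Qc <-]].
      have gg' : g' = g by apply: finj; rewrite ?inE// fg fg'.
      by rewrite gg' in Qc; exists (rho g *m c) => //; rewrite rhoVK.
    by exists g; rewrite rhoKV.
  by apply: image_caratheodory => //; [exact/rho_unit/GV | exact/rho_det/GV].
have tE : trivIset setT E.
  move=> k l _ _ [c [[g [Gg <- /QtP[i im Qi]]] [g' [Gg' <- /QtP[j jm Qj]]]]].
  by have [_ ->] := key _ _ _ _ _ im jm Gg Gg' Qi Qj.
have QtB : Qt `<=` \bigcup_k B k.
  move=> c Qc; have [i im Qi] := QtP _ Qc.
  have [s [z [s01 hz Lc zL xz]]] := hQ _ _ im Qi.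
  have [_ _ deep] := hx _ im; have := deep z hz zL xz.
  move=> /Dcov[g [y [Gg Dy zE]]]; exists (f g) => //; split => //.
  exists g; split => //; exists y => //; exists s => //.
  rewrite Lrho; last exact: GV.
  by rewrite Lc zE -scalemxAr mulKmx// (grp_unit (GM _ Gg)).
have : (mu Qt <= mu S)%E.
  apply: (le_trans (le_outer_measure mu _ _ QtB)).
  apply: (le_trans (outer_measure_sigma_subadditive mu B)).
  apply: (@le_trans _ _ (\sum_(k <oo) mu (S `&` E k))%E).
    by apply: lee_nneseries => [k _ _|k _]; [exact: outer_measure_ge0 | exact: BE].
  apply: le_trans (caratheodory_lime_le mE tE S).
  by rewrite leeDl// outer_measure_ge0.
by rewrite muQt [mu S]VE lee_fin leNgt mV.
Qed.

(** * Curves escaping to infinity *)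

Lemma ge1_neq0 (R : realType) (r : R) : 1 <= r -> r != 0.
Proof. by move=> r1; rewrite gt_eqF//; lra. Qed.

Lemma hyperbola_ge (R : realType) (r s : R) : 0 < r -> 20 * r <= s ->
  20 <= r / s + s / r.
Proof.
move=> r0 rs; have s0 : 0 < s by lra.
have : 20 <= s / r by rewrite ler_pdivlMr.
have h : 0 < r / s by exact: divr_gt0.
lra.
Qed.

(** A curve leaving every bounded set so fast that its points, and their translates,
separate more and more: sampling it along a geometric progression contradicts the
packing bound. The parameter r is the exponential of an arc length; the first term
of the bound separates translates by nontrivial elements, the second one separates
points of the curve from each other. *)
Lemma no_escape (R : realType) (n d : nat) (M : hyp_manifold R n)
    (G : set 'M[R]_n.+1) (L : 'M[R]_(n.+1, d.+1)) (X : set 'cV[R]_n.+1)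
    (a : 'cV[R]_n.+1) (x : R -> 'cV[R]_n.+1) (r0 : R) :
  \rank L = d.+1 -> subgroup M G ->
  (forall g y, G g -> in_span L y -> in_span L (g *m y)) ->
  finite_covolume L G X -> Hyp a -> in_span L a ->
  (forall r, r0 <= r -> 1 <= r -> deep L X (x r)) ->
  (forall g r s, G g -> 1 <= r -> 1 <= s ->
    r * s / 4 * (- ip a (g *m a) - 1) + (r / s + s / r) / 2 <=
      - ip (x r) (g *m x s)) ->
  False.
Proof.
move=> rL sG GL fin ha aL xdeep xfar.
have [m hm] := packing rL sG GL fin ha aL.
have [e e0 he] := grp_moves_away M ha.
pose b := Num.max 1 (Num.max r0 (32 / e)).
have b1 : 1 <= b by rewrite le_max lexx.
have br0 : r0 <= b by rewrite !le_max lexx !orbT.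
have be : 32 <= b * e by rewrite -ler_pdivrMr// !le_max lexx !orbT.
pose t (i : nat) : R := b * 20 ^+ i.
have tb i : b <= t i by rewrite /t ler_peMr ?exprn_ege1//; lra.
have [i _|i [j [g [_ _ Gg far ne]]]] := hm (fun i => x (t i)).
  by apply: xdeep; apply: le_trans (tb i).
have := xfar g (t i) (t j) Gg (le_trans b1 (tb i)) (le_trans b1 (tb j)).
have [GM _ _ _] := sG; have gg := GM _ Gg.
have ge1 := Hyp_ip_le ha (isom_Hyp (grp_isom gg) ha).
have ti0 : 0 < t i by have := tb i; lra.
have tj0 : 0 < t j by have := tb j; lra.
have tij0 : 0 < t i * t j by exact: mulr_gt0.
have t20 k l : (k < l)%N -> 20 * t k <= t l.
  move=> kl; rewrite /t mulrCA ler_pM2l; last by lra.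
  by rewrite -exprS ler_weXn2l//; lra.
have [ij|ij|ij] := ltngtP i j.
- have := hyperbola_ge ti0 (t20 _ _ ij).
  have : 0 <= t i * t j / 4 * (- ip a (g *m a) - 1).
    by rewrite mulr_ge0 ?divr_ge0 ?(ltW tij0)//; lra.
  by lra.
- have := hyperbola_ge tj0 (t20 _ _ ij).
  have : 0 <= t i * t j / 4 * (- ip a (g *m a) - 1).
    by rewrite mulr_ge0 ?divr_ge0 ?(ltW tij0)//; lra.
  by lra.
case: ne => [//|g1]; rewrite ij in far *; rewrite divff ?gt_eqF//.
have big : e <= - ip a (g *m a) - 1.
  by rewrite leNgt; apply/negP => lt; apply: g1; apply: he => //; lra.
have : b * b <= t j * t j by apply: ler_pM => //; lra.
move=> bb; have h1 : b * b * e <= t j * t j * (- ip a (g *m a) - 1).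
  by apply: ler_pM => //; [nra | lra].
have h2 : 32 <= b * b * e by rewrite -mulrA; nra.
by lra.
Qed.

(** The geodesic from a with direction w, with r the exponential of the arc length. *)
Definition geodesic (R : realType) (n : nat) (a w : 'cV[R]_n.+1) (r : R) :
  'cV[R]_n.+1 := ((r + r^-1) / 2) *: a + ((r - r^-1) / 2) *: w.

Lemma geodesic_Hyp (R : realType) (n : nat) (a w : 'cV[R]_n.+1) (r : R) :
  Hyp a -> ip w w = 1 -> ip a w = 0 -> 1 <= r -> Hyp (geodesic a w r).
Proof.
move=> ha ww aw r1; have r0 : 0 < r^-1 by rewrite invr_gt0; lra.
apply: (Hyp_intro ha); rewrite /geodesic !bilE (ipC w a) (Hyp_ip ha) aw ?ww.
  by field; lra.
by have : 0 < r + r^-1 by [lra]; lra.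
Qed.

(** All translates of a lie in the hyperplane orthogonal to w, and the geodesic moves
away from this hyperplane; as ip w (g w) <= ip w w, different translates of the
geodesic do not run towards each other. *)
Lemma no_expanding_geodesic (R : realType) (n d : nat) (M : hyp_manifold R n)
    (G : set 'M[R]_n.+1) (L : 'M[R]_(n.+1, d.+1)) (X : set 'cV[R]_n.+1)
    (a w : 'cV[R]_n.+1) (r0 : R) :
  \rank L = d.+1 -> subgroup M G ->
  (forall g y, G g -> in_span L y -> in_span L (g *m y)) ->
  finite_covolume L G X -> Hyp a -> in_span L a -> ip w w = 1 ->
  (forall g, G g -> ip (g *m a) w = 0) -> (forall g, G g -> ip w (g *m w) <= 1) ->
  (forall r, r0 <= r -> 1 <= r -> deep L X (geodesic a w r)) ->
  False.
Proof.
move=> rL sG GL fin ha aL ww gaw gww xdeep.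
have [GM _ _ GV] := sG.
apply: (no_escape rL sG GL fin ha aL xdeep) => g r s Gg r1 s1.
have ig := grp_isom (GM _ Gg).
have agw : ip a (g *m w) = 0.
  by rewrite ipC (isom_ip_inv _ _ ig) ipC gaw//; exact: GV.
rewrite /geodesic !mulmxDr -!scalemxAr !bilE agw (ipC w (g *m a)) gaw//.
have q1 : 0 <= - ip a (g *m a) - 1.
  by have := Hyp_ip_le ha (isom_Hyp ig ha); lra.
have p1 := gww _ Gg.
move: q1; set q := - ip a (g *m a) - 1 => q1.
have -> : ip a (g *m a) = - (q + 1) by rewrite /q; ring.
have r0' : 0 < r^-1 by rewrite invr_gt0; lra.
have s0' : 0 < s^-1 by rewrite invr_gt0; lra.
have ri1 : r^-1 <= 1 by rewrite invf_le1//; lra.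
have si1 : s^-1 <= 1 by rewrite invf_le1//; lra.
set p := ip w (g *m w) in p1 *.
have h1 : 0 <= (r - r^-1) / 2 * ((s - s^-1) / 2) * (1 - p).
  by rewrite !mulr_ge0//; lra.
have h2 : 0 <= (r * s^-1 + r^-1 * s + r^-1 * s^-1) * q.
  by rewrite mulr_ge0// !addr_ge0// mulr_ge0//; lra.
lra.
Qed.

(** The curve is the geodesic from a away from the point at infinity w. All its
translates start at w, so they diverge. *)
Lemma no_invariant_null (R : realType) (n d : nat) (M : hyp_manifold R n)
    (G : set 'M[R]_n.+1) (L : 'M[R]_(n.+1, d.+1)) (X : set 'cV[R]_n.+1)
    (a w : 'cV[R]_n.+1) :
  \rank L = d.+1 -> subgroup M G ->
  (forall g y, G g -> in_span L y -> in_span L (g *m y)) ->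
  finite_covolume L G X -> Hyp a -> in_span L a -> in_span L w ->
  ip w w = 0 -> w != 0 -> (forall g, G g -> g *m w = w) ->
  (forall x, Hyp x -> in_span L x -> X x) ->
  False.
Proof.
move=> rL sG GL fin ha aL wL ww w0 gw allX.
have [GM _ _ GV] := sG.
have aw0 : ip a w != 0 by apply: nonspacelike_ip_neq0 => //; rewrite ww.
have [u [au uu gu uL]] : exists u, [/\ ip a u = -1, ip u u = 0,
    forall g, G g -> g *m u = u & in_span L u].
  exists ((- (ip a w)^-1) *: w); split.
  - by rewrite bilZr; field.
  - by rewrite !bilE ww; ring.
  - by move=> g Gg; rewrite -scalemxAr gw.
  - by case: wL => c wE; exists (- (ip a w)^-1 *: c); rewrite -scalemxAr -wE.
pose x r := r *: a + ((r^-1 - r) / 2) *: u.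
apply: (no_escape (x := x) (r0 := 1) rL sG GL fin ha aL) => [r _ r1|g r s Gg r1 s1].
  have hx : Hyp (x r).
    by apply: (Hyp_intro ha); rewrite /x !bilE (ipC u a) (Hyp_ip ha) au ?uu;
      [field; exact: ge1_neq0 | have : 0 < r^-1 by [rewrite invr_gt0; lra]; lra].
  have xL : in_span L (x r).
    have [[c aE] [c' uE]] := (aL, uL); exists (r *: c + ((r^-1 - r) / 2) *: c').
    by rewrite mulmxDr -!scalemxAr -aE -uE.
  by split => // z hz zL _; exact: allX.
have ig := grp_isom (GM _ Gg).
have uga : ip u (g *m a) = -1.
  by rewrite -(gu _ Gg) isom_ip// ipC.
rewrite /x !mulmxDr -!scalemxAr (gu _ Gg) !bilE au uu uga.
have q1 : 0 <= - ip a (g *m a) - 1.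
  by have := Hyp_ip_le ha (isom_Hyp ig ha); lra.
move: q1; set q := - ip a (g *m a) - 1 => q1.
have -> : ip a (g *m a) = - (q + 1) by rewrite /q; ring.
have h1 : 0 <= r * s * q by rewrite !mulr_ge0//; lra.
have rr : r * r^-1 = 1 by rewrite divff ?ge1_neq0.
have ss : s * s^-1 = 1 by rewrite divff ?ge1_neq0.
lra.
Qed.

(** Both subspaces have dimension n. *)
Lemma in_span_orth (R : realType) (n : nat) (L : 'M[R]_(n.+1, n))
    (v y : 'cV[R]_n.+1) :
  \rank L = n -> v != 0 -> v^T *m lorentz R n *m L = 0 ->
  in_span L y <-> ip y v = 0.
Proof.
move=> rL v0 vL; split => [[c ->]|yv].
  by rewrite ipC /bil mulmxA vL mul0mx mxE.
pose u := lorentz R n *m v.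
have u0 : u != 0.
  apply: contra_neq v0 => u0; have : lorentz R n *m u = v.
    rewrite /u mulmxA mulmx_diag; apply/matrixP => i j.
    rewrite mul_diag_mx !mxE; case: eqP => _; ring.
  by rewrite u0 mulmx0.
have rk : \rank (kermx u) = n.
  rewrite mxrank_ker; suff -> : \rank u = 1%N by rewrite subSS subn0.
  apply/eqP; rewrite eqn_leq rank_leq_col lt0n mxrank_eq0.
  exact: u0.
have LK : (L^T <= kermx u)%MS.
  apply/sub_kermxP; apply: trmx_inj.
  by rewrite trmx0 !trmx_mul trmxK lorentz_sym.
have /eqmxP/eqmx_sym KL : (L^T == kermx u)%MS.
  by rewrite -mxrank_leqif_eq// mxrank_tr rL rk.
have : (y^T <= L^T)%MS.
  rewrite -KL; apply/sub_kermxP; apply/matrixP => i j.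
  by rewrite !ord1 mulmxA [RHS]mxE.
move=> /submxP[c yE]; exists c^T; apply: trmx_inj.
by rewrite trmx_mul trmxK.
Qed.

(** * The faces of the universal cover *)

Lemma cover_neq0 (R : realType) (n : nat) (M : hyp_manifold R n) :
  exists x, Defs.cover M x.
Proof. by case: M. Qed.

Lemma cover_half_spaces (R : realType) (n : nat) (M : hyp_manifold R n) :
  exists V : set 'cV[R]_n.+1,
    Defs.cover M = @Hyp R n `&` \bigcap_(v in V) half_space v.
Proof. by case: M => C G /= _ [V [_ ->]] *; exists V. Qed.

Lemma cover_local (R : realType) (n : nat) (M : hyp_manifold R n) x :
  Defs.cover M x ->
  (\forall y \near x, Hyp y -> Defs.cover M y) \/
  (exists v, [/\ unit_normal v, hyperplane v x &
     \forall y \near x, Hyp y -> (Defs.cover M y <-> half_space v y)]).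
Proof. by case: M => C G /= _ _ h *; exact: h. Qed.

Lemma cover_finite_covolume (R : realType) (n : nat) (M : hyp_manifold R n) :
  finite_covolume (1%:M : 'M[R]_n.+1) (grp M) (Defs.cover M).
Proof. by case: M. Qed.

Lemma boundary_finite_covolume (R : realType) (n : nat) (M : hyp_manifold R n) v :
  boundary_normal (Defs.cover M) v ->
  exists L : 'M[R]_(n.+1, n),
    [/\ \rank L = n, v^T *m lorentz R n *m L = 0 &
        finite_covolume L (setwise_stab (grp M) (hyperplane v)) (hyperplane v)].
Proof. by case: M => C G /= *; eauto. Qed.

Lemma cover_Hyp (R : realType) (n : nat) (M : hyp_manifold R n) x :
  Defs.cover M x -> Hyp x.
Proof. by have [V ->] := cover_half_spaces M; case. Qed.

(** A point of the geodesic from z in the direction of e, close to z. *)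
Lemma nudge (R : realType) (n : nat) (z e : 'cV[R]_n.+1) (P : 'cV[R]_n.+1 -> Prop) :
  Hyp z -> ip z e = 0 -> 0 < ip e e -> (\forall y \near z, Hyp y -> P y) ->
  exists y c d, [/\ Hyp y, P y, y = c *: z + d *: e & 0 < d].
Proof.
move=> hz ze ee nP; have [eta eta0 hP] := Hyp_near_ball hz nP.
pose k := Num.sqrt (ip e e).
have k0 : 0 < k by rewrite sqrtr_gt0.
have k2 : k ^+ 2 = ip e e by rewrite sqr_sqrtr// ltW.
have [w [ww zw wE]] : exists w, [/\ ip w w = 1, ip z w = 0 & w = k^-1 *: e].
  exists (k^-1 *: e); split => //; last by rewrite bilZr ze mulr0.
  by rewrite !bilE -k2; field; rewrite gt_eqF.
pose t := Num.min 1 eta; have t0 : 0 < t by rewrite lt_min ltr01.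
have t1 : t <= 1 by rewrite ge_min lexx.
have te : t <= eta by rewrite ge_min lexx orbT.
pose r := 1 + t; have r1 : 1 <= r by rewrite /r; lra.
have ri : r^-1 < 1 by rewrite invf_lt1 /r//; lra.
have hy := geodesic_Hyp hz ww zw r1.
exists (geodesic z w r), ((r + r^-1) / 2), ((r - r^-1) / 2 / k); split => //.
- apply: hP => //; rewrite /geodesic bilDr !bilZr (Hyp_ip hz) zw.
  have rr : r * r^-1 = 1 by rewrite divff ?ge1_neq0.
  have ri0 : 0 < r^-1 by rewrite invr_gt0; lra.
  suff : r + r^-1 < 2 + 2 * eta by lra.
  rewrite -(ltr_pM2l (x := r)); last lra.
  rewrite mulrDr rr /r; nra.
- by rewrite /geodesic wE scalerA.
- by rewrite divr_gt0// divr_gt0//; lra.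
Qed.

(** The geodesic from x to y is the projection of this segment to the hyperboloid, and
the pairing with a normal is an affine function of s. *)
Definition segment (R : realType) (n : nat) (x y : 'cV[R]_n.+1) (s : R) :=
  (1 - s) *: x + s *: y.

Definition normalized (R : realType) (n : nat) (x : 'cV[R]_n.+1) :=
  (Num.sqrt (- ip x x))^-1 *: x.

Lemma segment_ip_le (R : realType) (n : nat) (x y : 'cV[R]_n.+1) (s : R) :
  Hyp x -> Hyp y -> 0 <= s <= 1 ->
  ip (segment x y s) (segment x y s) <= -1.
Proof.
move=> hx hy /andP[s0 s1]; have := Hyp_ip_le hx hy.
rewrite /segment !bilE (Hyp_ip hx) (Hyp_ip hy) (ipC y x) => xy.
have : 0 <= s * (1 - s) * (- 1 - ip x y) by rewrite !mulr_ge0//; lra.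
lra.
Qed.

Lemma segment_Hyp (R : realType) (n : nat) (x y : 'cV[R]_n.+1) (s : R) :
  Hyp x -> Hyp y -> 0 <= s <= 1 -> Hyp (normalized (segment x y s)).
Proof.
move=> hx hy s01; have le := segment_ip_le hx hy s01.
apply: (normalize_Hyp hx); first by lra.
have /andP[s0 s1] := s01; have := Hyp_ip_le hx hy.
rewrite /segment !bilE (Hyp_ip hx) (ipC y x) => xy; nra.
Qed.

Lemma normalized_ip_le0 (R : realType) (n : nat) (x v : 'cV[R]_n.+1) :
  ip x x < 0 -> (ip (normalized x) v <= 0) = (ip x v <= 0).
Proof.
move=> xx; rewrite bilZl pmulr_rle0// invr_gt0 sqrtr_gt0; lra.
Qed.

Lemma normalized_ip_eq0 (R : realType) (n : nat) (x v : 'cV[R]_n.+1) :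
  ip x x < 0 -> (ip (normalized x) v == 0) = (ip x v == 0).
Proof.
move=> xx; rewrite bilZl mulf_eq0 invr_eq0 gt_eqF// sqrtr_gt0; lra.
Qed.

Lemma normalized_id (R : realType) (n : nat) (x : 'cV[R]_n.+1) :
  Hyp x -> normalized x = x.
Proof. by move=> hx; rewrite /normalized (Hyp_ip hx) opprK sqrtr1 invr1 scale1r. Qed.

(** The Gram determinant of two points of the segment is (s - s0)^2 times that
of its end points. *)
Lemma segment_near (R : realType) (n : nat) (x y : 'cV[R]_n.+1) (s0 : R)
    (P : 'cV[R]_n.+1 -> Prop) :
  Hyp x -> Hyp y -> 0 <= s0 <= 1 ->
  (\forall z \near normalized (segment x y s0), Hyp z -> P z) ->
  exists2 e : R, 0 < e & forall s, 0 <= s <= 1 -> `|s - s0| < e ->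
    P (normalized (segment x y s)).
Proof.
move=> hx hy s01 /(Hyp_near_ball (segment_Hyp hx hy s01))[eta eta0 hP].
pose k := ip x y ^+ 2 - 1.
have k0 : 0 <= k.
  by have := Hyp_ip_le hx hy; rewrite /k subr_ge0 => ?; nra.
pose e := Num.min 1 (2 * eta / (k + 1)).
have e0 : 0 < e by rewrite lt_min ltr01 divr_gt0//; lra.
have e1 : e <= 1 by rewrite ge_min lexx.
have ek : e * (k + 1) <= 2 * eta.
  by rewrite -ler_pdivlMr; [rewrite ge_min lexx orbT | lra].
exists e => // s ss se; apply: hP; first exact: segment_Hyp.
have q0 := segment_ip_le hx hy s01; have q := segment_ip_le hx hy ss.
have hz0 := segment_Hyp hx hy s01; have hz := segment_Hyp hx hy ss.
have c1 := Hyp_ip_le hz0 hz.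
set c := ip _ _ in c1 *.
pose p0 := segment x y s0; pose p := segment x y s.
have cE : c ^+ 2 * (ip p0 p0 * ip p p) = ip p0 p ^+ 2.
  rewrite /c /normalized bilZl bilZr -/p0 -/p !exprMn.
  rewrite !exprVn !sqr_sqrtr; [|lra..].
  by field; rewrite !lt_eqF//; lra.
have gram : ip p0 p ^+ 2 - ip p0 p0 * ip p p = k * (s - s0) ^+ 2.
  rewrite /p0 /p /segment /k !bilE (Hyp_ip hx) (Hyp_ip hy) (ipC y x).
  by ring.
have pp : 1 <= ip p0 p0 * ip p p by rewrite /p0 /p; nra.
have ss1 : (s - s0) ^+ 2 < e ^+ 2.
  by rewrite -real_normK ?num_real// ltr_sqr ?nnegrE// ltW.
have ks : k * (s - s0) ^+ 2 < 2 * eta.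
  have h0 : (s - s0) ^+ 2 <= e by have : e ^+ 2 <= e; [rewrite expr2|]; nra.
  have h1 : k * (s - s0) ^+ 2 <= k * e by rewrite ler_wpM2l.
  have : k * e < e * (k + 1) by nra.
  lra.
rewrite ltNge; apply/negP => le.
have : (1 + eta) ^+ 2 <= c ^+ 2.
  by rewrite -[X in _ <= X]sqrrN ler_sqr ?nnegrE; lra.
rewrite expr2 => c2; nra.
Qed.

(** The supremum of the parameters in the cover is attained, as the cover is cut out by
closed conditions. At that point the cover is not a neighbourhood, and the end point
is beyond the tangent half-space: otherwise the segment would stay in the cover a
little longer. *)
Lemma cover_exit (R : realType) (n : nat) (M : hyp_manifold R n)
    (x y : 'cV[R]_n.+1) :
  Defs.cover M x -> Hyp y -> ~ Defs.cover M y ->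
  exists s u, [/\ 0 <= s < 1, Defs.cover M (normalized (segment x y s)),
    unit_normal u, hyperplane u (normalized (segment x y s)) & 0 < ip y u /\
    \forall z \near normalized (segment x y s),
      Hyp z -> (Defs.cover M z <-> half_space u z)].
Proof.
move=> Cx hy nCy; have hx := cover_Hyp Cx.
have [V CE] := cover_half_spaces M.
have lin v s : ip (segment x y s) v = ip x v + s * (ip y v - ip x v).
  by rewrite /segment !bilE; ring.
have CP s : 0 <= s <= 1 -> Defs.cover M (normalized (segment x y s)) <->
    forall v, V v -> ip (segment x y s) v <= 0.
  move=> s01; have q := segment_ip_le hx hy s01.
  rewrite CE; split => [[_ h] v /h[_]|h]; first by rewrite normalized_ip_le0//; lra.
  split; first exact: segment_Hyp.
  move=> v /h le; split; first exact: segment_Hyp.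
  by rewrite normalized_ip_le0//; lra.
pose T := [set s : R | 0 <= s <= 1 /\ Defs.cover M (normalized (segment x y s))].
have seg0 : segment x y 0 = x by rewrite /segment subr0 scale1r scale0r addr0.
have seg1 : segment x y 1 = y by rewrite /segment subrr scale1r scale0r add0r.
have T0 : T 0 by split; rewrite ?lexx ?ler01// seg0 normalized_id.
have hasT : has_sup T.
  by split; [exists 0 | exists 1 => s [/andP[]]].
pose s0 := sup T.
have s00 : 0 <= s0 by apply: ub_le_sup => //; case: hasT.
have s01 : s0 <= 1 by apply: ge_sup; [exists 0 | move=> s [/andP[]]].
have s0in : 0 <= s0 <= 1 by rewrite s00.
have Tle s : T s -> s <= s0 by move=> Ts; apply: ub_le_sup => //; case: hasT.
have C0 : Defs.cover M (normalized (segment x y s0)).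
  apply/CP => // v Vv; rewrite leNgt; apply/negP; rewrite lin => pos.
  have x0 : ip x v <= 0.
    by have /CP h := T0.2; have := h _ _ Vv; rewrite seg0 lexx ler01; apply.
  set D := ip y v - ip x v in pos *.
  have D0 : 0 < D by nra.
  have lt : - ip x v / D < s0 by rewrite ltr_pdivrMr//; lra.
  have : s0 <= - ip x v / D.
    apply: ge_sup; first by exists 0.
    move=> s [ss /CP h]; rewrite ler_pdivlMr//.
    by have := h ss v Vv; rewrite lin -/D; lra.
  by rewrite leNgt lt.
have s0lt : s0 < 1.
  rewrite lt_neqAle s01 andbT; apply/eqP => s0E; apply: nCy.
  by move: C0; rewrite s0E seg1 normalized_id.
have after (P : 'cV[R]_n.+1 -> Prop) :
    (\forall z \near normalized (segment x y s0), Hyp z -> P z) ->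
    exists2 s, s0 < s <= 1 & P (normalized (segment x y s)).
  move=> /(segment_near hx hy s0in)[e e0 h].
  pose s := Num.min 1 (s0 + e / 2).
  have ss0 : s0 < s by rewrite lt_min s0lt; lra.
  have s1 : s <= 1 by rewrite ge_min lexx.
  have se : s <= s0 + e / 2 by rewrite ge_min lexx orbT.
  exists s; first by rewrite ss0.
  apply: h; first by rewrite s1 andbT; lra.
  by rewrite ltr_norml; apply/andP; split; lra.
have [/after[s /andP[lt s1] Cs]|[u [uu zu nu]]] := cover_local C0.
  suff : T s by move=> /Tle; lra.
  by split => //; rewrite s1 andbT; lra.
exists s0, u; split => //; first by rewrite s00.
split => //; rewrite ltNge; apply/negP => yu.
have [s /andP[lt s1] Cs] := after _ nu.
suff : T s by move=> /Tle; lra.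
have ss : 0 <= s <= 1 by rewrite s1 andbT; lra.
split => //; apply/Cs; split; first exact: segment_Hyp.
have q := segment_ip_le hx hy ss; have q0 := segment_ip_le hx hy s0in.
rewrite [bil _ _ _ <= _]normalized_ip_le0; last lra.
have := zu.2; rewrite lin => /eqP; rewrite normalized_ip_eq0; last lra.
by rewrite lin => /eqP e; nra.
Qed.

(** Otherwise a combination of the two normals gives a direction from z that stays in
one half-space and leaves the other. *)
Lemma local_normal_uniq (R : realType) (n : nat) (C : set 'cV[R]_n.+1)
    (z u u' : 'cV[R]_n.+1) :
  unit_normal u -> unit_normal u' -> hyperplane u z -> hyperplane u' z ->
  C `<=` half_space u ->
  (\forall y \near z, Hyp y -> (C y <-> half_space u' y)) -> u' = u.
Proof.
rewrite /unit_normal /qf => uu u'u' [hz zu] [_ zu'] Cu nu.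
have contra e : ip z e = 0 -> 0 < ip e e -> ip e u' <= 0 -> 0 < ip e u -> False.
  move=> ze ee eu' eu; have [y [c [d [hy Cy yE d0]]]] := nudge hz ze ee nu.
  have : C y.
    apply/Cy; split => //.
    by rewrite -/(bil _ _ _) yE bilDl !bilZl zu' mulr0 add0r pmulr_rle0.
  move=> /Cu[_]; rewrite yE bilDl !bilZl zu mulr0 add0r.
  by rewrite pmulr_rle0// leNgt eu.
have z0 : ip z z < 0 by rewrite (Hyp_ip hz); lra.
set c := ip u u'.
have orth (w : 'cV[R]_n.+1) : ip w z = 0 -> ip w w <= 0 -> w = 0.
  move=> wz ww; apply/eqP; apply: contraTT isT => w0.
  by have := orth_timelike_gt0 z0 wz w0; rewrite ltNge ww.
have [c1|c1] := ltP c 1; last first.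
  apply/eqP; rewrite -subr_eq0; apply/eqP; apply: orth.
    by rewrite !bilE (ipC u' z) (ipC u z) zu zu'; ring.
  by rewrite !bilE uu u'u' (ipC u' u) -/c; lra.
have [c1'|c1'] := ltP (-1) c.
  exfalso; apply: (contra (u - c *: u')).
  - by rewrite !bilE zu zu'; ring.
  - by rewrite !bilE uu u'u' (ipC u' u) -/c; nra.
  - by rewrite !bilE u'u' -/c; lra.
  - by rewrite !bilE uu (ipC u' u) -/c; nra.
have uN : u = - u'.
  apply/eqP; rewrite -addr_eq0; apply/eqP; apply: orth.
    by rewrite !bilE (ipC u' z) (ipC u z) zu zu'; ring.
  by rewrite !bilE uu u'u' (ipC u' u) -/c; lra.
exfalso; apply: (contra u).
- exact: zu.
- by rewrite uu; lra.
- by rewrite -/c; lra.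
- by rewrite uu; lra.
Qed.

(** By convexity, a point of the cover beyond the hyperplane would bring points of the
cover beyond the hyperplane arbitrarily close to x. *)
Lemma local_half_space_sub (R : realType) (n : nat) (M : hyp_manifold R n)
    (x u : 'cV[R]_n.+1) :
  Defs.cover M x -> hyperplane u x ->
  (\forall y \near x, Hyp y -> (Defs.cover M y <-> half_space u y)) ->
  Defs.cover M `<=` half_space u.
Proof.
move=> Cx [hx xu] nu y Cy; have hy := cover_Hyp Cy; split => //.
rewrite -/(bil _ _ _) leNgt; apply/negP => yu.
have [V CE] := cover_half_spaces M.
have in01 : 0 <= (0 : R) <= 1 by rewrite lexx/=; exact: ler01.
have seg0 : segment x y 0 = x by rewrite /segment subr0 scale1r scale0r addr0.
have [|e e0 h] := segment_near (s0 := 0) (P := fun z =>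
   Defs.cover M z <-> half_space u z) hx hy in01.
  by rewrite seg0 normalized_id.
pose s := Num.min 1 (e / 2).
have s0 : 0 < s by rewrite lt_min ltr01; lra.
have s1 : s <= 1 by rewrite ge_min lexx.
have se : s <= e / 2 by rewrite ge_min lexx orbT.
have ss : 0 <= s <= 1 by rewrite s1 ltW.
have q := segment_ip_le hx hy ss.
have := h s ss; rewrite subr0 ger0_norm ?(ltW s0)// => /(_ ltac:(lra))[h1 _].
have [_] : half_space u (normalized (segment x y s)).
  apply: h1; rewrite CE; split; first exact: segment_Hyp.
  move=> v Vv; split; first exact: segment_Hyp.
  rewrite -/(bil _ _ _) normalized_ip_le0; last lra.
  move: Cx Cy; rewrite CE => -[_ /(_ _ Vv)[_ xv]] [_ /(_ _ Vv)[_ yv]].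
  rewrite /segment bilDl !bilZl; rewrite -/(bil _ _ _) in xv yv.
  nra.
rewrite -/(bil _ _ _) normalized_ip_le0; last lra.
by rewrite /segment bilDl !bilZl xu; nra.
Qed.

(** A segment starting at x inside the hyperplane cannot leave the cover: at the exit
point the normal would again be u. *)
Lemma local_half_space_face (R : realType) (n : nat) (M : hyp_manifold R n)
    (x u : 'cV[R]_n.+1) :
  Defs.cover M x -> unit_normal u -> hyperplane u x ->
  (\forall y \near x, Hyp y -> (Defs.cover M y <-> half_space u y)) ->
  boundary_normal (Defs.cover M) u.
Proof.
move=> Cx uu xu nu; have Cu := local_half_space_sub Cx xu nu.
split => // y [hy yu]; apply: contrapT => nCy.
have [s [u' [/andP[s0 s1] Cz u'u' zu' [yu' nu']]]] := cover_exit Cx hy nCy.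
have ss : 0 <= s <= 1 by rewrite s0 ltW.
have q := segment_ip_le xu.1 hy ss.
have zu : hyperplane u (normalized (segment x y s)).
  split; first exact: segment_Hyp xu.1 hy ss.
  apply/eqP; rewrite normalized_ip_eq0; last lra.
  by rewrite /segment bilDl !bilZl yu xu.2; apply/eqP; ring.
by move: yu'; rewrite (local_normal_uniq uu u'u' zu zu' Cu nu') yu ltxx.
Qed.

(** A segment from a point of the cover to y could only leave the cover through a face. *)
Lemma cover_eq_half_spaces (R : realType) (n : nat) (M : hyp_manifold R n) y :
  Hyp y -> (forall v, boundary_normal (Defs.cover M) v -> ip y v <= 0) ->
  Defs.cover M y.
Proof.
move=> hy h; apply: contrapT => nCy; have [x Cx] := cover_neq0 M.
have [s [u [_ Cz uu zu [yu nu]]]] := cover_exit Cx hy nCy.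
by have := h _ (local_half_space_face Cz uu zu nu); rewrite leNgt yu.
Qed.

(** * Boundary normals *)

(** z - v is a future null or timelike vector. *)
Lemma ip_normal_ge (R : realType) (n : nat) (x z v : 'cV[R]_n.+1) :
  Hyp x -> Hyp z -> ip v v = 1 -> 0 <= ip z v -> ip x z <= ip x v.
Proof.
move=> hx hz vv zv; pose w := z - v.
have ww : ip w w <= 0 by rewrite !bilE (Hyp_ip hz) vv (ipC v z); lra.
have zw : ip z w < 0 by rewrite !bilE (Hyp_ip hz); lra.
have w0 : w != 0 by apply: contraTneq zw => ->; rewrite bil0r ltxx.
have := nonspacelike_same_sign hx hz w0 ww.
rewrite nmulr_lgt0// => lt; have : ip x w < 0 by [].
by rewrite !bilE; lra.
Qed.

Lemma cover_deep (R : realType) (n : nat) (M : hyp_manifold R n) x :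
  Hyp x -> (forall v, boundary_normal (Defs.cover M) v -> ip x v < -2) ->
  deep 1%:M (Defs.cover M) x.
Proof.
move=> hx h; split => //; first by exists x; rewrite mul1mx.
move=> z hz _ xz; apply: cover_eq_half_spaces => // v bv.
rewrite leNgt; apply/negP => zv; have [vv _ _] := bv.
by have := ip_normal_ge hx hz vv (ltW zv); have := h v bv; lra.
Qed.

Lemma Hyp_neq_empty (R : realType) (n : nat) : exists o : 'cV[R]_n.+1, Hyp o.
Proof.
exists (delta_mx ord_max ord0); split; last by rewrite mxE !eqxx ltr01.
by rewrite /qf bil_delta !mxE !eqxx mulr1n.
Qed.

Lemma hyperplane_neq0 (R : realType) (n : nat) (v : 'cV[R]_n.+1) :
  ip v v = 1 -> exists a, hyperplane v a.
Proof.
move=> vv; have [b hb] := Hyp_neq_empty R n.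
pose y := b - ip b v *: v.
have yv : ip y v = 0 by rewrite !bilE vv; ring.
have sq := sqr_ge0 (ip b v); rewrite expr2 in sq.
have yy : ip y y < 0 by rewrite !bilE (Hyp_ip hb) vv (ipC v b); lra.
have yo : ip y b < 0 by rewrite !bilE (Hyp_ip hb) (ipC v b); lra.
exists (normalized y); split; first exact: normalize_Hyp yy yo.
by apply/eqP; rewrite -/(bil _ _ _) normalized_ip_eq0// yv.
Qed.

(** Otherwise the cover would be contained in a hyperplane, whereas near any of its
points it contains at least half of a neighbourhood. *)
Lemma boundary_normal_noopp (R : realType) (n : nat) (M : hyp_manifold R n) v :
  boundary_normal (Defs.cover M) v -> ~ boundary_normal (Defs.cover M) (- v).
Proof.
move=> [uv Pv Cv] [uv' Pv' Cv']; have [a [ha av]] := hyperplane_neq0 uv.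
have Ca : Defs.cover M a by apply: Pv.
have av' : hyperplane (- v) a by split => //; rewrite bilNr av oppr0.
have [nu|[u [uu au nu]]] := cover_local Ca.
  have vv : ip v v = 1 by exact: uv.
  have vv0 : 0 < ip v v by rewrite vv.
  have [y [c [d [_ Cy yE d0]]]] := nudge ha av vv0 nu.
  have [_] := Cv _ Cy; rewrite yE bilDl !bilZl av vv; lra.
have uv1 := local_normal_uniq uv uu (conj ha av) au Cv nu.
have uv2 := local_normal_uniq uv' uu av' au Cv' nu.
have : v = - v by rewrite -uv2 uv1.
move=> /(congr1 (fun w => ip v w)); rewrite bilNr.
by move: uv; rewrite /unit_normal /qf => ->; lra.
Qed.

(** If the plane spanned by the normals were positive definite, the hyperplanes would
cross, and one would contain points beyond the other. If the normals pointed the same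
way, one half-space would contain the other, with one hyperplane beyond the other. *)
Lemma boundary_normal_sep (R : realType) (n : nat) (M : hyp_manifold R n) v v' :
  boundary_normal (Defs.cover M) v -> boundary_normal (Defs.cover M) v' ->
  v != v' -> ip v v' <= -1.
Proof.
move=> [uv Pv Cv] [uv' Pv' Cv'] vv'.
have vv : ip v v = 1 by exact: uv.
have v'v' : ip v' v' = 1 by exact: uv'.
have inv' y : hyperplane v y -> ip y v' <= 0 by move=> /Pv/Cv'[].
have inv y : hyperplane v' y -> ip y v <= 0 by move=> /Pv'/Cv[].
have [a [ha av]] := hyperplane_neq0 vv.
have [a' [ha' av']] := hyperplane_neq0 v'v'.
pose c := ip v v'.
have [u [uE uv0]] : exists u, v' = u + c *: v /\ ip u v = 0.
  exists (v' - c *: v); rewrite subrK; split => //.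
  by rewrite !bilE vv (ipC v' v) /c; ring.
have uu : ip u u = 1 - c ^+ 2.
  have : ip v' v' = ip u u + c ^+ 2 by rewrite uE !bilE uv0 vv (ipC v u) uv0; ring.
  by rewrite v'v'; lra.
have uu0 : ip u u <= 0.
  rewrite leNgt; apply/negP => pos.
  pose k := Num.sqrt (ip u u).
  have k0 : 0 < k by rewrite sqrtr_gt0.
  have k2 : k ^+ 2 = ip u u by rewrite sqr_sqrtr// ltW.
  have ww : ip (k^-1 *: u) (k^-1 *: u) = 1.
    by rewrite !bilE -k2; field; rewrite gt_eqF.
  have [||z [hz _ zw [p [q zE]]]] :=
    move_across (s := `|ip a (k^-1 *: u)| + 1) ha ww.
    by rewrite ltr_wpDl.
    by have := ler_norm (- ip a (k^-1 *: u)); rewrite normrN; lra.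
  have zv : ip z v = 0 by rewrite zE !bilE av uv0; ring.
  have := inv' z (conj hz zv); rewrite uE bilDr !bilZr zv mulr0 addr0 leNgt.
  by move: zw; rewrite bilZr pmulr_rgt0 ?invr_gt0// => ->.
have c2 : 1 <= c ^+ 2 by lra.
have [c0|c0] := ltP 0 c; last by rewrite -/c; nra.
pose w := v - v'.
have ww : ip w w <= 0 by rewrite !bilE vv v'v' (ipC v' v) -/c; nra.
have w0 : w != 0 by rewrite subr_eq0.
have := nonspacelike_same_sign ha ha' w0 ww.
rewrite !bilE av av'; have := inv' _ (conj ha av); have := inv _ (conj ha' av').
by move=> h1 h2; nra.
Qed.

Lemma boundary_normal_meet (R : realType) (n : nat) (M : hyp_manifold R n) v v' x :
  boundary_normal (Defs.cover M) v -> boundary_normal (Defs.cover M) v' ->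
  hyperplane v x -> hyperplane v' x -> v = v'.
Proof.
move=> bv bv' [hx xv] [_ xv']; apply/eqP; apply: contraT => vv'.
have sep := boundary_normal_sep bv bv' vv'.
have [uv _ _] := bv; have [uv' _ _] := bv'.
have vv : ip v v = 1 by exact: uv.
have v'v' : ip v' v' = 1 by exact: uv'.
exfalso; apply: (boundary_normal_noopp bv); suff <- : v' = - v by [].
apply/eqP; rewrite -addr_eq0; apply/eqP; apply/eqP; apply: contraTT isT => w0.
have := orth_timelike_gt0 (x := v' + v) (z := x).
rewrite (Hyp_ip hx) => /(_ (ltrN10 _)).
rewrite ipC bilDr xv xv' addr0 => /(_ erefl w0).
by rewrite !bilE vv v'v' (ipC v' v); lra.
Qed.

Lemma boundary_normal_act (R : realType) (n : nat) (M : hyp_manifold R n) g v :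
  grp M g -> boundary_normal (Defs.cover M) v ->
  boundary_normal (Defs.cover M) (g *m v).
Proof.
move=> gg [uv Pv Cv]; have ig := grp_isom gg.
have gV := grpV gg; have iV := grp_isom gV; have ug := grp_unit gg.
split.
- by rewrite /unit_normal /qf isom_ip.
- move=> y [hy yv]; rewrite -(mulKVmx ug y); apply: grp_cover => //; apply: Pv.
  split; first exact: isom_Hyp.
  by rewrite -(isom_ip _ _ ig) mulKVmx.
- move=> y Cy; have hy := cover_Hyp Cy; split => //.
  have [_] := Cv _ (grp_cover gV Cy).
  by rewrite -(isom_ip _ _ ig) mulKVmx.
Qed.

Lemma hyperplane_stab_subgroup (R : realType) (n : nat) (M : hyp_manifold R n)
    (P : set 'cV[R]_n.+1) : subgroup M (setwise_stab (grp M) P).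
Proof.
split.
- by move=> g [].
- split; first exact: grp1.
  by apply/seteqP; split => [_ [x Px <-]|x Px]; [rewrite mul1mx | exists x; rewrite ?mul1mx].
- move=> g h [gg gP] [gh hP]; split; first exact: grpM.
  rewrite -[RHS]gP -[in RHS]hP.
  apply/seteqP; split => [_ [x Px <-]|_ [_ [x Px <-] <-]].
    by exists (h *m x); [exists x | rewrite mulmxA].
  by exists x; rewrite ?mulmxA.
- move=> g [gg gP]; split; first exact: grpV.
  rewrite -[in LHS]gP; have ug := grp_unit gg.
  apply/seteqP; split => [_ [_ [x Px <-] <-]|x Px]; first by rewrite mulKmx.
  by exists (g *m x); [exists x | rewrite mulKmx].
Qed.

(** The image of the normal is a normal of the same hyperplane. *)
Lemma stab_normal (R : realType) (n : nat) (M : hyp_manifold R n) g v :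
  boundary_normal (Defs.cover M) v -> setwise_stab (grp M) (hyperplane v) g ->
  g *m v = v.
Proof.
move=> bv [gg gP]; have [uv _ _] := bv; have ig := grp_isom gg.
have [a Pa] := hyperplane_neq0 uv.
have ga : hyperplane v (g *m a) by rewrite -gP; exists a.
apply: (boundary_normal_meet (M := M) (x := g *m a)) => //.
  exact: boundary_normal_act.
by case: Pa => ha av; split; [exact: isom_Hyp | rewrite isom_ip].
Qed.

(** * Subspaces of Lorentz space *)

Definition subspace (R : realType) (N : nat) (S : set 'cV[R]_N) : Prop :=
  S 0 /\ forall a x y, S x -> S y -> S (a *: x + y).

Lemma inj_rank (R : realType) (N r : nat) (B : 'M[R]_(N, r)) :
  (forall c : 'cV[R]_r, B *m c = 0 -> c = 0) -> \rank B = r.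
Proof.
move=> inj; rewrite -mxrank_tr; apply/eqP; rewrite -/(row_free _) -kermx_eq0.
apply/rowV0P => v /sub_kermxP vB; apply: trmx_inj; rewrite trmx0; apply: inj.
by apply: trmx_inj; rewrite trmx_mul trmxK vB trmx0.
Qed.

(** A family of maximal rank with columns in S. *)
Lemma subspace_basis (R : realType) (N : nat) (S : set 'cV[R]_N) :
  subspace S -> exists r (B : 'M[R]_(N, r)),
    (forall c : 'cV[R]_r, B *m c = 0 -> c = 0) /\ forall x, S x <-> in_span B x.
Proof.
move=> [S0 Sl].
pose P r := `[< exists B : 'M[R]_(N, r),
  (forall c : 'cV[R]_r, B *m c = 0 -> c = 0) /\ forall c : 'cV[R]_r, S (B *m c) >].
have P0 : exists r, P r.
  exists 0%N; apply/asboolP; exists 0; split; last by move=> c; rewrite mul0mx.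
  by move=> c _; rewrite [c]flatmx0.
have Ple r : P r -> (r <= N)%N.
  by move=> /asboolP[B [inj _]]; rewrite -(inj_rank inj) rank_leq_row.
have [r /asboolP[B [inj SB]] max] := ex_maxnP P0 Ple.
exists r, B; split => // x; split => [Sx|[c ->]]; last exact: SB.
apply: contrapT => nx; suff /max : P (r + 1)%N by rewrite addn1 ltnn.
apply/asboolP; exists (row_mx B x); split => c.
  rewrite -[c]vsubmxK mul_row_col; set u := usubmx c; set d := dsubmx c.
  rewrite [d]mx11_scalar mul_mx_scalar; set t := d ord0 ord0.
  have [->|t0] := eqVneq t 0.
    by rewrite scale0r addr0 => /inj ->; rewrite raddf0 col_mx0.
  move=> e; exfalso; apply: nx; exists (- t^-1 *: u).
  rewrite -scalemxAr; have -> : B *m u = - (t *: x) by apply/eqP; rewrite -addr_eq0 e.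
  by rewrite scalerN scaleNr opprK scalerA mulVf// scale1r.
rewrite -[c]vsubmxK mul_row_col addrC [dsubmx c]mx11_scalar mul_mx_scalar.
exact: Sl.
Qed.

Definition posdef (R : realType) (n : nat) (S : set 'cV[R]_n.+1) : Prop :=
  forall s, S s -> s != 0 -> 0 < ip s s.

(** The Gram matrix of a basis of S is invertible. *)
Lemma orth_projection (R : realType) (n : nat) (S : set 'cV[R]_n.+1) x :
  subspace S -> posdef S -> exists2 b, S b & forall s, S s -> ip (x - b) s = 0.
Proof.
move=> sS pS; have [r [B [inj SB]]] := subspace_basis sS.
pose G := B^T *m lorentz R n *m B.
have ipB c c' : ip (B *m c) (B *m c') = bil G c c'.
  by rewrite /bil trmx_mul /G !mulmxA.
have uG : G \in unitmx.
  apply: unitmx_ker0 => c Gc; apply: inj; apply/eqP; apply: contraTT isT => Bc.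
  have := pS (B *m c) (proj2 (SB _) (ex_intro _ c erefl)) Bc.
  by rewrite ipB /bil -mulmxA Gc mulmx0 mxE ltxx.
pose c := invmx G *m (B^T *m lorentz R n *m x).
exists (B *m c); first by apply/SB; exists c.
move=> s /SB[c' ->]; rewrite ipC bilDr bilNr ipB.
have -> : bil G c' c = (c'^T *m (G *m c)) ord0 ord0 by rewrite /bil mulmxA.
by rewrite mulKVmx// /bil trmx_mul !mulmxA subrr.
Qed.

(** The point a is the projection of a0 to the orthogonal complement of S, normalized.
The last bound is the Cauchy-Schwarz inequality in S. *)
Lemma posdef_axis (R : realType) (n : nat) (M : hyp_manifold R n)
    (G : set 'M[R]_n.+1) (S : set 'cV[R]_n.+1) w0 a0 :
  subgroup M G -> subspace S -> posdef S -> (forall g s, G g -> S s -> S (g *m s)) ->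
  S w0 -> w0 != 0 -> Hyp a0 ->
  exists a w b k, [/\ Hyp a, S w /\ ip w w = 1, S b, 0 < k /\ a = k *: (a0 - b) &
    (forall s, S s -> ip a s = 0) /\
    (forall g, G g -> ip (g *m a) w = 0) /\ (forall g, G g -> ip w (g *m w) <= 1)].
Proof.
move=> [GM G1 GMul GV] sS pS GS Sw w00 ha0.
have [b Sb bo] := orth_projection a0 sS pS.
have Z c s : S s -> S (c *: s) by case: sS => S0 Sl Ss; rewrite -[_ *: _]addr0; exact: Sl.
have a0b : ip a0 b = ip b b.
  by have := bo b Sb; rewrite bilDl bilNl; lra.
have bb : 0 <= ip b b.
  by have [->|/pS h] := eqVneq b 0; [rewrite bil0l | exact/ltW/h].
pose y := a0 - b.
have yy : ip y y < 0.
  by rewrite !bilE (Hyp_ip ha0) (ipC b a0) a0b; lra.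
have ya : ip y a0 < 0 by rewrite !bilE (Hyp_ip ha0) (ipC b a0) a0b; lra.
have ww0 := pS _ Sw w00.
pose k := Num.sqrt (ip w0 w0).
have k0 : 0 < k by rewrite sqrtr_gt0.
have k2 : k ^+ 2 = ip w0 w0 by rewrite sqr_sqrtr// ltW.
have [w [wE Sw' ww]] : exists w, [/\ w = k^-1 *: w0, S w & ip w w = 1].
  exists (k^-1 *: w0); split => //; first exact: Z.
  by rewrite !bilE -k2; field; rewrite gt_eqF.
pose l := (Num.sqrt (- ip y y))^-1.
have l0 : 0 < l by rewrite invr_gt0 sqrtr_gt0; lra.
have ao s : S s -> ip (normalized y) s = 0.
  by move=> Ss; rewrite bilZl (bo s Ss) mulr0.
exists (normalized y), w, b, l; split => //; first exact: normalize_Hyp yy ya.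
split => //; split => g Gg.
  by rewrite (isom_ip_inv _ _ (grp_isom (GM _ Gg))) ao//; apply/GS => //; exact: GV.
have ig := grp_isom (GM _ Gg).
have Sd : S (w - g *m w).
  by rewrite addrC -scaleN1r; apply: sS.2 => //; exact: GS.
have : 0 <= ip (w - g *m w) (w - g *m w).
  by have [->|/(pS _ Sd)/ltW//] := eqVneq (w - g *m w) 0; rewrite bil0l.
by rewrite !bilE isom_ip// ww (ipC (g *m w) w); lra.
Qed.

Lemma exists_orth2 (R : realType) (n : nat) (u v : 'cV[R]_n.+3) :
  exists2 y : 'cV[R]_n.+3, y != 0 & ip y u = 0 /\ ip y v = 0.
Proof.
pose J := lorentz R n.+2; pose A := row_mx (J *m u) (J *m v).
have : kermx A != 0.
  rewrite kermx_eq0 /row_free; apply/negP => /eqP rA.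
  by have := rank_leq_col A; rewrite rA addn1.
move=> /rowV0Pn[y /sub_kermxP yA y0]; exists y^T.
  by apply: contra_neq y0 => y0; apply: trmx_inj; rewrite y0 trmx0.
have yu : y *m (J *m u) = 0.
  by have := congr1 lsubmx yA; rewrite mul_mx_row row_mxKl linear0.
have yv : y *m (J *m v) = 0.
  by have := congr1 rsubmx yA; rewrite mul_mx_row row_mxKr linear0.
by rewrite /bil trmxK -!mulmxA -/J yu yv !mxE.
Qed.

(** The combination of y and z orthogonal to a timelike vector is not spacelike, hence
zero. *)
Lemma nonspacelike_orth (R : realType) (n : nat) (y z : 'cV[R]_n.+1) :
  y != 0 -> z != 0 -> ip y y <= 0 -> ip z z <= 0 -> ip y z = 0 ->
  exists2 t, z = t *: y & ip y y = 0.
Proof.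
move=> y0 z0 yy zz yz; have [a ha] := Hyp_neq_empty R n.
have ay := nonspacelike_ip_neq0 ha y0 yy.
pose t := ip a z / ip a y.
have t0 : t != 0 by rewrite mulf_neq0 ?invr_eq0// nonspacelike_ip_neq0.
have [u uE] : exists u, u = z - t *: y by exists (z - t *: y).
have ua : ip u a = 0 by rewrite ipC uE !bilE /t; field.
have uu : ip u u <= 0.
  by rewrite uE !bilE (ipC z y) yz; have := sqr_ge0 t; rewrite expr2; nra.
have u0 : u = 0.
  apply/eqP; apply: contraTT isT => u0.
  by have := orth_timelike_gt0 _ ua u0; rewrite (Hyp_ip ha) => /(_ (ltrN10 _)); lra.
have zE : z = t *: y by apply/eqP; rewrite -subr_eq0 -uE u0.
exists t => //; move: yz; rewrite zE bilZr => /eqP.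
by rewrite mulf_eq0 (negPf t0) => /eqP.
Qed.

(** * Stabilizers of boundary hyperplanes *)

Lemma stab_span (R : realType) (n : nat) (M : hyp_manifold R n) v
    (L : 'M[R]_(n.+1, n)) :
  boundary_normal (Defs.cover M) v -> \rank L = n ->
  v^T *m lorentz R n *m L = 0 ->
  (forall y, in_span L y <-> ip y v = 0) /\
  (forall g y, setwise_stab (grp M) (hyperplane v) g -> in_span L y ->
     in_span L (g *m y)).
Proof.
move=> bv rL vL; have [uv _ _] := bv.
have v0 : v != 0.
  by apply: contra_eq_neq uv => ->; rewrite /qf bil0l eq_sym oner_neq0.
have LP y : in_span L y <-> ip y v = 0 by exact: in_span_orth.
split => // g y Gg /LP yv; apply/LP; rewrite -(stab_normal bv Gg) isom_ip//.
exact: grp_isom Gg.1.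
Qed.

Lemma normalize_span (R : realType) (n : nat) (y a : 'cV[R]_n.+1) :
  Hyp a -> ip y y < 0 -> exists z c, [/\ Hyp z, z = c *: y & c != 0].
Proof.
move=> ha yy; have y0 : y != 0 by apply: contraTneq yy => ->; rewrite bil0l ltxx.
have ya := nonspacelike_ip_neq0 ha y0 (ltW yy); rewrite ipC in ya.
have s0 : (Num.sqrt (- ip y y))^-1 != 0.
  by rewrite invr_eq0 gt_eqF// sqrtr_gt0; lra.
have [lt|gt] := ltP (ip y a) 0.
  by exists (normalized y), (Num.sqrt (- ip y y))^-1; split => //; exact: normalize_Hyp yy lt.
exists (normalized (- y)), (- (Num.sqrt (- ip y y))^-1); split.
- apply: (normalize_Hyp ha); rewrite ?bilNl ?bilNr ?opprK//.
  by rewrite oppr_lt0 lt_neqAle eq_sym ya.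
- by rewrite /normalized bilNl bilNr opprK scaleNr scalerN.
- by rewrite oppr_eq0.
Qed.

(** A boundary component has no invariant null vector, as the complements of the
horoballs centred there would have infinite volume. *)
Lemma stab_no_null (R : realType) (n : nat) (M : hyp_manifold R n.+1) v w :
  boundary_normal (Defs.cover M) v -> ip w v = 0 -> ip w w = 0 -> w != 0 ->
  (forall g, setwise_stab (grp M) (hyperplane v) g -> g *m w = w) -> False.
Proof.
move=> bv wv ww w0 gw; have [uv _ _] := bv.
have [L [rL vL fin]] := boundary_finite_covolume bv.
have [LP LG] := stab_span bv rL vL.
have [a [ha av]] := hyperplane_neq0 uv.
apply: (no_invariant_null rL (hyperplane_stab_subgroup M _) LG fin ha _ _ ww w0 gw).
- exact/LP.
- exact/LP.
- by move=> x hx /LP xv.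
Qed.

(** A ball of the hyperplane around any of its points lies in the hyperplane, so every
geodesic inside a boundary component runs through centres of balls of fixed radius. *)
Lemma stab_no_geodesic (R : realType) (n : nat) (M : hyp_manifold R n.+1) v a w :
  boundary_normal (Defs.cover M) v -> Hyp a -> ip a v = 0 -> ip w v = 0 ->
  ip w w = 1 ->
  (forall g, setwise_stab (grp M) (hyperplane v) g -> ip (g *m a) w = 0) ->
  (forall g, setwise_stab (grp M) (hyperplane v) g -> ip w (g *m w) <= 1) -> False.
Proof.
move=> bv ha av wv ww gaw gww.
have [L [rL vL fin]] := boundary_finite_covolume bv.
have [LP LG] := stab_span bv rL vL.
have sG := hyperplane_stab_subgroup M (hyperplane v).
apply: (no_expanding_geodesic (r0 := 0) rL sG LG fin ha _ ww gaw gww).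
  exact/LP.
move=> r _ r1.
have [_ G1 _ _] := sG; have aw : ip a w = 0 by rewrite -(mul1mx a) gaw.
have hx := geodesic_Hyp ha ww aw r1.
split => //; first by apply/LP; rewrite /geodesic !bilE av wv; ring.
by move=> z hz /LP zv _.
Qed.

(** The stabilizer of a boundary hyperplane has finite covolume there, so its
squares have no common fixed vector in the hyperplane: the fixed vectors form an
invariant subspace S, and a timelike vector in S would make the group trivial, a
null one would be invariant, and otherwise S is positive definite. *)
Lemma stab_fixed (R : realType) (n : nat) (M : hyp_manifold R n.+2) v x :
  boundary_normal (Defs.cover M) v ->
  (forall g, setwise_stab (grp M) (hyperplane v) g -> g *m (g *m x) = x) ->
  exists c, x = c *: v.
Proof.
move=> bv xfix; have [uv _ _] := bv; have vv : ip v v = 1 by exact: uv.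
pose G := setwise_stab (grp M) (hyperplane v).
have sG : subgroup M G := hyperplane_stab_subgroup M _.
have [GM G1 GMul GV] := sG.
have Gv g : G g -> g *m v = v by move=> Gg; exact: stab_normal bv Gg.
have Gi g : G g -> IsomH g by move=> Gg; exact/grp_isom/GM.
have Gu g : G g -> g \in unitmx by move=> Gg; exact/isom_unit/Gi.
pose S := [set y : 'cV[R]_n.+3 | ip y v = 0 /\ forall g, G g -> g *m (g *m y) = y].
have sS : subspace S.
  split; first by split => [|g _]; rewrite ?bil0l// !mulmx0.
  move=> c y z [yv yG] [zv zG]; split; first by rewrite !bilE yv zv; ring.
  by move=> g Gg; rewrite !mulmxDr -!scalemxAr yG// zG.
have GS g s : G g -> S s -> S (g *m s).
  move=> Gg [sv sfix]; split; first by rewrite -(Gv _ Gg) isom_ip//; exact: Gi.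
  move=> h Gh; have := sfix (invmx g *m (h *m g)) (GMul _ _ (GV _ Gg) (GMul _ _ Gh Gg)).
  move=> /(congr1 (mulmx g)); rewrite -!mulmxA !mulKVmx//; exact: Gu.
have Z c s : S s -> S (c *: s).
  by move=> Ss; rewrite -[_ *: _]addr0; apply: sS.2 => //; exact: sS.1.
pose w := x - ip x v *: v.
have Sw : S w.
  split; first by rewrite !bilE vv; ring.
  by move=> g Gg; rewrite !mulmxBr -!scalemxAr !Gv// xfix.
exists (ip x v); apply/eqP; rewrite -subr_eq0; apply: contraT => w0; exfalso.
have [a0 [ha0 a0v]] := hyperplane_neq0 vv.
have [[s [Ss ss]]|nt] := pselect (exists s, S s /\ ip s s < 0).
  have [z [c [hz zE _]]] := normalize_span ha0 ss.
  have Sz : S z by rewrite zE; exact: Z.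
  have [e e0 he] := grp_moves_away M hz.
  have triv g : G g -> g = 1.
    move=> Gg; have gg : g *m g = 1.
      apply: he; first by apply: grpM; exact: GM.
      by rewrite -mulmxA Sz.2// (Hyp_ip hz); lra.
    by apply: (grp_torsion_free (GM _ Gg) (m := 2)) => //; rewrite expr2.
  have [y y0 [yz yv]] := exists_orth2 z v.
  have yy : 0 < ip y y.
    by apply: (orth_timelike_gt0 _ yz y0); rewrite (Hyp_ip hz); lra.
  pose k := Num.sqrt (ip y y).
  have k2 : k ^+ 2 = ip y y by rewrite sqr_sqrtr// ltW.
  have k0 : 0 < k by rewrite sqrtr_gt0.
  apply: (stab_no_geodesic (w := k^-1 *: y) bv hz Sz.1).
  - by rewrite bilZl yv mulr0.
  - by rewrite !bilE -k2; field; rewrite gt_eqF.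
  - by move=> g Gg; rewrite (triv _ Gg) mul1mx bilZr ipC yz mulr0.
  - move=> g Gg; rewrite (triv _ Gg) mul1mx !bilE -k2.
    by rewrite le_eqVlt; apply/orP; left; apply/eqP; field; rewrite gt_eqF.
have ge0 s : S s -> 0 <= ip s s.
  by move=> Ss; rewrite leNgt; apply/negP => lt; apply: nt; exists s.
have [[s [Ss s0 ss]]|pos] := pselect (exists s, [/\ S s, s != 0 & ip s s <= 0]).
  have ss0 : ip s s = 0 by apply/eqP; rewrite eq_le ss ge0.
  (* S has no timelike vector, so g s is a multiple of s; the factor t is positive, and
     its square is 1 *)
  apply: (stab_no_null bv Ss.1 ss0 s0) => g Gg.
  have gs0 : g *m s != 0.
    apply: contra_neq s0 => gs; have := mulKmx (Gu _ Gg) s.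
    by rewrite gs mulmx0 => <-.
  have gss : ip (g *m s) (g *m s) = 0 by rewrite isom_ip//; exact: Gi.
  have hga : Hyp (g *m a0) by apply: isom_Hyp => //; exact: Gi.
  have sgn : 0 < ip a0 s * ip a0 (g *m s).
    have := nonspacelike_same_sign ha0 hga gs0; rewrite gss isom_ip; last exact: Gi.
    by rewrite mulrC => ->.
  have as0 := nonspacelike_ip_neq0 ha0 s0 ss.
  pose t := ip a0 (g *m s) / ip a0 s.
  have t0 : 0 < t.
    have -> : t = ip a0 s * ip a0 (g *m s) / ip a0 s ^+ 2 by rewrite /t; field.
    by rewrite divr_gt0// exprn_even_gt0.
  have [y yE] : exists y, y = - t *: s + g *m s by exists (- t *: s + g *m s).
  have ya : ip y a0 = 0 by rewrite ipC yE !bilE /t; field.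
  have Ssum : S (1 *: s + g *m s) by apply: sS.2 => //; exact: GS.
  have y0 : y = 0.
    apply/eqP; apply: contraTT isT => y0.
    have := orth_timelike_gt0 _ ya y0; rewrite (Hyp_ip ha0) => /(_ (ltrN10 _)).
    have := ge0 _ Ssum; rewrite yE !bilE ss0 gss (ipC (g *m s) s).
    by set q := ip s _; nra.
  have gsE : g *m s = t *: s.
    by apply/eqP; rewrite -subr_eq0 -scaleNr addrC -yE y0.
  have := Ss.2 _ Gg; rewrite gsE -scalemxAr gsE scalerA => tts.
  have t1 : t * t = 1.
    apply/eqP; rewrite -subr_eq0; apply: contraTT isT => tt.
    have : (t * t - 1) *: s = 0 by rewrite scalerBl tts scale1r subrr.
    by move=> /eqP; rewrite scaler_eq0 (negPf tt) (negPf s0).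
  by have -> : t = 1 by [nra]; rewrite scale1r.
have pS : posdef S.
  move=> s Ss s0; rewrite ltNge; apply/negP => le; apply: pos; exists s; split => //.
have [a [w' [b [k [ha [Sw' ww'] Sb [k0 aE] [ao [gaw gww]]]]]]] :=
  posdef_axis sG sS pS GS Sw w0 ha0.
apply: (stab_no_geodesic bv ha _ Sw'.1 ww' gaw gww).
by rewrite aE !bilE a0v Sb.1; ring.
Qed.

(** * The span of the boundary normals *)

Lemma near_ip_lt (R : realType) (n : nat) (y u : 'cV[R]_n.+1) (c : R) :
  ip y u < c -> \forall z \near y, ip z u < c.
Proof.
move=> yu; have [K K0 hK] := bil_bound (lorentz R n).
pose e2 := \sum_i `|u i ord0|.
have e20 : 0 <= e2 by exact: sumr_ge0.
have ue i : `|u i ord0| <= e2 by rewrite /e2 (bigD1 i)//= lerDl; exact: sumr_ge0.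
pose e := (c - ip y u) / (K * e2 + 1).
have Ke : 0 < K * e2 + 1 by have := mulr_ge0 K0 e20; lra.
have e0 : 0 < e by rewrite divr_gt0//; lra.
apply: (cV_near e0) => z yz.
have dz i : `|(z - y) i ord0| <= e by rewrite !mxE distrC ltW.
have := hK _ _ _ _ dz ue; rewrite bilDl bilNl => le.
have : K * (e * e2) < c - ip y u.
  have -> : c - ip y u = e * (K * e2 + 1) by rewrite /e divfK// gt_eqF.
  lra.
have := ler_norm (ip z u - ip y u); lra.
Qed.

(** Since - ip a v is the hyperbolic sine of the distance from a to the face of normal v,
a ball around a in the cover gives a bound for all faces at once. *)
Lemma cover_interior (R : realType) (n : nat) (M : hyp_manifold R n) :
  exists a, Hyp a /\ exists2 k : R, 0 < k &
    forall v, boundary_normal (Defs.cover M) v -> ip a v <= - k.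
Proof.
have [a [ha na]] : exists a, Hyp a /\ \forall z \near a, Hyp z -> Defs.cover M z.
  have [x Cx] := cover_neq0 M; have hx := cover_Hyp Cx.
  have [nx|[u [uu xu nu]]] := cover_local Cx; first by exists x.
  have [||y [c [d [hy Py yE d0]]]] := nudge (e := - u) hx _ _
      (filterS (fun z h (_ : Hyp z) => h) (nbhs_interior nu)).
  - by rewrite bilNr xu.2 oppr0.
  - by rewrite bilNl bilNr opprK [ip u u]uu ltr01.
  exists y; split => //.
  have yu : ip y u < 0.
    by rewrite yE bilDl !bilZl bilNl xu.2 [ip u u]uu; lra.
  have := near_ip_lt yu; have : \forall z \near y, Hyp z ->
    (Defs.cover M z <-> half_space u z) by exact: Py.
  apply: filterS2 => z h zu hz; apply/h => //; split => //; exact: ltW.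
exists a; split => //; have [e e0 he] := Hyp_near_ball ha na.
pose s := Num.min 1 e; have s0 : 0 < s by rewrite lt_min ltr01.
have se : s <= e by rewrite ge_min lexx orbT.
exists s => // v [vv _ Cv]; rewrite leNgt; apply/negP => lt.
have [//||z [hz az zv _]] := move_across (s := s) ha vv; first by lra.
have Cz : Defs.cover M z.
  apply: he => //; rewrite az; apply: (@lt_le_trans _ _ (1 + s)); last by lra.
  rewrite -ltr_sqr ?nnegrE ?sqrtr_ge0//; last by lra.
  by rewrite sqr_sqrtr; have := sqr_ge0 s; rewrite ?expr2; nra.
by have [_] := Cv _ Cz; rewrite leNgt zv.
Qed.

(** With a single face the cover would be a half-space, and the geodesic orthogonal to
the face would escape into it. *)
Lemma second_boundary_normal (R : realType) (n : nat) (M : hyp_manifold R n) v :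
  boundary_normal (Defs.cover M) v ->
  exists2 v', boundary_normal (Defs.cover M) v' & v != v'.
Proof.
move=> bv; apply: contrapT => no; have [uv _ _] := bv.
have vv : ip v v = 1 by exact: uv.
have only v' : boundary_normal (Defs.cover M) v' -> v' = v.
  move=> bv'; apply/eqP; rewrite eq_sym; apply: contra_notT no => ne; by exists v'.
have sG : subgroup M (grp M).
  by split => //; [exact: grp1 | exact: grpM | exact: grpV].
have gv g : grp M g -> g *m v = v by move=> gg; apply/only/boundary_normal_act.
have [a [ha av]] := hyperplane_neq0 vv.
have span1 y : in_span (1%:M : 'M[R]_n.+1) y by exists y; rewrite mul1mx.
apply: (no_expanding_geodesic (L := 1%:M) (w := - v) (r0 := 6) (mxrank1 _ _) sG _
  (cover_finite_covolume M) ha) => //.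
- by rewrite bilNl bilNr opprK.
- by move=> g gg; rewrite bilNr -(gv _ gg) isom_ip ?av ?oppr0//; exact: grp_isom gg.
- by move=> g gg; rewrite mulmxN (gv _ gg) bilNl bilNr opprK vv.
move=> r r6 r1; apply: cover_deep.
  apply: geodesic_Hyp => //; first by rewrite bilNl bilNr opprK.
  by rewrite bilNr av oppr0.
move=> v' /only ->; rewrite /geodesic !bilE av vv.
have : r^-1 <= 1 by rewrite invf_le1//; lra.
lra.
Qed.

(** The vectors orthogonal to all boundary normals form an invariant subspace Y.
If Y is positive definite, geodesics in the direction of Y escape into the
interior of the cover.  Otherwise Y contains a null vector, all boundary
hyperplanes are tangent at one point at infinity, hence there are only two of them, and
the sum of their normals is a null vector invariant under their stabilizers. *)
Lemma boundary_normals_span (R : realType) (n : nat) (M : hyp_manifold R n.+2) v0 y :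
  boundary_normal (Defs.cover M) v0 ->
  (forall v, boundary_normal (Defs.cover M) v -> ip y v = 0) -> y = 0.
Proof.
move=> bv0 yo; pose bn := boundary_normal (Defs.cover M).
pose Y := [set z : 'cV[R]_n.+3 | forall v, bn v -> ip z v = 0].
have sY : subspace Y.
  split; first by move=> v _; rewrite bil0l.
  by move=> c x z Yx Yz v bv; rewrite !bilE Yx// Yz//; ring.
have GY g s : grp M g -> Y s -> Y (g *m s).
  move=> gg Ys v bv; rewrite (isom_ip_inv _ _ (grp_isom gg)); apply: Ys.
  by apply: boundary_normal_act => //; exact: grpV.
have [v1 bv1 v01] := second_boundary_normal bv0.
have [uv0 _ _] := bv0; have [uv1 _ _] := bv1.
have vv0 : ip v0 v0 = 1 by exact: uv0.
have vv1 : ip v1 v1 = 1 by exact: uv1.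
have sum_neq0 v : bn v -> v0 + v != 0.
  move=> bv; rewrite addr_eq0; apply: contra_notN (boundary_normal_noopp bv) => /eqP <-.
  exact: bv0.
have [[s [Ys s0 ss]]|pos] := pselect (exists s, [/\ Y s, s != 0 & ip s s <= 0]).
  exfalso; have tangent v : bn v -> v0 != v ->
      exists2 t, v0 + v = t *: s & ip (v0 + v) (v0 + v) = 0 /\ ip v0 v = -1.
    move=> bv v0v; have sep := boundary_normal_sep bv0 bv v0v.
    have [uv _ _] := bv; have vv : ip v v = 1 by exact: uv.
    have zz : ip (v0 + v) (v0 + v) = 2 + 2 * ip v0 v.
      by rewrite !bilE vv0 vv (ipC v v0); ring.
    have zz0 : ip (v0 + v) (v0 + v) <= 0 by rewrite zz; lra.
    have sz : ip s (v0 + v) = 0 by rewrite bilDr !Ys// addr0.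
    have [t tE ss0] := nonspacelike_orth s0 (sum_neq0 _ bv) ss zz0 sz.
    by exists t => //; split; [rewrite tE !bilE ss0; ring |
      move: zz; rewrite tE !bilE ss0; lra].
  have [t zE [zz c1]] := tangent _ bv1 v01.
  apply: (stab_no_null (w := v0 + v1) bv0 _ zz (sum_neq0 _ bv1)).
    by rewrite bilDl vv0 ipC c1; ring.
  move=> g Gg; have gv0 := stab_normal bv0 Gg; have gg := Gg.1.
  have bg : bn (g *m v1) by exact: boundary_normal_act.
  have v0g : v0 != g *m v1.
    apply: contra_neq v01 => e; apply: (can_inj (mulKmx (grp_unit gg))).
    by rewrite gv0.
  rewrite mulmxDr gv0; congr (_ + _); apply/eqP; rewrite eq_sym; apply: contraT => ne.
  have [t' zE' [_ _]] := tangent _ bg v0g.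
  have := boundary_normal_sep bv1 bg ne.
  have -> : g *m v1 = t' *: s - v0 by rewrite -zE' addrC addKr.
  have -> : v1 = t *: s - v0 by rewrite -zE addrC addKr.
  have ss0 : ip s s = 0.
    have t0 : t != 0 by apply: contra_neq (sum_neq0 _ bv1) => t0; rewrite zE t0 scale0r.
    move: zz; rewrite zE !bilE => /eqP; rewrite !mulf_eq0 !(negPf t0)/=.
    by move=> /eqP.
  by rewrite !bilE ss0 vv0 (ipC v0 s) (Ys _ bv0); lra.
apply/eqP; apply: contraT => y0; exfalso.
have pY : posdef Y.
  by move=> s Ys s0; rewrite ltNge; apply/negP => le; apply: pos; exists s; split.
have [a0 [ha0 [k k0 ak]]] := cover_interior M.
have sG : subgroup M (grp M).
  by split => //; [exact: grp1 | exact: grpM | exact: grpV].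
have [a [w [b [l [ha [Yw ww] Yb [l0 aE] [ao [gaw gww]]]]]]] :=
  posdef_axis sG sY pY GY yo y0 ha0.
have span1 z : in_span (1%:M : 'M[R]_n.+3) z by exists z; rewrite mul1mx.
apply: (no_expanding_geodesic (L := 1%:M) (r0 := 1 + 4 / (l * k)) (mxrank1 _ _) sG _
  (cover_finite_covolume M) ha _ ww gaw gww) => //.
move=> r rk r1; apply: cover_deep.
  by apply: geodesic_Hyp => //; exact: ao.
move=> v bv; rewrite /geodesic bilDl !bilZl (Yw _ bv) mulr0 addr0.
have av : ip a v <= - (l * k).
  rewrite aE bilZl bilDl bilNl (Yb _ bv) subr0 -mulrN ler_pM2l//; exact: ak.
have lk : 0 < l * k by exact: mulr_gt0.
have rlk : 4 < r * (l * k).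
  have : 4 / (l * k) < r by lra.
  by rewrite ltr_pdivrMr.
have ri : 0 < r^-1 by rewrite invr_gt0; lra.
have : 0 <= r^-1 * (l * k) by rewrite mulr_ge0// ltW.
have : (r + r^-1) / 2 * ip a v <= (r + r^-1) / 2 * - (l * k).
  by rewrite ler_pM2l//; lra.
lra.
Qed.

(** * Vectors and matrices over a subfield *)

Lemma gen_field_subfield (R : realType) (S : set R) : is_subfield (gen_field S).
Proof.
split.
- by rewrite unfold_in; apply/mem_set => K [[]]; rewrite unfold_in => /set_mem.
- move=> x y; rewrite !unfold_in => /set_mem hx /set_mem hy; apply/mem_set => K KS.
  have [[_ KB _] _] := KS; apply/set_mem.
  by apply: (KB x y); rewrite unfold_in; apply/mem_set; [exact: hx | exact: hy].
- move=> x y; rewrite !unfold_in => /set_mem hx /set_mem hy; apply/mem_set => K KS.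
  have [[_ _ KV] _] := KS; apply/set_mem.
  by apply: (KV x y); rewrite unfold_in; apply/mem_set; [exact: hx | exact: hy].
Qed.

Lemma gen_field_sub (R : realType) (S : set R) : S `<=` gen_field S.
Proof. by move=> x Sx K [_]; exact. Qed.

Lemma sf1 (R : realType) (K : set R) : is_subfield K -> K 1.
Proof. by case; rewrite unfold_in => /set_mem. Qed.

Lemma sfB (R : realType) (K : set R) x y : is_subfield K -> K x -> K y -> K (x - y).
Proof.
move=> [_ h _] Kx Ky; apply/set_mem; apply: (h x y); rewrite unfold_in; exact: mem_set.
Qed.

Lemma sf_div (R : realType) (K : set R) x y : is_subfield K -> K x -> K y -> K (x / y).
Proof.
move=> [_ _ h] Kx Ky; apply/set_mem; apply: (h x y); rewrite unfold_in; exact: mem_set.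
Qed.

Lemma sf0 (R : realType) (K : set R) : is_subfield K -> K 0.
Proof. by move=> KK; rewrite -(subrr (1 : R)); apply: sfB => //; exact: sf1. Qed.

Lemma sfN (R : realType) (K : set R) x : is_subfield K -> K x -> K (- x).
Proof. by move=> KK Kx; rewrite -(sub0r x); apply: sfB => //; exact: sf0. Qed.

Lemma sfD (R : realType) (K : set R) x y : is_subfield K -> K x -> K y -> K (x + y).
Proof. by move=> KK Kx Ky; rewrite -(opprK y); apply: sfB => //; exact: sfN. Qed.

Lemma sfV (R : realType) (K : set R) x : is_subfield K -> K x -> K x^-1.
Proof. by move=> KK Kx; rewrite -(div1r x); apply: sf_div => //; exact: sf1. Qed.

Lemma sfM (R : realType) (K : set R) x y : is_subfield K -> K x -> K y -> K (x * y).
Proof. by move=> KK Kx Ky; rewrite -(invrK y); apply: sf_div => //; exact: sfV. Qed.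

Lemma sf_sum (R : realType) (K : set R) (I : Type) (r : seq I) (P : pred I)
    (F : I -> R) :
  is_subfield K -> (forall i, P i -> K (F i)) -> K (\sum_(i <- r | P i) F i).
Proof.
move=> KK KF; apply: (big_ind K) => //; first exact: sf0.
by move=> x y; exact: sfD.
Qed.

Lemma sf_prod (R : realType) (K : set R) (I : Type) (r : seq I) (P : pred I)
    (F : I -> R) :
  is_subfield K -> (forall i, P i -> K (F i)) -> K (\prod_(i <- r | P i) F i).
Proof.
move=> KK KF; apply: (big_ind K) => //; first exact: sf1.
by move=> x y; exact: sfM.
Qed.

Lemma sf_nat (R : realType) (K : set R) m : is_subfield K -> K m%:R.
Proof.
by move=> KK; elim: m => [|m IH]; [exact: sf0 | rewrite -natr1; apply: sfD => //; exact: sf1].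
Qed.

Definition rat_mx (R : realType) (K : set R) (m n : nat) (A : 'M[R]_(m, n)) : Prop :=
  forall i j, K (A i j).

Lemma rat_mxM (R : realType) (K : set R) (m n p : nat) (A : 'M[R]_(m, n))
    (B : 'M[R]_(n, p)) : is_subfield K -> rat_mx K A -> rat_mx K B -> rat_mx K (A *m B).
Proof.
by move=> KK hA hB i j; rewrite mxE; apply: sf_sum => // l _; exact: sfM.
Qed.

Lemma rat_mxD (R : realType) (K : set R) (m n : nat) (A B : 'M[R]_(m, n)) :
  is_subfield K -> rat_mx K A -> rat_mx K B -> rat_mx K (A + B).
Proof. by move=> KK hA hB i j; rewrite mxE; exact: sfD. Qed.

Lemma rat_mxN (R : realType) (K : set R) (m n : nat) (A : 'M[R]_(m, n)) :
  is_subfield K -> rat_mx K A -> rat_mx K (- A).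
Proof. by move=> KK hA i j; rewrite mxE; exact: sfN. Qed.

Lemma rat_mxZ (R : realType) (K : set R) (m n : nat) c (A : 'M[R]_(m, n)) :
  is_subfield K -> K c -> rat_mx K A -> rat_mx K (c *: A).
Proof. by move=> KK hc hA i j; rewrite mxE; exact: sfM. Qed.

Lemma rat_mxT (R : realType) (K : set R) (m n : nat) (A : 'M[R]_(m, n)) :
  rat_mx K A -> rat_mx K A^T.
Proof. by move=> hA i j; rewrite mxE. Qed.

Lemma rat_mx1 (R : realType) (K : set R) (n : nat) :
  is_subfield K -> rat_mx K (1%:M : 'M[R]_n).
Proof. by move=> KK i j; rewrite mxE; exact: sf_nat. Qed.

Lemma rat_mx_delta (R : realType) (K : set R) (m n : nat) i j :
  is_subfield K -> rat_mx K (delta_mx i j : 'M[R]_(m, n)).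
Proof. by move=> KK k l; rewrite mxE; exact: sf_nat. Qed.

Lemma rat_mx_det (R : realType) (K : set R) (n : nat) (A : 'M[R]_n) :
  is_subfield K -> rat_mx K A -> K (\det A).
Proof.
move=> KK hA; apply: sf_sum => // s _; apply: sfM => //; last by apply: sf_prod.
by case: (perm.odd_perm s); rewrite ?expr1 ?expr0; [apply: sfN|] => //; exact: sf1.
Qed.

Lemma rat_mx_inv (R : realType) (K : set R) (n : nat) (A : 'M[R]_n) :
  is_subfield K -> rat_mx K A -> rat_mx K (invmx A).
Proof.
move=> KK hA; rewrite /invmx; case: ifP => // _.
apply: rat_mxZ => //; first by apply: sfV => //; exact: rat_mx_det.
move=> i j; rewrite mxE /cofactor; apply: sfM => //.
  rewrite -signr_odd; case: (odd _); rewrite ?expr1 ?expr0; [apply: sfN|] => //;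
    exact: sf1.
by apply: rat_mx_det => // k l; rewrite !mxE.
Qed.

Lemma rat_bil (R : realType) (K : set R) (n : nat) (F : 'M[R]_n) x y :
  is_subfield K -> rat_mx K F -> rat_mx K x -> rat_mx K y -> K (bil F x y).
Proof.
move=> KK hF hx hy; apply: (rat_mxM KK) => //; apply: (rat_mxM KK) => //.
exact: rat_mxT.
Qed.

(** The form e does not vanish on y, which all rows of B annihilate. *)
Lemma row_free_col_mx (R : realType) (r N : nat) (B : 'M[R]_(r, N)) (e : 'rV[R]_N)
    (y : 'cV[R]_N) :
  row_free B -> B *m y = 0 -> e *m y <> 0 -> row_free (col_mx B e).
Proof.
move=> fB By ey; rewrite -kermx_eq0; apply/rowV0P => w /sub_kermxP.
rewrite -[w]hsubmxK mul_row_col; set w1 := lsubmx w; set w2 := rsubmx w => we.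
have w20 : w2 = 0.
  have := congr1 (fun z => z *m y) we.
  rewrite mulmxDl -!mulmxA By mulmx0 add0r mul0mx [w2]mx11_scalar mul_scalar_mx.
  by move=> /eqP; rewrite scaler_eq0 => /orP[/eqP ->|/eqP//]; rewrite raddf0.
move: we; rewrite w20 mul0mx addr0 => /(congr1 (mulmx^~ (pinvmx B))).
by rewrite mul0mx mulmxKp// => ->; rewrite row_mx0.
Qed.

(** A homogeneous linear system over K whose real solutions form a line: the line
is spanned by a vector over K.  Finitely many equations over K cut out the line;
normalizing one coordinate makes the solution unique. *)
Lemma rational_line (R : realType) (K : set R) (N : nat) (E : set 'rV[R]_N)
    (u : 'cV[R]_N) :
  is_subfield K -> u != 0 -> (forall e, E e -> rat_mx K e) ->
  (forall e, E e -> e *m u = 0) ->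
  (forall y : 'cV[R]_N, (forall e, E e -> e *m y = 0) -> exists c, y = c *: u) ->
  exists2 s : R, s != 0 & rat_mx K (s *: u).
Proof.
move=> KK u0 KE Eu sol.
pose P r := `[< exists B : 'M[R]_(r, N), [/\ rat_mx K B, B *m u = 0 & row_free B] >].
have P0 : exists r, P r.
  exists 0%N; apply/asboolP; exists 0; split; last by rewrite /row_free mxrank0.
    by case.
  by rewrite mul0mx.
have Ple r : P r -> (r <= N)%N.
  by move=> /asboolP[B [_ _ /eqP <-]]; exact: rank_leq_col.
have [r /asboolP[B [KB Bu fB]] max] := ex_maxnP P0 Ple.
have Bsol (y : 'cV[R]_N) : B *m y = 0 -> exists c, y = c *: u.
  move=> By; apply: sol => e Ee; apply: contrapT => ey.
  suff /max : P (r + 1)%N by rewrite addn1 ltnn.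
  apply/asboolP; exists (col_mx B e); split.
  - move=> i j; rewrite mxE; case: splitP => k _; [exact: KB | exact: KE].
  - by rewrite mul_col_mx Bu Eu// col_mx0.
  exact: row_free_col_mx fB By ey.
have [i ui] : exists i, u i ord0 != 0.
  apply/existsP; apply: contra_neqT u0 => /existsPn h; apply/matrixP => i j.
  by rewrite ord1 mxE; apply/eqP; have := h i; rewrite negbK.
exists (u i ord0)^-1; first by rewrite invr_eq0.
pose e : 'cV[R]_N := delta_mx i ord0.
(* M is positive definite: vectors killed by B are multiples of u, and those killed by
   e^T as well vanish *)
pose M := B^T *m B + e *m e^T.
have eT (y : 'cV[R]_N) : e^T *m y = (y i ord0)%:M.
  apply/matrixP => k l; rewrite !ord1 [RHS]mxE eqxx mulr1n trmx_delta -rowE.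
  by rewrite mxE.
have uM : M \in unitmx.
  apply: unitmx_ker0 => y My.
  have : (y^T *m M *m y) ord0 ord0 = 0 by rewrite -mulmxA My mulmx0 mxE.
  have -> : y^T *m M *m y = (B *m y)^T *m (B *m y) + (e^T *m y)^T *m (e^T *m y).
    by rewrite mulmxDr mulmxDl !trmx_mul trmxK !mulmxA.
  rewrite mxE => h.
  have sq m (z : 'cV[R]_m) : 0 <= (z^T *m z) ord0 ord0.
    by rewrite mxE sumr_ge0// => k _; rewrite mxE -expr2 sqr_ge0.
  have sq0 m (z : 'cV[R]_m) : (z^T *m z) ord0 ord0 = 0 -> z = 0.
    rewrite mxE => z0; apply/matrixP => k l; rewrite ord1 mxE.
    have := @psumr_eq0P R 'I_m xpredT (fun j => z^T ord0 j * z j ord0).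
    move=> /(_ _ z0 k isT)/=; rewrite mxE -expr2 => zk.
    apply/eqP; rewrite -sqrf_eq0 zk// => j _.
    by rewrite mxE -expr2 sqr_ge0.
  have h1 := sq _ (B *m y); have h2 := sq _ (e^T *m y).
  have By : B *m y = 0 by apply: sq0; lra.
  have ey : e^T *m y = 0 by apply: sq0; lra.
  have [c yE] := Bsol y By; have := congr1 (fun z : 'M[R]_1 => z ord0 ord0) ey.
  rewrite eT !mxE eqxx mulr1n yE mxE => /eqP.
  by rewrite mulf_eq0 (negPf ui) orbF => /eqP ->; rewrite scale0r.
have -> : (u i ord0)^-1 *: u = invmx M *m e.
  rewrite -[LHS](mulKmx uM); congr (_ *m _).
  rewrite -scalemxAr mulmxDl -!mulmxA Bu mulmx0 add0r eT mul_mx_scalar.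
  by rewrite scalerA mulVf// scale1r.
apply: (rat_mxM KK); last exact: rat_mx_delta.
apply: (rat_mx_inv KK); apply: (rat_mxD KK); apply: (rat_mxM KK) => //.
- exact: rat_mxT.
- exact: rat_mx_delta.
- by apply: rat_mxT; exact: rat_mx_delta.
Qed.

(** * Rational points *)

Lemma po_rationalM (R : realType) (K : set R) (n : nat) (A B : 'M[R]_n) :
  is_subfield K -> po_rational K A -> po_rational K B -> po_rational K (A *m B).
Proof.
move=> KK [c c0 hA] [d d0 hB]; exists (c * d); first by rewrite mulf_neq0.
move=> i j; have -> : c * d * (A *m B) i j = ((c *: A) *m (d *: B)) i j.
  by rewrite -scalemxAl -scalemxAr scalerA !mxE.
by apply: (rat_mxM KK) => k l; rewrite mxE.
Qed.

Lemma rat_po_rational (R : realType) (K : set R) (n : nat) (A : 'M[R]_n) :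
  rat_mx K A -> po_rational K A.
Proof. by move=> hA; exists 1; rewrite ?oner_neq0// => i j; rewrite mul1r. Qed.

Lemma po_rationalN (R : realType) (K : set R) (n : nat) (A : 'M[R]_n) :
  po_rational K A -> po_rational K (- A).
Proof.
by move=> [c c0 hA]; exists (- c) => [|i j]; rewrite ?oppr_eq0// mxE mulrNN.
Qed.

Lemma po_rational_sub (R : realType) (K K' : set R) (n : nat) (A : 'M[R]_n) :
  K `<=` K' -> po_rational K A -> po_rational K' A.
Proof. by move=> KK' [c c0 hA]; exists c => // i j; exact/KK'/hA. Qed.

(** The scalar making X rational has its square in K, as X preserves F. *)
Lemma po_rational_sqr (R : realType) (K : set R) (n : nat) (F X : 'M[R]_n.+1) :
  is_subfield K -> rat_mx K F -> F \in unitmx -> F^T = F ->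
  form_iso F F X -> po_rational K X -> rat_mx K (X *m X).
Proof.
move=> KK KF uF Fs oX [c c0 hX].
have KX : rat_mx K (c *: X) by move=> i j; rewrite mxE.
have [i [j Fij]] : exists i j, F i j != 0.
  apply: contrapT => h; move: uF; suff -> : F = 0.
    by rewrite unitmxE det0 unitr0.
  apply/matrixP => i j; rewrite mxE; apply/eqP; apply: contra_notT h => Fij.
  by exists i, j.
have Kc2 : K (c ^+ 2).
  have e : bil F ((c *: X) *m delta_mx i ord0) ((c *: X) *m delta_mx j ord0) =
      c ^+ 2 * F i j.
    by rewrite -!scalemxAl bilZl bilZr (form_iso_bil _ _ Fs Fs oX) bil_delta; ring.
  have -> : c ^+ 2 = c ^+ 2 * F i j / F i j by field.
  rewrite -e; apply: (sf_div KK); last exact: KF.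
  by apply: (rat_bil KK) => //; apply: (rat_mxM KK) => //; exact: rat_mx_delta.
have -> : X *m X = (c ^+ 2)^-1 *: ((c *: X) *m (c *: X)).
  rewrite -scalemxAl -scalemxAr !scalerA -[LHS]scale1r; congr (_ *: _).
  by field.
by apply: (rat_mxZ KK); [exact: sfV | exact: rat_mxM].
Qed.

(** * Fields of definition under composition with rational maps *)

Lemma regular_sum (R : realType) (n : nat) (K : set R) (I : Type) (r : seq I)
    (h : I -> 'M[R]_n -> R) :
  is_subfield K -> (forall i, regular_on_PO K (h i)) ->
  regular_on_PO K (fun X => \sum_(i <- r) h i X).
Proof.
move=> KK hh; elim: r => [|i r IH].
  rewrite (_ : (fun X => _) = fun=> 0); last by apply/funext => X; rewrite big_nil.
  by apply: regular_cst; exact: sf0.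
rewrite (_ : (fun X => _) = fun X => h i X + \sum_(j <- r) h j X).
  exact: regular_add.
by apply/funext => X; rewrite big_cons.
Qed.

(** The scalar making P rational cancels in the conjugation by P, so that each entry of
the conjugate is a combination over K of entries of X. *)
Lemma regular_conj (R : realType) (n : nat) (K : set R) (P : 'M[R]_n) h :
  is_subfield K -> P \in unitmx -> po_rational K P -> regular_on_PO K h ->
  regular_on_PO K (fun X => h (P *m X *m invmx P)).
Proof.
move=> KK uP pP.
have [p [q [Kp Kq pq]]] : exists p q : 'M[R]_n, [/\ rat_mx K p, rat_mx K q &
    forall X, P *m X *m invmx P = p *m X *m q].
  have [c c0 hP] := pP.
  have Kp : rat_mx K (c *: P) by move=> i j; rewrite mxE.
  exists (c *: P), (invmx (c *: P)); split => //; first exact: rat_mx_inv.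
  move=> X; rewrite invmxZ; last by rewrite unitmxZ// unitfE.
  by rewrite -!scalemxAl -scalemxAr scalerA divff// scale1r.
elim=> {h} [c Kc|i j k l|g h _ IHg _ IHh|g h _ IHg _ IHh].
- exact: regular_cst.
- rewrite (_ : (fun X => _) = fun X : 'M[R]_n => \sum_a \sum_b \sum_a' \sum_b'
      (p i b * q a j * (p k b' * q a' l)) * (X b a * X b' a')).
    do 4![apply: regular_sum => // ?].
    by apply: regular_mul; [apply: regular_cst; do ![apply: (sfM KK)] |
      exact: regular_gen].
  apply/funext => X; rewrite pq !mxE mulr_suml; apply: eq_bigr => a _.
  rewrite mxE !mulr_suml; apply: eq_bigr => b _.
  rewrite mulr_sumr; apply: eq_bigr => a' _.
  rewrite mxE mulr_suml mulr_sumr; apply: eq_bigr => b' _.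
  by ring.
- exact: regular_add.
- exact: regular_mul.
Qed.

Lemma invmxM (R : realType) (n : nat) (B C : 'M[R]_n) :
  B \in unitmx -> C \in unitmx -> invmx (B *m C) = invmx C *m invmx B.
Proof.
move=> uB uC; have uBC : B *m C \in unitmx by rewrite unitmx_mul uB.
apply: (can_inj (mulKmx uBC)).
by rewrite mulmxV// mulmxA -(mulmxA B) mulmxV// mulmx1 mulmxV.
Qed.

Lemma form_iso_comp (R : realType) (n : nat) (F1 F2 F3 A B : 'M[R]_n) :
  form_iso F1 F2 A -> form_iso F2 F3 B -> form_iso F1 F3 (B *m A).
Proof.
move=> [uA hA] [uB hB]; split; first by rewrite unitmx_mul uB.
by move=> x; rewrite -mulmxA hB hA.
Qed.

Lemma form_iso_inv (R : realType) (n : nat) (F1 F2 A : 'M[R]_n) :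
  form_iso F1 F2 A -> form_iso F2 F1 (invmx A).
Proof.
move=> [uA hA]; split; first by rewrite unitmx_inv.
by move=> x; rewrite -hA mulKVmx.
Qed.

(** Conjugation by P A Q is the composition of the conjugations by Q, A and P, and the
first and the last of these are defined over K. *)
Lemma conj_defined_transfer (R : realType) (n : nat) (F1 F1' A P Q : 'M[R]_n)
    (K : set R) :
  is_subfield K -> A \in unitmx -> P \in unitmx -> po_rational K P ->
  form_iso F1' F1 Q -> po_rational K Q ->
  conj_defined_over F1 A K -> conj_defined_over F1' (P *m A *m Q) K.
Proof.
move=> KK uA uP pP isoQ pQ hA h hreg; have [uQ _] := isoQ.
have [g greg hg] := hA _ (regular_conj KK uP pP hreg).
exists (fun X => g (Q *m X *m invmx Q)); first exact: regular_conj.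
move=> X oX; rewrite -hg.
  by rewrite !invmxM ?unitmx_mul ?uP// !mulmxA.
apply: form_iso_comp (form_iso_inv isoQ) _.
exact: form_iso_comp oX isoQ.
Qed.

(** * Rationality in the models *)

Lemma trace_field_subfield (R : realType) (n : nat) (M : hyp_manifold R n) :
  is_subfield (trace_field M).
Proof. exact: gen_field_subfield. Qed.

Lemma form_sym (R : realType) (n : nat) (M : hyp_manifold R n) (m : model M) :
  (Defs.form m)^T = Defs.form m.
Proof. by case: m. Qed.

Lemma form_rat (R : realType) (n : nat) (M : hyp_manifold R n) (m : model M) :
  rat_mx (trace_field M) (Defs.form m).
Proof. by case: m. Qed.

Lemma dev_iso (R : realType) (n : nat) (M : hyp_manifold R n) (m : model M) :
  form_iso (lorentz R n) (Defs.form m) (dev m).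
Proof. by case: m. Qed.

Lemma dev_grp_rational (R : realType) (n : nat) (M : hyp_manifold R n) (m : model M)
    g : grp M g -> po_rational (trace_field M) (dev m *m g *m invmx (dev m)).
Proof. by case: m => F D *; eauto. Qed.

Lemma dev_unit (R : realType) (n : nat) (M : hyp_manifold R n) (m : model M) :
  dev m \in unitmx.
Proof. by case: (dev_iso m). Qed.

Lemma dev_bil (R : realType) (n : nat) (M : hyp_manifold R n) (m : model M) x y :
  bil (Defs.form m) (dev m *m x) (dev m *m y) = ip x y.
Proof. exact: form_iso_bil (lorentz_sym R n) (form_sym m) (dev_iso m). Qed.

Lemma lorentz_sqr (R : realType) (n : nat) : lorentz R n *m lorentz R n = 1%:M.
Proof.
apply/matrixP => i j; rewrite mul_diag_mx !mxE.
by case: (i == j) => //=; case: eqP => _; rewrite ?mulr1n ?mulr0n; ring.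
Qed.

Lemma lorentz_unit (R : realType) (n : nat) : lorentz R n \in unitmx.
Proof. by have /mulmx1_unit[] := lorentz_sqr R n. Qed.

Lemma form_unit (R : realType) (n : nat) (M : hyp_manifold R n) (m : model M) :
  Defs.form m \in unitmx.
Proof.
apply: unitmx_ker0 => c Fc; have uD := dev_unit m.
suff : invmx (dev m) *m c = 0.
  by move=> /(congr1 (mulmx (dev m))); rewrite mulKVmx// mulmx0.
have z y : ip y (invmx (dev m) *m c) = 0.
  by rewrite -(dev_bil m) mulKVmx// /bil -mulmxA Fc mulmx0 mxE.
apply/matrixP => i j; rewrite ord1 [RHS]mxE -(ip_co i) ipC; exact: z.
Qed.

Lemma isom_model (R : realType) (n : nat) (M : hyp_manifold R n) (m : model M) g :
  form_iso (lorentz R n) (lorentz R n) g ->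
  form_iso (Defs.form m) (Defs.form m) (dev m *m g *m invmx (dev m)).
Proof.
move=> og; apply: form_iso_comp (form_iso_inv (dev_iso m)) _.
exact: form_iso_comp og (dev_iso m).
Qed.

(** The normal is the only common fixed vector of the squares of the stabilizer,
and these squares have entries in the trace field. *)
Lemma normal_rational (R : realType) (n : nat) (M : hyp_manifold R n.+2) (m : model M)
    v : boundary_normal (Defs.cover M) v ->
  exists2 s : R, s != 0 & rat_mx (trace_field M) (s *: (dev m *m v)).
Proof.
move=> bv; have uD := dev_unit m; set D := dev m in uD *.
have KK := trace_field_subfield M.
have [uv _ _] := bv; have vv : ip v v = 1 by exact: uv.
pose X g := D *m g *m invmx D.
pose E := [set e : 'rV[R]_n.+3 | exists g i,
  setwise_stab (grp M) (hyperplane v) g /\ e = row i (X g *m X g - 1%:M)].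
have XX g : X g *m X g = D *m (g *m g) *m invmx D.
  by rewrite /X !mulmxA mulmxKV.
apply: (rational_line (E := E) KK).
- apply: contraTneq isT => u0; have : v = 0 by rewrite -(mulKmx uD v) u0 mulmx0.
  by move=> v0; move: vv; rewrite v0 bil0l => /eqP; rewrite eq_sym oner_eq0.
- move=> e [g [i [Gg ->]]] a b; rewrite mxE.
  apply: (rat_mxD KK); last by apply: (rat_mxN KK); exact: rat_mx1.
  apply: (po_rational_sqr KK (form_rat m) (form_unit m) (form_sym m)).
    by apply: isom_model; case: (grp_isom Gg.1).
  exact: dev_grp_rational Gg.1.
- move=> e [g [i [Gg ->]]]; rewrite -row_mul mulmxBl mul1mx XX.
  rewrite -!mulmxA mulKmx// !(stab_normal bv Gg) subrr.
  by apply/matrixP => a b; rewrite !mxE.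
move=> y hy; have [|c yE] := @stab_fixed _ _ M v (invmx D *m y) bv.
  move=> g Gg; apply: (can_inj (mulKmx uD)); rewrite mulKVmx//.
  apply/eqP; rewrite -subr_eq0; apply/eqP/row_matrixP => i; rewrite row0.
  have := hy (row i (X g *m X g - 1%:M)) (ex_intro _ g (ex_intro _ i (conj Gg erefl))).
  by rewrite -row_mul mulmxBl mul1mx XX -!mulmxA.
by exists c; rewrite scalemxAr -yE mulKVmx.
Qed.

Lemma mx_ext (R : realType) (m n : nat) (A B : 'M[R]_(m, n)) :
  (forall x : 'cV[R]_n, A *m x = B *m x) -> A = B.
Proof.
move=> h; apply/matrixP => i j.
by have /matrixP/(_ i ord0) := h (delta_mx j ord0); rewrite -!colE !mxE.
Qed.

Lemma refl_mx_scale (R : realType) (d : nat) (F : 'M[R]_d) (c : R) w :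
  c != 0 -> refl_mx F (c *: w) = refl_mx F w.
Proof.
move=> c0; apply: mx_ext => x; rewrite !refl_mxE !bilE scalerA; congr (_ - _ *: _).
have [->|w0] := eqVneq (bil F w w) 0; first by rewrite !mulr0 invr0; ring.
by field; rewrite ?c0 ?w0.
Qed.

(** The reflection depends only on the line of v, which is spanned by a rational vector
of the model. *)
Lemma reflection_rational (R : realType) (n : nat) (M : hyp_manifold R n.+2)
    (m : model M) v :
  boundary_normal (Defs.cover M) v ->
  po_rational (trace_field M)
    (dev m *m refl_mx (lorentz R n.+2) v *m invmx (dev m)).
Proof.
move=> bv; have [s s0 hs] := normal_rational m bv; have uD := dev_unit m.
have KK := trace_field_subfield M.
have -> : dev m *m refl_mx (lorentz R n.+2) v *m invmx (dev m) =
    refl_mx (Defs.form m) (s *: (dev m *m v)).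
  rewrite refl_mx_scale//; apply: mx_ext => x.
  rewrite -!mulmxA !refl_mxE dev_bil mulmxBr mulKVmx// -scalemxAr.
  by rewrite -[in RHS](mulKVmx uD x) dev_bil mulKVmx.
apply: rat_po_rational.
have KF := form_rat m; set u := s *: _ in hs *.
apply: (rat_mxD KK); first exact: rat_mx1.
apply: (rat_mxN KK); apply: (rat_mxZ KK).
  by apply: (sf_div KK); [exact: sf_nat | exact: rat_bil].
by apply: (rat_mxM KK) => //; apply: (rat_mxM KK) => //; exact: rat_mxT.
Qed.

(** A linearly independent family in E of maximal size. *)
Lemma basis_in (R : realType) (N : nat) (E : set 'cV[R]_N) :
  (forall y : 'cV[R]_N, (forall e, E e -> e^T *m y = 0) -> y = 0) ->
  exists2 V : 'M[R]_N, V \in unitmx & forall j, E (col j V).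
Proof.
move=> span.
pose P r := `[< exists B : 'M[R]_(r, N), row_free B /\ forall i, E (row i B)^T >].
have P0 : exists r, P r.
  exists 0%N; apply/asboolP; exists 0; split; first by rewrite /row_free mxrank0.
  by case.
have Ple r : P r -> (r <= N)%N.
  by move=> /asboolP[B [fB _]]; have := rank_leq_col B; rewrite (eqP fB).
have [r /asboolP[B [fB EB]] max] := ex_maxnP P0 Ple.
have rN : r = N.
  rewrite -[LHS](eqP fB); apply: inj_rank => y By; apply: span => e Ee.
  apply: contrapT => ey; suff /max : P (r + 1)%N by rewrite addn1 ltnn.
  apply/asboolP; exists (col_mx B e^T); split; first exact: row_free_col_mx fB By ey.
  move=> i; case: (split_ordP i) => j ->.
    by rewrite rowKu.
  by rewrite rowKd row_id trmxK.
subst r; exists B^T; first by rewrite unitmx_tr -row_free_unit.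
by move=> j; rewrite -tr_row.
Qed.

(** Take a basis of boundary normals and scale it to rational bases of the two models.
The change of models is diagonal in these bases. The products of any two of its
diagonal entries are quotients of rational Gram matrix entries, which do not vanish
as no two normals are orthogonal; hence dividing by one diagonal entry makes the
change of models rational. *)
Lemma model_change_rational (R : realType) (n : nat) (M : hyp_manifold R n.+2)
    (m m' : model M) v0 :
  boundary_normal (Defs.cover M) v0 ->
  po_rational (trace_field M) (dev m' *m invmx (dev m)).
Proof.
move=> bv0; set k := trace_field M; have KK : is_subfield k := trace_field_subfield M.
have uD := dev_unit m; have uD' := dev_unit m'.
set D := dev m in uD *; set D' := dev m' in uD' *.
have [V uV bV] : exists2 V : 'M[R]_n.+3, V \in unitmx &
    forall j, boundary_normal (Defs.cover M) (col j V).
  apply: basis_in => y yo; have J2 := lorentz_unit R n.+2.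
  have : invmx (lorentz R n.+2) *m y = 0.
    apply: (boundary_normals_span bv0) => v bv; rewrite ipC /bil -mulmxA mulKVmx//.
    by rewrite yo// mxE.
  by move=> /(congr1 (mulmx (lorentz R n.+2))); rewrite mulKVmx// mulmx0.
have scal (m0 : model M) : exists s : 'rV[R]_n.+3, (forall j, s ord0 j != 0) /\
    rat_mx k (dev m0 *m V *m diag_mx s).
  have h j : exists s : R, s != 0 /\ rat_mx k (s *: (dev m0 *m col j V)).
    by have [s s0 hs] := normal_rational m0 (bV j); exists s.
  have [s hs] := choice h; exists (\row_j s j); split.
    by move=> j; rewrite mxE; case: (hs j).
  move=> i j; have [_ /(_ i ord0)] := hs j.
  rewrite colE mulmxA -colE; rewrite mul_mx_diag !mxE.
  by rewrite mulrC.
have [s [s0 hs]] := scal m; have [s' [s'0 hs']] := scal m'.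
rewrite -/D in hs; rewrite -/D' in hs'.
set U := D *m V *m diag_mx s in hs; set U' := D' *m V *m diag_mx s' in hs'.
have udiag (t : 'rV[R]_n.+3) : (forall j, t ord0 j != 0) -> diag_mx t \in unitmx.
  by move=> t0; rewrite unitmxE det_diag unitfE; apply/prodf_neq0 => j _; exact: t0.
have uU : U \in unitmx by rewrite !unitmx_mul uD uV udiag.
have colU (m0 : model M) (t : 'rV[R]_n.+3) i j :
    bil (Defs.form m0) (col i (dev m0 *m V *m diag_mx t))
       (col j (dev m0 *m V *m diag_mx t)) =
    t ord0 i * t ord0 j * ip (col i V) (col j V).
  have cE l : col l (dev m0 *m V *m diag_mx t) = t ord0 l *: (dev m0 *m col l V).
    apply/matrixP => a b; rewrite mul_mx_diag !mxE mulrC; congr (_ * _).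
    by apply: eq_bigr => c _; rewrite mxE.
  by rewrite !cE bilZl bilZr dev_bil; ring.
have nz i j : ip (col i V) (col j V) != 0.
  have [->|ij] := eqVneq i j.
    by have [uv _ _] := bV j; rewrite [ip _ _]uv oner_neq0.
  have cij : col i V != col j V.
    apply: contra_neq ij => e; have := congr1 (mulmx (invmx V)) e.
    rewrite !colE !mulKmx// => /matrixP/(_ i ord0); rewrite !mxE !eqxx andbT.
    by case: eqP => // _ /eqP; rewrite oner_eq0.
  by have := boundary_normal_sep (bV i) (bV j) cij; rewrite neq_lt => ?; apply/orP; left; lra.
pose t j := s ord0 j / s' ord0 j.
have t0 j : t j != 0 by rewrite mulf_neq0 ?invr_eq0.
have tt i j : k (t i * t j).
  have -> : t i * t j = bil (Defs.form m) (col i U) (col j U) /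
      bil (Defs.form m') (col i U') (col j U').
    by rewrite !colU /t; field; rewrite nz !s'0.
  have colr (W : 'M[R]_n.+3) l : rat_mx k W -> rat_mx k (col l W).
    by move=> hW a b; rewrite mxE.
  by apply: (sf_div KK); apply: (rat_bil KK); do ?[exact: form_rat | exact: colr].
exists (t ord0)^-1; first by rewrite invr_eq0.
have gE : D' *m invmx D = U' *m diag_mx (\row_j t j) *m invmx U.
  apply: (can_inj (mulmxK uU)); rewrite mulmxKV//.
  rewrite /U /U' -!mulmxA mulKmx//; congr (_ *m (_ *m _)).
  rewrite mulmx_diag; congr diag_mx; apply/rowP => j; rewrite !mxE /t.
  by field.
move=> i j; rewrite gE.
have -> : (t ord0)^-1 * (U' *m diag_mx (\row_j t j) *m invmx U) i j =
    (U' *m diag_mx (\row_j (t j * t ord0 / (t ord0 * t ord0))) *m invmx U) i j.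
  have -> : \row_j (t j * t ord0 / (t ord0 * t ord0)) = (t ord0)^-1 *: \row_j t j.
    by apply/rowP => l; rewrite !mxE; field.
  have -> : diag_mx ((t ord0)^-1 *: \row_j0 t j0) = (t ord0)^-1 *: diag_mx (\row_j0 t j0).
    by apply/matrixP => a b; rewrite !mxE mulrnAr.
  by rewrite -scalemxAr -scalemxAl [RHS]mxE.
move: i j; apply: (rat_mxM KK); last exact: rat_mx_inv.
apply: (rat_mxM KK) => // i j; rewrite !mxE.
case: (i == j); last by rewrite mulr0n; exact: sf0.
by rewrite mulr1n; apply: (sf_div KK); exact: tt.
Qed.

(** * Lifts of the gluing isometry to the universal covers *)

Lemma Hyp_sign_eq1 (R : realType) (n : nat) (x y : 'cV[R]_n.+1) (e : R) :
  Hyp x -> Hyp y -> e = 1 \/ e = -1 -> x = e *: y -> e = 1.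
Proof.
move=> hx hy [//|e1]; rewrite e1 scaleN1r => xy.
by have := Hyp_ip_lt0 hx hy; rewrite xy bilNl (Hyp_ip hy); lra.
Qed.

(** The sign is determined by the upper sheet. *)
Lemma model_proj_dev (R : realType) (n : nat) (M : hyp_manifold R n) (m : model M)
    x (e : R) : Hyp x -> e = 1 \/ e = -1 -> model_proj m (e *: (dev m *m x)) = Defs.proj M x.
Proof.
move=> hx he; have uD := dev_unit m; apply/seteqP; split => z.
  move=> [x' [hx' eq hz]]; suff -> : x = x' by [].
  have [e' he' xx'] : exists2 e' : R, e' = 1 \/ e' = -1 & x = e' *: x'.
    case: he eq => ->; rewrite ?scale1r ?scaleN1r => -[] eq.
    - by exists 1; [left | rewrite scale1r; exact: (can_inj (mulKmx uD))].
    - by exists (-1); [right | apply: (can_inj (mulKmx uD)); rewrite eq scaleN1r mulmxN].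
    - exists (-1); [by right | apply: (can_inj (mulKmx uD))].
      by rewrite -[LHS]opprK eq scaleN1r mulmxN.
    - by exists 1; [left | rewrite scale1r; apply: (can_inj (mulKmx uD)); exact: oppr_inj].
  by rewrite xx' (Hyp_sign_eq1 hx hx' he' xx') scale1r.
move=> hz; exists x; split => //.
by case: he => ->; rewrite ?scale1r ?scaleN1r; [left | right].
Qed.

(** In the Lorentz coordinates of the two manifolds, an extension becomes an isometry of
the Lorentz form that covers the gluing isometry on a boundary hyperplane, up to the
sign that the models do not see. *)
Lemma extension_lift (R : realType) (n : nat) (M1 M2 : hyp_manifold R n)
    (N1 N2 : set (set 'cV[R]_n.+1))
    (phi : set 'cV[R]_n.+1 -> set 'cV[R]_n.+1)
    (m1 : model M1) (m2 : model M2) (R1 R2 : set 'cV[R]_n.+1) (A : 'M[R]_n.+1) :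
  is_extension N1 N2 phi m1 m2 R1 R2 A ->
  let B := invmx (dev m2) *m A *m dev m1 in
  exists v1 v2, [/\ boundary_normal (Defs.cover M1) v1,
    boundary_normal (Defs.cover M2) v2,
    Defs.proj M1 @` hyperplane v1 = N1,
    form_iso (lorentz R n) (lorentz R n) B &
    forall x, hyperplane v1 x -> exists (e : R) y, [/\ e = 1 \/ e = -1,
      Hyp y, B *m x = e *: y & Defs.proj M2 y = phi (Defs.proj M1 x)]].
Proof.
move=> [[[Q1 [v1 [bv1 Q1E N1E]] R1E] [Q2 [v2 [bv2 Q2E N2E]] R2E]] isoA AR hphi] B.
have uD1 := dev_unit m1; have uD2 := dev_unit m2.
exists v1, v2; split => //; first by rewrite -Q1E.
  rewrite /B -mulmxA; apply: form_iso_comp (form_iso_inv (dev_iso m2)).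
  exact: form_iso_comp (dev_iso m1) isoA.
move=> x Px; have R1x : R1 (dev m1 *m x) by rewrite R1E; exists x; [rewrite Q1E | left].
have := hphi _ R1x; have : R2 (A *m (dev m1 *m x)) by rewrite -AR; exists (dev m1 *m x).
have := @model_proj_dev _ _ _ m1 x 1 Px.1 (or_introl erefl); rewrite scale1r => ->.
rewrite R2E Q2E => -[y [hy yv2] Ay].
have [e he Ae] : exists2 e : R, e = 1 \/ e = -1 & A *m (dev m1 *m x) = e *: (dev m2 *m y).
  case: Ay => ->; first by exists 1; [left | rewrite scale1r].
  by exists (-1); [right | rewrite scaleN1r].
rewrite Ae (model_proj_dev m2 hy he) => pE; exists e, y; split => //.
by rewrite /B -!mulmxA Ae -scalemxAr mulKmx.
Qed.

Lemma proj_self (R : realType) (n : nat) (M : hyp_manifold R n) x : Defs.proj M x x.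
Proof. by exists 1; [exact: grp1 | rewrite mul1mx]. Qed.

Lemma proj_grp (R : realType) (n : nat) (M : hyp_manifold R n) g x :
  grp M g -> Defs.proj M (g *m x) = Defs.proj M x.
Proof.
move=> gg; apply/seteqP; split => y [h hh ->].
  by exists (h *m g); [exact: grpM | rewrite mulmxA].
exists (h *m invmx g); first by apply: grpM => //; exact: grpV.
by rewrite -mulmxA mulKmx//; exact: grp_unit gg.
Qed.

(** A deck transformation carrying a point of one hyperplane into the other one carries
the first hyperplane to a boundary hyperplane that meets the second. *)
Lemma lifts_conjugate (R : realType) (n : nat) (M : hyp_manifold R n) v v' :
  boundary_normal (Defs.cover M) v -> boundary_normal (Defs.cover M) v' ->
  Defs.proj M @` hyperplane v = Defs.proj M @` hyperplane v' ->
  exists2 g, grp M g & g *m v = v'.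
Proof.
move=> bv bv' vv'; have [uv _ _] := bv; have [x Px] := hyperplane_neq0 uv.
have : (Defs.proj M @` hyperplane v') (Defs.proj M x) by rewrite -vv'; exists x.
move=> [x' Px' e]; have [g gg x'E] : Defs.proj M x x' by rewrite -e; exact: proj_self.
exists g => //; have ig := grp_isom gg.
apply: (@boundary_normal_meet _ _ M _ _ x' _ bv' _ Px'); first exact: boundary_normal_act.
by rewrite x'E; split; [exact: isom_Hyp Px.1 | rewrite isom_ip//; exact: Px.2].
Qed.

(** Moving from a by a small distance in any direction orthogonal to a and v stays in the
hyperplane. *)
Lemma zero_near_hyperplane (R : realType) (n : nat) (N : 'M[R]_n.+1) v a :
  hyperplane v a -> (\forall y \near a, hyperplane v y -> N *m y = 0) ->
  forall x, ip x v = 0 -> N *m x = 0.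
Proof.
move=> [ha av] nN x xv; have Na : N *m a = 0 by exact: (nbhs_singleton nN).
have aa := Hyp_ip ha.
have [w [wE wa wv]] : exists w, [/\ w = x + ip x a *: a, ip w a = 0 & ip w v = 0].
  by eexists; split; first reflexivity; rewrite !bilE ?aa ?av ?xv; ring.
suff Nw : N *m w = 0.
  by move: Nw; rewrite wE mulmxDr -scalemxAr Na scaler0 addr0.
have [->|w0] := eqVneq w 0; first by rewrite mulmx0.
have ww : 0 < ip w w by apply: (orth_timelike_gt0 _ wa w0); rewrite aa; lra.
have nP : \forall y \near a, Hyp y -> hyperplane v y -> N *m y = 0.
  by move: nN; apply: filterS => y h _.
have [y [c [d [hy Py yE d0]]]] := nudge ha (etrans (ipC a w) wa) ww nP.
have : N *m y = 0 by apply: Py; split => //; rewrite yE !bilE av wv; ring.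
rewrite yE mulmxDr -!scalemxAr Na scaler0 add0r => /eqP.
by rewrite scaler_eq0 gt_eqF//= => /eqP.
Qed.

(** A hyperplane is not a finite union of proper linear subspaces: if the first map does
not vanish near a, it is nonzero near some point close to a, where the remaining
maps must suffice. *)
Lemma finite_cover_hyperplane (R : realType) (n : nat) (s : seq 'M[R]_n.+1) v a :
  hyperplane v a ->
  (\forall y \near a, hyperplane v y -> exists2 N, N \in s & N *m y = 0) ->
  exists2 N, N \in s & forall x, ip x v = 0 -> N *m x = 0.
Proof.
elim: s a => [|N s IH] a Pa h; first by have [] := nbhs_singleton h Pa.
have [[y [Py Ny ny]]|no] := pselect (exists y, [/\ hyperplane v y, N *m y != 0 &
    \forall z \near y, hyperplane v z -> exists2 N', N' \in N :: s & N' *m z = 0]).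
  have [N' N's hN'] : exists2 N', N' \in s & forall x, ip x v = 0 -> N' *m x = 0.
    apply: (IH y) => //.
    have [i Nyi] : exists i, (N *m y) i ord0 != 0.
      apply: contrapT => /forallNP no; move/eqP: Ny; apply; apply/matrixP => i j.
      by rewrite ord1 [RHS]mxE; have /negP := no i; rewrite negbK => /eqP.
    have NE (z : 'cV[R]_n.+1) : (N *m z) i ord0 = ip z (lorentz R n *m (row i N)^T).
      rewrite ipC /bil trmx_mul trmxK lorentz_sym -[_ *m _ *m lorentz R n]mulmxA.
      rewrite lorentz_sqr mulmx1 -row_mul.
      by rewrite !mxE.
    have nz : \forall z \near y, N *m z != 0.
      have zi (z : 'cV[R]_n.+1) : (N *m z) i ord0 != 0 -> N *m z != 0.
        by apply: contra_neq => ->; rewrite mxE.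
      move: Nyi; rewrite NE neq_lt => /orP[] lt.
        move: (near_ip_lt lt); apply: filterS => z hz; apply: zi; rewrite NE.
        by rewrite lt_eqF.
      have := @near_ip_lt _ _ y (- (lorentz R n *m (row i N)^T)) 0.
      rewrite bilNr oppr_lt0 => /(_ lt); apply: filterS => z hz; apply: zi; rewrite NE.
      by move: hz; rewrite bilNr oppr_lt0 => hz; rewrite gt_eqF.
    apply: filterS2 nz ny => z z0 hz Pz; have [N' N's N'z] := hz Pz.
    exists N' => //; move: N's; rewrite inE => /orP[/eqP N'N|//].
    by move: z0; rewrite -N'N N'z eqxx.
  by exists N' => //; rewrite inE N's orbT.
exists N; first by rewrite inE eqxx.
apply: (zero_near_hyperplane Pa); move: (nbhs_interior h); apply: filterS => y ny Py.
by apply/eqP; apply: contrapT => /negP Ny; apply: no; exists y; split.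
Qed.

(** Near a given point only finitely many deck transformations occur, by discreteness,
and the hyperplane is not a finite union of proper linear subspaces. Hence one deck
transformation and one sign serve for the whole hyperplane. *)
Lemma uniform_deck (R : realType) (n : nat) (M : hyp_manifold R n) v
    (B B' : 'M[R]_n.+1) :
  ip v v = 1 -> form_iso (lorentz R n) (lorentz R n) B ->
  form_iso (lorentz R n) (lorentz R n) B' ->
  (forall x, hyperplane v x -> exists e e' y y', [/\ e = 1 \/ e = -1, e' = 1 \/ e' = -1,
    Hyp y /\ B *m x = e *: y, Hyp y' /\ B' *m x = e' *: y' &
    Defs.proj M y = Defs.proj M y']) ->
  exists g (e : R), [/\ grp M g, e = 1 \/ e = -1 &
    forall x, ip x v = 0 -> B' *m x = e *: (g *m (B *m x))].
Proof.
move=> vv oB oB' h; have [a Pa] := hyperplane_neq0 vv.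
have Bip x y : ip (B *m x) (B *m y) = ip x y.
  exact: form_iso_bil (lorentz_sym R n) (lorentz_sym R n) oB.
have B'ip x y : ip (B' *m x) (B' *m y) = ip x y.
  exact: form_iso_bil (lorentz_sym R n) (lorentz_sym R n) oB'.
have ee (e : R) : e = 1 \/ e = -1 -> e * e = 1 by case=> ->; ring.
have same (x1 x2 y1 y2 : 'cV[R]_n.+1) (e1 e2 : R) (C : 'M[R]_n.+1) :
    (forall x y, ip (C *m x) (C *m y) = ip x y) -> Hyp x1 -> Hyp x2 -> Hyp y1 -> Hyp y2 ->
    e1 = 1 \/ e1 = -1 -> e2 = 1 \/ e2 = -1 ->
    C *m x1 = e1 *: y1 -> C *m x2 = e2 *: y2 -> ip y1 y2 = ip x1 x2.
  move=> Cip hx1 hx2 hy1 hy2 he1 he2 E1 E2.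
  have := Cip x1 x2; rewrite E1 E2 bilZl bilZr.
  have := Hyp_ip_lt0 hx1 hx2; have := Hyp_ip_lt0 hy1 hy2.
  by case: he1 => ->; case: he2 => ->; lra.
have [e0 [e0' [y0 [y0' [he0 he0' [hy0 By0] [hy0' By0'] _]]]]] := h _ Pa.
have [bound _ hb] := isom_entry_le hy0.
(* two uses of the triangle inequality bound the displacement of y0 by any g that
   occurs for a point x with - ip x a < 2 *)
pose c := 16 * (- ip y0 y0').
pose S := [set g | grp M g /\ forall i j, `|g i j| <= bound c].
have /finite_seqP[s sE] : finite_set S by exact: grp_bounded_finite.
pose t := [seq B' - g *m B | g <- s] ++ [seq B' + g *m B | g <- s].
have [|N Nt N0] := @finite_cover_hyperplane _ _ t v a Pa.
  have := @near_ip_lt _ _ a (- a) 2; rewrite bilNr (Hyp_ip Pa.1).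
  move=> /(_ ltac:(lra)); apply: filterS => x; rewrite bilNr => ax Px.
  have [e [e' [y [y' [he he' [hy By] [hy' By'] yy']]]]] := h _ Px.
  have [g gg y'E] : Defs.proj M y y' by rewrite yy'; exact: proj_self.
  have ig := grp_isom gg.
  have gs : g \in s.
    have : S g.
      split => //; apply: hb => //.
      have i1 := same _ _ _ _ _ _ B Bip Px.1 Pa.1 hy hy0 he he0 By By0.
      have i2 := same _ _ _ _ _ _ B' B'ip Px.1 Pa.1 hy' hy0' he' he0' By' By0'.
      have hgy0 := isom_Hyp ig hy0.
      have t1 := Hyp_triangle hy0 hgy0 hy'.
      have t2 := Hyp_triangle hy0 hy' hy0'.
      have gy : ip (g *m y0) y' = ip x a by rewrite y'E isom_ip// ipC.
      rewrite gy in t1; rewrite i2 in t2.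
      have p := Hyp_ip_lt0 Px.1 Pa.1; have q := Hyp_ip_lt0 hy0 hy0'.
      have r := Hyp_ip_lt0 hy0 hy'.
      rewrite /c; nra.
    by rewrite sE.
  have B'x : B' *m x = (e' * e) *: (g *m (B *m x)).
    by rewrite By' By y'E -scalemxAr scalerA mulrAC -mulrA ee// mulr1.
  have [E|E] : e' * e = 1 \/ e' * e = -1.
    by case: he => ->; case: he' => ->; rewrite ?mulr1 ?mul1r ?mulrNN ?mulr1; [left|right|right|left].
  - exists (B' - g *m B); first by rewrite mem_cat; apply/orP; left; apply/mapP; exists g.
    by rewrite mulmxBl -mulmxA B'x E scale1r subrr.
  - exists (B' + g *m B); first by rewrite mem_cat; apply/orP; right; apply/mapP; exists g.
    by rewrite mulmxDl -mulmxA B'x E scaleN1r addNr.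
have sS g : g \in s -> grp M g by move=> gs; have : [set` s] g := gs; rewrite -sE => -[].
move: Nt; rewrite mem_cat => /orP[] /mapP[g gs NE].
  exists g, 1; split; [exact: sS | by left | move=> x xv].
  have := N0 x xv; rewrite NE mulmxBl -mulmxA scale1r => /eqP.
  by rewrite subr_eq0 => /eqP.
exists g, (-1); split; [exact: sS | by right | move=> x xv].
have := N0 x xv; rewrite NE mulmxDl -mulmxA scaleN1r => /eqP.
by rewrite addr_eq0 => /eqP.
Qed.

Lemma isom_fixing_hyperplane (R : realType) (n : nat) (E : 'M[R]_n.+1) v :
  ip v v = 1 -> form_iso (lorentz R n) (lorentz R n) E ->
  (forall x, ip x v = 0 -> E *m x = x) -> E = 1%:M \/ E = refl_mx (lorentz R n) v.
Proof.
move=> vv oE Ex.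
have Eip x y : ip (E *m x) (E *m y) = ip x y.
  exact: form_iso_bil (lorentz_sym R n) (lorentz_sym R n) oE.
pose c := ip (E *m v) v.
have orth_v z : ip (z - ip z v *: v) v = 0 by rewrite !bilE vv; ring.
have Ev : E *m v = c *: v.
  apply/eqP; rewrite -subr_eq0; apply/eqP; set w := _ - _.
  have wv : ip w v = 0 by exact: orth_v.
  have w0 z : ip z w = 0.
    have zE : z = (z - ip z v *: v) + ip z v *: v by rewrite subrK.
    rewrite zE bilDl bilZl (ipC v w) wv mulr0 addr0 -(Ex _ (orth_v z)) /w bilDr Eip.
    by rewrite (Ex _ (orth_v z)) orth_v bilNr bilZr orth_v; ring.
  by apply/matrixP => i j; rewrite ord1 [RHS]mxE -(ip_co i) ipC; exact: w0.
have cc : c * c = 1 by have := Eip v v; rewrite Ev !bilE vv mulr1.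
have act x : E *m x = x + (ip x v * (c - 1)) *: v.
  have xE : x = (x - ip x v *: v) + ip x v *: v by rewrite subrK.
  rewrite {1}xE mulmxDr Ex// -scalemxAr Ev scalerA mulrBr mulr1 scalerBl.
  by rewrite addrA addrAC.
have : (c - 1) * (c + 1) == 0 by rewrite -subr_sqr expr1n expr2 cc subrr.
rewrite mulf_eq0 => /orP[/eqP c1|]; first by left; apply: mx_ext => x; rewrite act c1 mulr0 scale0r addr0 mul1mx.
rewrite addr_eq0 => /eqP c1; right; apply: mx_ext => x.
rewrite act refl_mxE vv c1 -scaleNr; congr (_ + _ *: _).
by rewrite (ipC v x) divr1; ring.
Qed.

(** After moving the first hyperplane to the second by a deck transformation, the two
lifts agree on a hyperplane up to a deck transformation and a sign, and an isometry
is determined by its restriction to a hyperplane up to the reflection in it. *)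
Lemma extensions_related (R : realType) (n : nat) (M1 M2 : hyp_manifold R n)
    (N1 N2 : set (set 'cV[R]_n.+1))
    (phi : set 'cV[R]_n.+1 -> set 'cV[R]_n.+1)
    (m1 m1' : model M1) (m2 m2' : model M2) (R1 R1' R2 R2' : set 'cV[R]_n.+1)
    (A A' : 'M[R]_n.+1) :
  is_extension N1 N2 phi m1 m2 R1 R2 A ->
  is_extension N1 N2 phi m1' m2' R1' R2' A' ->
  exists v1 v2 g1 g2 E (e : R),
    [/\ boundary_normal (Defs.cover M1) v1 /\ boundary_normal (Defs.cover M2) v2,
        grp M1 g1 /\ grp M2 g2, e = 1 \/ e = -1,
        E = 1%:M \/ E = refl_mx (lorentz R n) v1 &
        invmx (dev m2') *m A' *m dev m1' =
        (e *: g2) *m (invmx (dev m2) *m A *m dev m1) *m E *m g1].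
Proof.
move=> hA hA'.
have [v1 [v2 [bv1 bv2 N1E oB hB]]] := extension_lift hA.
have [v1' [v2' [bv1' bv2' N1E' oB' hB']]] := extension_lift hA'.
set B := _ *m _ *m _ in oB hB *; set B' := _ *m _ *m _ in oB' hB' *.
have [g1 gg1 g1v] := lifts_conjugate bv1 bv1' (etrans N1E (esym N1E')).
have [uv1 _ _] := bv1; have ig1 := grp_isom gg1.
have oB'g : form_iso (lorentz R n) (lorentz R n) (B' *m g1).
  exact: form_iso_comp ig1.1 oB'.
have [x Px|g2 [e [gg2 he BE]]] := @uniform_deck _ _ M2 v1 B (B' *m g1) uv1 oB oB'g.
  have [e [y [he hy By py]]] := hB _ Px.
  have [|e' [y' [he' hy' By' py']]] := hB' (g1 *m x).
    by rewrite -g1v; split; [exact: isom_Hyp Px.1 | rewrite isom_ip//; exact: Px.2].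
  exists e, e', y, y'; split => //; first by split => //; rewrite -mulmxA.
  by rewrite py py' proj_grp.
have ug2 := grp_unit gg2; have [uB _] := oB; have ug1 := grp_unit gg1.
have ee : e * e = 1 by case: he => ->; ring.
have oI : form_iso (lorentz R n) (lorentz R n) (g2 *m B).
  exact: form_iso_comp oB (grp_isom gg2).1.
have ugB : g2 *m B \in unitmx by case: oI.
(* the isometry E measures the difference of the two lifts on the line of the normal *)
pose E := e *: (invmx (g2 *m B) *m (B' *m g1)).
have oE : form_iso (lorentz R n) (lorentz R n) E.
  have [uC hC] := form_iso_comp oB'g (form_iso_inv oI).
  have u_e : e \is a GRing.unit by case: he => ->; rewrite ?unitrN ?unitr1.
  split; first by rewrite unitmxZ.
  by move=> x; rewrite /qf -scalemxAl bilZl bilZr mulrA ee mul1r; exact: hC.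
have Efix x : ip x v1 = 0 -> E *m x = x.
  move=> xv; rewrite -scalemxAl -mulmxA BE// -scalemxAr scalerA ee scale1r.
  by rewrite [g2 *m (B *m x)]mulmxA mulKmx.
exists v1, v2, (invmx g1), g2, E, e; split => //.
- by split => //; exact: grpV.
- exact: isom_fixing_hyperplane uv1 oE Efix.
rewrite -!scalemxAl -scalemxAr -scalemxAl scalerA ee scale1r.
by rewrite mulKVmx// mulmxK.
Qed.

(** * Transfer of the field of definition *)

(** The two extensions differ by changes of models, deck transformations and reflections
in boundary hyperplanes, all of which are rational over the trace fields. *)
Lemma definition_field_candidate_transfer (R : realType) (n : nat)
    (M1 M2 : hyp_manifold R n.+2) (N1 N2 : set (set 'cV[R]_n.+3))
    (phi : set 'cV[R]_n.+3 -> set 'cV[R]_n.+3)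
    (m1 m1' : model M1) (m2 m2' : model M2) (R1 R1' R2 R2' : set 'cV[R]_n.+3)
    (A A' : 'M[R]_n.+3) (K : set R) :
  is_extension N1 N2 phi m1 m2 R1 R2 A ->
  is_extension N1 N2 phi m1' m2' R1' R2' A' ->
  definition_field_candidate M2 m1 A K -> definition_field_candidate M2 m1' A' K.
Proof.
move=> hA hA' [KK kK hK]; split => //.
have [_ [uA _] _ _] := hA.
have [v1 [v2 [g1 [g2 [E [e [[bv1 bv2] [gg1 gg2] he hE BE]]]]]]] :=
  extensions_related hA hA'.
have uD1 := dev_unit m1; have uD1' := dev_unit m1'.
have uD2 := dev_unit m2; have uD2' := dev_unit m2'.
have k1K : trace_field M1 `<=` K.
  by move=> x kx; apply: kK; apply: gen_field_sub; left.
have k2K : trace_field M2 `<=` K.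
  by move=> x kx; apply: kK; apply: gen_field_sub; right.
pose P := (dev m2' *m invmx (dev m2)) *m (e *: (dev m2 *m g2 *m invmx (dev m2))).
pose Q := (dev m1 *m E *m invmx (dev m1)) *m (dev m1 *m g1 *m invmx (dev m1)) *m
  (dev m1 *m invmx (dev m1')).
have -> : A' = P *m A *m Q.
  have -> : P *m A *m Q = dev m2' *m ((e *: g2) *m (invmx (dev m2) *m A *m dev m1) *m
      E *m g1) *m invmx (dev m1').
    rewrite /P /Q -!(scalemxAr, scalemxAl); congr (_ *: _).
    by rewrite !mulmxA !mulmxKV.
  by rewrite -BE !mulmxA mulmxV// mul1mx mulmxK.
have oE : form_iso (lorentz R n.+2) (lorentz R n.+2) E.
  case: hE => ->; first by split=> [|x]; rewrite ?unitmx1 ?mul1mx.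
  by split=> [|x]; [exact: refl_mx_unit | exact: refl_mx_bil (lorentz_sym _ _)].
have sgn (k : set R) (X : 'M[R]_n.+3) : po_rational k X -> po_rational k (e *: X).
  by case: he => -> hX; rewrite ?scale1r ?scaleN1r//; exact: po_rationalN.
apply: (conj_defined_transfer KK uA) hK.
- have u_e : e \is a GRing.unit by case: he => ->; rewrite ?unitrN ?unitr1.
  by rewrite /P !unitmx_mul unitmxZ// !unitmx_mul !unitmx_inv uD2' uD2 (grp_unit gg2).
- apply: (po_rationalM KK); apply: (po_rational_sub k2K).
    exact: model_change_rational bv2.
  by apply: sgn; exact: dev_grp_rational.
- apply: form_iso_comp (form_iso_comp (form_iso_inv (dev_iso m1')) (dev_iso m1)) _.
  exact: form_iso_comp (isom_model m1 (grp_isom gg1).1) (isom_model m1 oE).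
- apply: (po_rationalM KK); last first.
    by apply: (po_rational_sub k1K); exact: model_change_rational bv1.
  apply: (po_rationalM KK); apply: (po_rational_sub k1K); last exact: dev_grp_rational.
  case: hE => ->; last exact: reflection_rational.
  rewrite mulmx1 mulmxV//; apply: rat_po_rational.
  by apply: rat_mx1; exact: trace_field_subfield.
Qed.

Lemma field_of_definition_transfer (R : realType) (n : nat)
    (M1 M2 : hyp_manifold R n.+2) (N1 N2 : set (set 'cV[R]_n.+3))
    (phi : set 'cV[R]_n.+3 -> set 'cV[R]_n.+3)
    (m1 m1' : model M1) (m2 m2' : model M2) (R1 R1' R2 R2' : set 'cV[R]_n.+3)
    (A A' : 'M[R]_n.+3) (K : set R) :
  is_extension N1 N2 phi m1 m2 R1 R2 A ->
  is_extension N1 N2 phi m1' m2' R1' R2' A' ->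
  is_field_of_definition m1 m2 A K -> is_field_of_definition m1' m2' A' K.
Proof.
move=> hA hA' [_ cK minK]; have [_ isoA' _ _] := hA'; split => //.
  exact: definition_field_candidate_transfer hA hA' cK.
by move=> K' cK'; apply: minK; exact: definition_field_candidate_transfer hA' hA cK'.
Qed.

Theorem lemma2p2 (R : realType) (n : nat) (hn : (2 <= n)%N)
    (M1 M2 : hyp_manifold R n)
    (N1 N2 : set (set 'cV[R]_n.+1))
    (phi : set 'cV[R]_n.+1 -> set 'cV[R]_n.+1)
    (hphi : gluing_isometry M1 M2 N1 N2 phi)
    (m1 m1' : model M1) (m2 m2' : model M2)
    (R1 R1' R2 R2' : set 'cV[R]_n.+1)
    (A A' : 'M[R]_n.+1)
    (hA : is_extension N1 N2 phi m1 m2 R1 R2 A)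
    (hA' : is_extension N1 N2 phi m1' m2' R1' R2' A')
    (K : set R) :
  is_field_of_definition m1 m2 A K <-> is_field_of_definition m1' m2' A' K.
Proof.
case: n hn M1 M2 N1 N2 phi hphi m1 m1' m2 m2' R1 R1' R2 R2' A A' hA hA'.
  by [].
case=> [//|n] _ M1 M2 N1 N2 phi _ m1 m1' m2 m2' R1 R1' R2 R2' A A' hA hA'.
by split; apply: field_of_definition_transfer; eassumption.
Qed.
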